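(* Let $(X_n)$ be deterministic $n\times p$ matrices with SVD $X_n=U_nL_nV_n^\top$, $\limsup_n\ell_{n,1}/\ell_{n,p}<\infty$ and $\liminf_n\min_{i\in[p-1]}\ell_{n,i}/\ell_{n,i+1}>1$. Let $u_{n,i}\in\mathbb R^p$, $i\in[n]$, be the rows of $U_n$ and $G_n=n\sum_{i=1}^n(u_{n,i}u_{n,i}^\top)\otimes(u_{n,i}u_{n,i}^\top)$. Suppose $(U_n)$ satisfies: for some $0<c_0<C_0$, $c_0I_{p(p+1)/2}\preceq D_p^\top G_nD_p\preceq C_0I_{p(p+1)/2}$; and for all (nonzero) upper triangular $\Phi\in\mathbb R^{p\times p}$, $\max_{i\in[n]}(u_{n,i}^\top\Phi u_{n,i})^2\big/\sum_{i=1}^n(u_{n,i}^\top\Phi u_{n,i})^2\to0$. Let $S_{m,n}$ be the uniform subsampling matrices, $\gamma_n=m/n$, and suppose that $$\sqrt{\frac m{1-\gamma_n}}\,(D_p^\top G_nD_p)^{-1/2}D_p^\top\mathrm{vec}(U_n^\top S_{m,n}^\top S_{m,n}U_n-I_p)\Rightarrow\mathcal N(0,I_{p(p+1)/2}).$$ Then for any $i\in[p]$, $$\sqrt{\frac m{(1-\gamma_n)\,n\sum_{k=1}^n(U_n)_{ki}^4}}\;\hat\Lambda_{m,n,i}^{-1}(\hat\Lambda_{m,n,i}-\Lambda_{n,i})\Rightarrow\mathcal N(0,1).$$ Let $\tilde X_{m,n}=S_{m,n}X_n=\tilde U_{m,n}\hat L_{m,n}\hat V_{m,n}^\top$ be the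 SVD of $\tilde X_{m,n}$. If $\liminf\gamma_n>0$, then $$\frac1{\sqrt{(1-\gamma_n)\sum_{j}(\tilde U_{m,n})_{ji}^4}}\;\hat\Lambda_{m,n,i}^{-1}(\hat\Lambda_{m,n,i}-\Lambda_{n,i})\Rightarrow\mathcal N(0,1),$$ the sum being over all rows $j$ of $\tilde U_{m,n}$. Moreover, for any unit vector $c\in\mathbb R^p$ with $\liminf_{n\to\infty}c^\top\Delta_{n,i}c>0$, $$\sqrt{m/(1-\gamma_n)}\,(c^\top\hat\Delta_{m,n,i}c)^{-1/2}c^\top(\hat v_{m,n,i}-v_{n,i})\Rightarrow\mathcal N(0,1).$$
   Context: Asymptotic regime: $p$ fixed, $n\to\infty$, $m=m_n\to\infty$, $m<n$. Uniform subsampling: $S_{m,n}=\sqrt{n/m}\,\mathrm{diag}(B_1,\dots,B_n)$ with i.i.d. $B_i\sim$ Bernoulli$(m/n)$. SVD: $U_n$ is $n\times p$ with orthonormal columns, $L_n=\mathrm{diag}(\ell_{n,1},\dots,\ell_{n,p})$, $\ell_{n,1}\ge\dots\ge\ell_{n,p}>0$, $V_n$ is $p\times p$ orthogonal; the SVD of $\tilde X_{m,n}$ is of the same thin form. For a symmetric $p\times p$ matrix $\Xi$, $\lambda_i(\Xi)$ is its $i$-th largest eigenvalue and $v_i(\Xi)$ an associated unit eigenvector whose first nonzero coordinate is positive. $\Lambda_{n,i}=\lambda_i(X_n^\top X_n)$, $v_{n,i}=v_i(X_n^\top X_n)$, $\hat\Lambda_{m,n,i}=\lambda_i(X_n^\top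 S_{m,n}^\top S_{m,n}X_n)$, $\hat v_{m,n,i}=v_i(X_n^\top S_{m,n}^\top S_{m,n}X_n)$. $\mathrm{vec}$ stacks columns, $\mathrm{vec}(A)_{(ij)}=A_{ij}$; $D_p$ is the $p^2\times p(p+1)/2$ matrix $(D_p)_{(ij),(kl)}=\delta_{ik}\delta_{jl}$, $k\le l$. In coordinates $(G_n)_{(ij),(kl)}=n\sum_{h=1}^n(U_n)_{hi}(U_n)_{hj}(U_n)_{hk}(U_n)_{hl}$. $$\Delta_{n,i}=\sum_{k\ne i,\,l\ne i}\frac{\Lambda_{n,i}\sqrt{\Lambda_{n,k}\Lambda_{n,l}}}{(\Lambda_{n,i}-\Lambda_{n,k})(\Lambda_{n,i}-\Lambda_{n,l})}(G_n)_{(ik),(il)}v_{n,k}v_{n,l}^\top,$$ and $\hat\Delta_{m,n,i}$ is given by the same formula with $\hat\Lambda_{m,n,\cdot}$, $\hat v_{m,n,\cdot}$ in place of $\Lambda_{n,\cdot}$, $v_{n,\cdot}$ (and the same $G_n$). If the eigenvalues involved are not distinct, the matrix is formally set to $\infty\cdot I_p$, so that $(c^\top\hat\Delta_{m,n,i}c)^{-1/2}=0$.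
   Formalization: Eigenvector claim, false as stated: proved with sample eigenvector signs matched to v_{n,k}; for the stated sign rule only if sqrt(m/(1-γ_n)) times first coordinate of v_{n,k} tends to +∞ (k=i; all k if p≥3). Columns of V_n are taken to be the v_{n,k}. *)

(* Defs.v *)
From HB Require Import structures.
From mathcomp Require Import all_boot all_order all_algebra.
From mathcomp Require Import all_classical all_reals all_analysis.
From mathcomp Require Import mxtens.
Set Implicit Arguments.
Unset Strict Implicit.
Unset Printing Implicit Defensive.
Import Order.TTheory GRing.Theory Num.Theory.
Import numFieldNormedType.Exports.
Local Open Scope classical_set_scope.
Local Open Scope ring_scope.

Section matrices.
Context {R : realType}.
Implicit Types n p : nat.

Definition dotv p (x y : 'cV[R]_p) : R := (x^T *m y) 0 0.

Definition qform p (A : 'M[R]_p) (x : 'cV[R]_p) : R := dotv x (A *m x).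

Definition psd_mx p (A : 'M[R]_p) := A^T = A /\ forall x, 0 <= qform A x.

Definition pd_mx p (A : 'M[R]_p) :=
  A^T = A /\ forall x, x != 0 -> 0 < qform A x.

(* The Loewner order. *)
Definition loewner_le p (A B : 'M[R]_p) := psd_mx (B - A).

(* A^{-1/2}; meaningful for symmetric positive definite A, where the matrix B
   below exists and is unique. *)
Definition inv_sqrt_mx p (A : 'M[R]_p) : 'M[R]_p :=
  xget 0 [set B : 'M[R]_p | pd_mx B /\ B *m B = invmx A].

Definition gram n p (X : 'M[R]_(n, p)) : 'M[R]_p := X^T *m X.

(* The eigenvalues of a symmetric matrix, counted with multiplicity, in
   nonincreasing order: entry i is the (i+1)-st largest one. *)
Definition eigvals p (A : 'M[R]_p) : 'rV[R]_p :=
  xget 0 [set lam : 'rV[R]_p |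
    (forall i j : 'I_p, (i <= j)%N -> lam 0 j <= lam 0 i) /\
    char_poly A = \prod_(i < p) ('X - (lam 0 i)%:P)].

Definition first_nonzero_pos p (x : 'cV[R]_p) :=
  exists k : 'I_p, 0 < x k 0 /\ forall j : 'I_p, (j < k)%N -> x j 0 = 0.

Definition is_eigvec p (A : 'M[R]_p) (i : 'I_p) (x : 'cV[R]_p) :=
  [/\ A *m x = eigvals A 0 i *: x, dotv x x = 1 & first_nonzero_pos x].

(* Thin SVD. Null singular values are allowed: a subsampled matrix is rank
   deficient with positive probability. *)
Definition thin_svd n p (X : 'M[R]_(n, p)) (U : 'M[R]_(n, p)) (l : 'rV[R]_p)
    (V : 'M[R]_p) :=
  [/\ U^T *m U = 1%:M,
      V^T *m V = 1%:M,
      forall i j : 'I_p, (i <= j)%N -> l 0 j <= l 0 i,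
      forall i, 0 <= l 0 i
    & X = U *m diag_mx l *m V^T].

(* The position of entry (i, j) in the column-stacked vec of a p x p matrix. *)
Definition vec_idx p (i j : 'I_p) : 'I_(p * p) := mxtens_index (j, i).

Definition vec p (A : 'M[R]_p) : 'cV[R]_(p * p) :=
  \col_k A (mxtens_unindex k).2 (mxtens_unindex k).1.

Lemma vecE p (A : 'M[R]_p) i j : vec A (vec_idx i j) 0 = A i j.
Proof. by rewrite mxE mxtens_indexK. Qed.

Definition upper_pairs p : {set 'I_p * 'I_p} :=
  finset (fun kl : 'I_p * 'I_p => (kl.1 <= kl.2)%N).

Lemma card_upper_pairs p : #|upper_pairs p| = (p * p.+1)./2.
Proof.
have inU (kl : 'I_p * 'I_p) : (kl \in upper_pairs p) = (kl.1 <= kl.2)%N.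
  by rewrite inE.
rewrite -sum1_card (eq_bigl _ _ inU).
rewrite -(pair_big_dep xpredT (fun k l : 'I_p => (k <= l)%N)
  (fun _ _ => 1%N)) /= (exchange_big_dep xpredT) //=.
rewrite (eq_bigr (fun l : 'I_p => (l : nat).+1)) => [|l _].
  rewrite -(big_mkord xpredT (fun l => l.+1)) mulnC -[RHS](bin2 p.+1).
  by rewrite -bin2_sum big_nat_recl //= add0n.
by rewrite -(big_ord_widen p (fun=> 1%N) (ltn_ord l)) sum1_card card_ord.
Qed.

(* The columns of D_p are indexed by an enumeration of the pairs k <= l. *)
Definition Dmx p : 'M[R]_(p * p, #|upper_pairs p|) :=
  \matrix_(r, s) (r == vec_idx (enum_val s).1 (enum_val s).2)%:R.

Definition Gmx n p (U : 'M[R]_(n, p)) : 'M[R]_(p * p) :=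
  n%:R *: \sum_(h < n)
    tensmx ((row h U)^T *m row h U) ((row h U)^T *m row h U).

Lemma GmxE n p (U : 'M[R]_(n, p)) i j k l :
  Gmx U (vec_idx i j) (vec_idx k l) =
  n%:R * \sum_(h < n) U h i * U h j * U h k * U h l.
Proof.
rewrite mxE summxE; congr (_ * _); apply: eq_bigr => h _.
rewrite tensmxE !mxE !big_ord1 !mxE.
by rewrite mulrC mulrACA mulrA.
Qed.

(* D^T G D for the matrix G attached to U. *)
Definition DGD n p (U : 'M[R]_(n, p)) : 'M[R]_#|upper_pairs p| :=
  (Dmx p)^T *m Gmx U *m Dmx p.

Definition Deltamx p (lam : 'rV[R]_p) (v : 'I_p -> 'cV[R]_p)
    (G : 'M[R]_(p * p)) (i : 'I_p) : 'M[R]_p :=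
  \sum_(k < p | k != i) \sum_(l < p | l != i)
    (lam 0 i * Num.sqrt (lam 0 k * lam 0 l)
       / ((lam 0 i - lam 0 k) * (lam 0 i - lam 0 l))
       * G (vec_idx i k) (vec_idx i l))
    *: (v k *m (v l)^T).

(* c^T Delta c for a unit vector c, with Delta = oo.I when the eigenvalues are
   not distinct. *)
Definition Delta_form p (lam : 'rV[R]_p) (v : 'I_p -> 'cV[R]_p)
    (G : 'M[R]_(p * p)) (i : 'I_p) (c : 'cV[R]_p) : \bar R :=
  if injectiveb (lam 0) then (qform (Deltamx lam v G i) c)%:E else +oo%E.

(* x^{-1/2}, with (+oo)^{-1/2} = 0. *)
Definition inv_sqrt_ereal (x : \bar R) : R := fine (sqrte x)^-1.

Definition align_sign p (x y : 'cV[R]_p) : 'cV[R]_p :=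
  if 0 <= dotv x y then y else - y.

(* sqrt(n/m) diag(b_1, ..., b_n) *)
Definition subsample_mx (m n : nat) (b : 'I_n -> bool) : 'M[R]_n :=
  Num.sqrt (n%:R / m%:R) *: diag_mx (\row_i (b i)%:R).

End matrices.

Section std_normal.
Context (R : realType) (d : nat).

Definition cons_pair (x : measurableTypeR R * d.-tuple R) : d.+1.-tuple R :=
  [tuple of x.1 :: x.2].

Lemma measurable_cons_pair : measurable_fun setT cons_pair.
Proof. exact: measurable_cons. Qed.

HB.instance Definition _ :=
  isMeasurableFun.Build _ _ _ _ _ measurable_cons_pair.

End std_normal.

(* N(0, I_d), as the d-fold product of N(0, 1). *)
Fixpoint std_normal (R : realType) (d : nat) : probability (d.-tuple R) R :=
  if d is d'.+1 then
    distribution (normal_prob 0 1 \x std_normal R d')%E (cons_pair (d := d'))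
  else \d_[tuple].

Definition col_of_tuple (R : realType) (d : nat) (t : d.-tuple R) : 'cV[R]_d :=
  \col_i tnth t i.

Section probability.
Context {R : realType}.

(* Convergence in distribution of Y_n, each defined on its own probability
   space, to the random element Z. *)
Definition cvg_in_law (d : nat -> measure_display)
    (T : forall n, measurableType (d n)) (P : forall n, probability (T n) R)
    (E : topologicalType) (Y : forall n, T n -> E)
    (d' : measure_display) (T' : measurableType d') (Q : probability T' R)
    (Z : T' -> E) :=
  forall f : E -> R, continuous f -> (exists M, forall x, `|f x| <= M) ->
    (fun n => \int[P n]_w (f (Y n w))%:E)%E @ \oo -->
    (\int[Q]_z (f (Z z))%:E)%E.

Definition cvg_std_normal (d : nat -> measure_display)
    (T : forall n, measurableType (d n)) (P : forall n, probability (T n) R)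
    (Y : forall n, T n -> R) :=
  cvg_in_law P Y (normal_prob 0 1) (fun z => z).

Definition cvg_std_normal_vec (d : nat -> measure_display)
    (T : forall n, measurableType (d n)) (P : forall n, probability (T n) R)
    (q : nat) (Y : forall n, T n -> 'cV[R]_q) :=
  cvg_in_law P Y (std_normal R q) (@col_of_tuple R q).

Definition mutually_independent (d : measure_display) (T : measurableType d)
    (P : probability T R) (d' : measure_display) (T' : measurableType d')
    (I : finType) (Y : I -> {RV P >-> T'}) :=
  forall (J : {set I}) (A : I -> set T'), (forall i, measurable (A i)) ->
    P (\bigcap_(i in [set` J]) (Y i @^-1` A i)) =
    (\prod_(i in J) P (Y i @^-1` A i))%E.

Definition iid_bernoulli (d : measure_display) (T : measurableType d)
    (P : probability T R) (I : finType) (B : I -> {RV P >-> bool}) (q : R) :=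
  mutually_independent B /\
  forall i (A : set bool), distribution P (B i) A = bernoulli_prob q A.

End probability.

(* Main.v *)
Require Import Defs.
From HB Require Import structures.
From mathcomp Require Import all_boot all_order all_algebra.
From mathcomp Require Import all_classical all_reals all_analysis.
From mathcomp Require Import perm measurable_realfun.
From mathcomp Require Import ring lra.
Set Implicit Arguments.
Unset Strict Implicit.
Unset Printing Implicit Defensive.
Import Order.TTheory GRing.Theory Num.Theory.
Import numFieldNormedType.Exports.
Local Open Scope classical_set_scope.
Local Open Scope ring_scope.

(** Write W = U^T S^T S U - 1 for the sampling error of the Gram matrix of the
    left singular vectors. Then X^T S^T S X = V L (1 + W) L V^T, so in the basis V
    the sampled Gram matrix is the diagonal matrix L^2 perturbed by L W L. The
    assumed central limit theorem makes the entries of W of order 1 / rate in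
    probability, and the conditions on the singular values keep them spaced up to
    a common scale, so that first-order perturbation theory holds with constants
    that do not depend on n ([frame_perturbation], [sample_expansion]). Up to an
    error of order W^2, the relative error of the i-th eigenvalue is W_(i, i), and
    the k-th coordinate of the error of the i-th eigenvector, its sign being
    matched, is l_k l_i / (l_i^2 - l_k^2) W_(k, i). Multiplied by rate the error
    still vanishes ([rateE2_cvg0]), so each statistic is a linear form in W up to
    a term that tends to zero in probability.

    The coefficients of this form depend on n. [cramer_wold] extends the central
    limit theorem to such moving directions, using the compactness of the sphere,
    and [form_clt] restates it for the non-whitened forms a.W: their variance is
    a^T (D^T G D) a / rate^2. For eigenvalues this is
    n * sum_k U_(k, i)^4 / rate^2, and for the eigenvector functional it is
    c^T Delta c / rate^2 ([qform_Deltamx]).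

    It remains to replace these variances by their sample versions, with the lemma
    of Slutsky. The plug-in value of c^T Delta c differs from the true one by a
    multiple of the size of W ([variance_perturb]). For the studentized
    eigenvalues, a left singular vector of S X is close to S times that of X
    ([left_vector_expansion]), so the sum of its fourth powers is close to
    (n / m)^2 sum_j B_j U_(j, i)^4, which a law of large numbers controls because no
    U_(j, i)^4 dominates the sum ([sampled_pow4_cvg]).

    If rate times the first coordinate of v_k diverges, then the first coordinate
    of the aligned sample eigenvector is positive with probability tending to one,
    and the two sign conventions agree ([aligned_sample_eigvec]). With only two
    singular values Delta is quadratic in the single other eigenvector, whose sign
    is therefore irrelevant. *)

(** * Gaussian integrals *)

Lemma bounded_integrable (R : realType) d (T : measurableType d) (P : probability T R)
    (g : T -> R) K :
  measurable_fun setT g -> (forall x, `|g x| <= K) ->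
  P.-integrable setT (EFin \o g).
Proof.
move=> mg gK; apply: measurable_bounded_integrable => //.
  by rewrite -ge0_fin_numE //; exact: fin_num_measure.
exists K; split; first exact: num_real.
by move=> x xK y _; exact: le_trans (gK y) (ltW xK).
Qed.

Section gaussian.
Context {R : realType}.
Local Notation mu := (@lebesgue_measure R).
Implicit Types (f : R -> R) (s t M : R).

Lemma integral_normal_prob (m s : R) (f : R -> \bar R) :
  (normal_prob m s).-integrable setT f ->
  (\int[normal_prob m s]_x f x = \int[mu]_x (f x * (normal_pdf m s x)%:E))%E.
Proof.
move=> intf; have mf := measurable_int _ intf.
rewrite -(Radon_Nikodym_change_of_variables (normal_prob_dominates m s))//=.
apply: ae_eq_integral => //.
- apply: emeasurable_funM => //; apply: (measurable_int mu).
  by apply: Radon_Nikodym_integrable; exact: normal_prob_dominates.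
- apply: emeasurable_funM => //; apply/measurable_EFinP.
  exact: measurable_normal_pdf.
- apply: ae_eqe_mul2l => /=.
  rewrite Radon_NikodymE//=; first exact: normal_prob_dominates.
  move=> dom; case: cid => /= h [h1 h2 h3].
  apply: integral_ae_eq => //=.
  + by apply/measurable_EFinP; exact: measurable_normal_pdf.
  + by move=> E _ mE'; rewrite -h3.
Qed.

(** The substitution rules are stated on half-lines, hence the split at 0. *)
Lemma ge0_integral_oppT f : continuous f -> (forall x, 0 <= f x) ->
  (\int[mu]_x (f (- x))%:E = \int[mu]_x (f x)%:E)%E.
Proof.
have half (g : R -> R) : continuous g -> (forall x, 0 <= g x) ->
  (\int[mu]_(x in `]-oo, (0 : R)%R]) (g x)%:E =
   \int[mu]_(x in `[(0 : R)%R, +oo[) (g (- x)%R)%:E)%E.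
  move=> cg g0; rewrite -[X in `]-oo, X]]oppr0 ge0_integration_by_substitutionNy //.
  exact: continuous_subspaceT.
have split (g : R -> R) : continuous g -> (forall x, 0 <= g x) ->
  (\int[mu]_x (g x)%:E = \int[mu]_(x in `]-oo, (0 : R)%R]) (g x)%:E +
   \int[mu]_(x in `[(0 : R)%R, +oo[) (g x)%:E)%E.
  move=> cg g0.
  have mg : measurable_fun setT g by exact: continuous_measurable_fun.
  have -> : [set: R] = `]-oo, (0 : R)] `|` `](0 : R), +oo[.
    by apply/seteqP; split=> // x _ /=; rewrite !in_itv/= andbT; case: (leP x 0); [left|right].
  rewrite ge0_integral_setU //=; last first.
  - apply/disj_setPS => x /= []; rewrite !in_itv /= andbT => x0.
    by rewrite ltNge x0.
  - by move=> x _; rewrite lee_fin.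
  - by apply/measurable_EFinP; exact: measurable_funTS.
  by congr (_ + _)%E; rewrite integral_itv_obnd_cbnd //; apply/measurable_EFinP; exact: measurable_funTS.
move=> cf f0.
have cfN : continuous (fun x => f (- x)).
  by move=> x; apply: continuous_comp; [exact: opp_continuous|exact: cf].
rewrite (split _ cfN) // (split f) // addeC (half _ cfN) // (half f) //.
by under [X in (_ + X = _)%E]eq_integral do rewrite opprK.
Qed.

Lemma ge0_integral_affine (a b : R) f : 0 < b ->
  continuous f -> (forall x, 0 <= f x) ->
  (\int[mu]_u (f u)%:E = \int[mu]_y (f (a + b * y) * b)%:E)%E.
Proof.
move=> b0 cf f0; pose F y := a + b * y.
have dF (y : R) : is_derive y 1 F b.
  rewrite /F; by apply: is_derive_eq; rewrite add0r mul1r /GRing.scale /= mulr1.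
have F'E : F^`()%classic = cst b.
  by apply/funext => y; rewrite derive1E (@derive_val _ _ _ _ _ _ _ (dF y)).
rewrite (increasing_ge0_integration_by_substitutionT (F := F)) //.
- by apply: eq_integral => y _; rewrite F'E.
- by move=> x y xy; rewrite /F ltrD2l ltr_pM2l.
- by rewrite F'E => x; exact: cvg_cst.
- by rewrite F'E; exact: is_cvg_cst.
- by rewrite F'E; exact: is_cvg_cst.
- have -> : F = (fun y => (y + a / b) * b).
    by apply/funext => y; rewrite /F mulrDl divfK ?gt_eqF // addrC mulrC.
  by apply/(gt0_cvgMlNy b0); exact: cvg_addrr_Ny.
- have -> : F = (fun y => (y + a / b) * b).
    by apply/funext => y; rewrite /F mulrDl divfK ?gt_eqF // addrC mulrC.
  by apply/(gt0_cvgMly b0); exact: cvg_addrr.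
Qed.

Lemma normal_peak_scale (c : R) : 0 <= c ->
  normal_peak c = c^-1 * normal_peak 1.
Proof.
move=> c0; rewrite /normal_peak -mulrnAr sqrtrM ?sqr_ge0 // invfM.
by rewrite sqrtr_sqr ger0_norm // expr1n mul1r.
Qed.

Lemma normal_pdf_affine (a t y : R) : 0 < t ->
  normal_pdf a t (a + t * y) * t = normal_pdf 0 1 y.
Proof.
move=> t0; rewrite !normal_pdfE ?oner_neq0 ?gt_eqF //.
rewrite (normal_peak_scale (ltW t0)) /normal_fun.
transitivity (normal_peak 1 * expR (- (a + t * y - a) ^+ 2 / (t ^+ 2 *+ 2))).
  by field; rewrite gt_eqF.
congr (_ * expR _).
by field; rewrite gt_eqF.
Qed.

(** Completing the square: the joint density of (X, sX + tY) factors as the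
    density of sX + tY times the conditional density of X. *)
Lemma normal_pdf_condition (s t x u : R) : 0 < t ->
  let r := Num.sqrt (s ^+ 2 + t ^+ 2) in
  normal_pdf (s * x) t u * normal_pdf 0 1 x =
  normal_pdf 0 r u * normal_pdf (s * u / r ^+ 2) (t / r) x.
Proof.
move=> t0 r; have st0 : 0 < s ^+ 2 + t ^+ 2.
  by rewrite ltr_wpDl ?sqr_ge0 // exprn_gt0.
have r0 : 0 < r by rewrite sqrtr_gt0.
have rE : r ^+ 2 = s ^+ 2 + t ^+ 2 by rewrite sqr_sqrtr // ltW.
rewrite !normal_pdfE ?oner_neq0 ?gt_eqF ?divr_gt0 //.
rewrite (normal_peak_scale (ltW t0)) (normal_peak_scale (ltW r0)).
rewrite (normal_peak_scale (ltW (divr_gt0 t0 r0))) /normal_fun.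
rewrite mulrACA [RHS]mulrACA -!expRD; congr (_ * expR _).
  by field; rewrite !gt_eqF.
rewrite expr_div_n rE.
by field; rewrite !gt_eqF.
Qed.

(** The law of s X + t Y for independent standard normal X and Y. With t > 0 the
    inner integral is over the density of s x + t Y; Tonelli and
    [normal_pdf_condition] then integrate x out first. *)
Lemma normal_linear2 (s t : R) f M : 0 <= t -> continuous f ->
  (forall x, 0 <= f x <= M) ->
  (\int[normal_prob 0 1]_x \int[normal_prob 0 1]_y (f (s * x + t * y)%R)%:E =
   \int[normal_prob 0 1]_x (f (Num.sqrt (s ^+ 2 + t ^+ 2) * x)%R)%:E)%E.
Proof.
move=> t0 cf fM.
have f0 x : 0 <= f x by case/andP: (fM x).
have aff (a b : R) : continuous (fun y : R => a + b * y).
  by move=> y; apply: cvgD; [exact: cvg_cst|apply: cvgM; [exact: cvg_cst|exact: cvg_id]].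
have cfa (a b : R) : continuous (fun y => f (a + b * y)).
  by move=> y; apply: continuous_comp; [exact: aff|exact: cf].
have densE (g : R -> R) : continuous g -> (forall x, 0 <= g x <= M) ->
    (\int[normal_prob 0 1]_x (g x)%:E = \int[mu]_x (g x * normal_pdf 0 1 x)%:E)%E.
  move=> cg gM; rewrite integral_normal_prob //.
  apply: (@bounded_integrable R _ _ (normal_prob 0 1) g M) => [|x].
    exact: continuous_measurable_fun.
  by case/andP: (gM x) => gx ?; rewrite ger0_norm.
have norm_scale a : (\int[normal_prob 0 1]_x (f (a * x))%:E =
    \int[mu]_x (f (a * x) * normal_pdf 0 1 x)%:E)%E.
  apply: densE => // x.
  by have := cfa 0 a x; under eq_fun do rewrite add0r.
(* In the degenerate case only the sign of s is at stake. *)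
have [t00|tn0] := eqVneq t 0.
  have int1 x : (\int[normal_prob 0 1]_y (f (s * x + t * y)%R)%:E = (f (s * x))%:E)%E.
    rewrite (eq_integral (cst (f (s * x))%:E)) => [|y _]; last first.
      by rewrite /= t00 mul0r addr0.
    by rewrite integral_cst //= probability_setT mule1.
  under eq_integral do rewrite int1.
  rewrite t00 expr0n addr0 sqrtr_sqr.
  have [s0|s0] := ler0P s; last by [].
  have cfs (b : R) : continuous (fun y => f (b * y)).
    by move=> x; have := cfa 0 b x; under eq_fun do rewrite add0r.
  rewrite !densE //; rewrite -[LHS]ge0_integral_oppT.
  - apply: eq_integral => x _; rewrite mulrN mulNr; congr (_ * _)%:E.
    by rewrite !normal_pdfE ?oner_neq0 // /normal_fun !subr0 sqrrN.
  - move=> x; apply: cvgM; first exact: cfs.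
    by apply: continuous_normal_pdf; rewrite oner_neq0.
  - by move=> x; rewrite mulr_ge0 // normal_pdf_ge0.
have {tn0 t0}t0 : 0 < t by rewrite lt_neqAle eq_sym tn0.
set r := Num.sqrt _.
have r0 : 0 < r by rewrite sqrtr_gt0 ltr_wpDl ?sqr_ge0 // exprn_gt0.
have int1 x : (\int[normal_prob 0 1]_y (f (s * x + t * y)%R)%:E =
   \int[mu]_u (f u * normal_pdf (s * x) t u)%:E)%E.
  rewrite densE // [RHS](ge0_integral_affine (s * x) t0).
  - by apply: eq_integral => y _; rewrite -(normal_pdf_affine (s * x) y t0) mulrA.
  - move=> y; apply: cvgM; first exact: cf.
    by apply: continuous_normal_pdf; rewrite gt_eqF.
  - by move=> y; rewrite mulr_ge0 // normal_pdf_ge0.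
have mf : measurable_fun setT f by exact: continuous_measurable_fun.
(* The same integrand, written so that its joint measurability is visible. *)
pose h (z : R * R) : R := f z.2 * (normal_pdf 0 1 ((z.2 - s * z.1) / t) / t).
have hE x u : h (x, u) = f u * normal_pdf (s * x) t u.
  rewrite /h /= -(normal_pdf_affine (s * x) _ t0) mulfK ?gt_eqF //.
  by congr (_ * normal_pdf _ _ _); field; rewrite gt_eqF.
have h0 z : 0 <= h z by case: z => x u; rewrite hE mulr_ge0 // normal_pdf_ge0.
have mh : measurable_fun setT h.
  apply: measurable_funM; first exact: measurableT_comp.
  apply: measurable_funM => //.
  apply: measurableT_comp; first exact: measurable_normal_pdf.
  apply: measurable_funM => //; apply: measurable_funB => //.
  exact: measurable_funM.
have mh1 : measurable_fun setT (fun x => \int[mu]_u (h (x, u))%:E)%E.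
  have mhE : measurable_fun setT (fun z : measurableTypeR R * measurableTypeR R => (h z)%:E).
    exact/measurable_EFinP.
  exact: (measurable_fun_fubini_tonelli_F (m2 := mu) _ mhE (fun z => h0 z)).
have mI : measurable_fun setT
    (fun x => \int[mu]_u (f u * normal_pdf (s * x) t u)%:E)%E.
  rewrite (_ : (fun _ => _) = (fun x => \int[mu]_u (h (x, u))%:E)%E) //.
  by apply/funext => x; apply: eq_integral => u _; rewrite hE.
have mpdf : measurable_fun setT (normal_pdf (0 : R) 1) by exact: measurable_normal_pdf.
under eq_integral do rewrite int1.
rewrite [LHS]integral_normal_prob; last first.
  apply/integrableP; split; first exact: mI.
  apply: (@le_lt_trans _ _ (\int[normal_prob 0 1]_(_ in [set: R]) M%:E)%E); last first.
    by rewrite integral_cst //= probability_setT mule1 ltry.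
  apply: ge0_le_integral => //.
  - exact: measurableT_comp.
  - move=> x _; rewrite gee0_abs; last first.
      by apply: integral_ge0 => u _; rewrite lee_fin mulr_ge0 // normal_pdf_ge0.
    rewrite -int1; apply: (@le_trans _ _ (\int[normal_prob 0 1]_(_ in [set: R]) M%:E)%E).
      apply: ge0_le_integral => //.
      + by move=> y _; rewrite lee_fin.
      + by apply/measurable_EFinP; exact: continuous_measurable_fun.
      + by move=> y _; rewrite lee_fin; case/andP: (fM (s * x + t * y)).
    by rewrite integral_cst //= probability_setT mule1.
under eq_integral => x _.
  rewrite muleC -ge0_integralZl //; last 3 first.
  - by apply/measurable_EFinP; apply: measurable_funM => //; exact: measurable_normal_pdf.
  - by move=> u _; rewrite lee_fin mulr_ge0 // normal_pdf_ge0.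
  - by rewrite lee_fin normal_pdf_ge0.
  over.
rewrite /=.
have -> : (\int[mu]_x \int[mu]_u ((normal_pdf 0 1 x)%:E * (f u * normal_pdf (s * x) t u)%:E) =
  \int[mu]_x \int[mu]_u (normal_pdf 0 1 x * h (x, u))%:E)%E.
  by apply: eq_integral => x _; apply: eq_integral => u _; rewrite hE.
pose k (z : measurableTypeR R * measurableTypeR R) := (normal_pdf 0 1 z.1 * h z)%:E.
have mk : measurable_fun setT k.
  by apply/measurable_EFinP; apply: measurable_funM => //; exact: measurableT_comp.
have k0 z : (0 <= k z)%E by rewrite lee_fin mulr_ge0 // normal_pdf_ge0.
apply: etrans; first exact: (fubini_tonelli (m1 := mu) (m2 := mu) k mk k0).
rewrite /k /=.
transitivity (\int[mu]_u (f u * normal_pdf 0 r u)%:E)%E.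
  apply: eq_integral => u _.
  under eq_integral => x _.
    rewrite hE mulrCA [normal_pdf 0 1 x * _]mulrC normal_pdf_condition // -/r mulrA EFinM.
    over.
  rewrite ge0_integralZl //; last 3 first.
  - by apply/measurable_EFinP; exact: measurable_normal_pdf.
  - by move=> x _; rewrite lee_fin normal_pdf_ge0.
  - by rewrite lee_fin mulr_ge0 // normal_pdf_ge0.
  by rewrite integral_normal_pdf mule1.
rewrite norm_scale [LHS](ge0_integral_affine 0 r0).
- apply: eq_integral => y _; rewrite -(normal_pdf_affine 0 y r0) mulrA.
  by rewrite !add0r.
- move=> y; apply: cvgM; first exact: cf.
  by apply: continuous_normal_pdf; rewrite gt_eqF.
- by move=> y; rewrite mulr_ge0 // normal_pdf_ge0.
Qed.

End gaussian.

(** * Dot products *)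

Section dot_product.
Context {R : realType}.
Implicit Types q : nat.

Lemma dotvE q (a b : 'cV[R]_q) : dotv a b = \sum_i a i 0 * b i 0.
Proof. by rewrite /dotv mxE; apply: eq_bigr => i _; rewrite mxE. Qed.

Lemma dotvC q (x y : 'cV[R]_q) : dotv x y = dotv y x.
Proof. by rewrite !dotvE; apply: eq_bigr => i _; rewrite mulrC. Qed.

Lemma dotvZl q a (x y : 'cV[R]_q) : dotv (a *: x) y = a * dotv x y.
Proof. by rewrite /dotv linearZ -scalemxAl mxE. Qed.

Lemma dotvZr q a (x y : 'cV[R]_q) : dotv x (a *: y) = a * dotv x y.
Proof. by rewrite dotvC dotvZl dotvC. Qed.

Lemma dotvBr q (x y z : 'cV[R]_q) : dotv x (y - z) = dotv x y - dotv x z.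
Proof.
by rewrite !dotvE -sumrB; apply: eq_bigr => i _; rewrite !mxE mulrBr.
Qed.

Lemma dotv_mulmx q (A : 'M[R]_q) (x y : 'cV[R]_q) :
  dotv x (A *m y) = dotv (A^T *m x) y.
Proof. by rewrite /dotv trmx_mul trmxK mulmxA. Qed.

Lemma dotv_delta q k (x : 'cV[R]_q) : dotv (delta_mx k 0) x = x k 0.
Proof.
rewrite dotvE (bigD1 k) //= mxE !eqxx mul1r big1 ?addr0 // => i ik.
by rewrite mxE (negbTE ik) mul0r.
Qed.

Lemma dotv_ge0 q (x : 'cV[R]_q) : 0 <= dotv x x.
Proof. by rewrite dotvE sumr_ge0 // => i _; rewrite -expr2 sqr_ge0. Qed.

Lemma dotv_eq0 q (x : 'cV[R]_q) : dotv x x = 0 -> x = 0.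
Proof.
rewrite dotvE => /eqP; rewrite psumr_eq0 => [/allP x0|i _]; last first.
  by rewrite -expr2 sqr_ge0.
apply/matrixP => i j; rewrite ord1 mxE.
by have := x0 i (mem_index_enum _); rewrite mulf_eq0 orbb => /eqP.
Qed.

Lemma coord_sqr_le q (x : 'cV[R]_q) k : x k 0 ^+ 2 <= dotv x x.
Proof.
rewrite dotvE (bigD1 k) //= expr2 lerDl sumr_ge0 // => i _.
by rewrite -expr2 sqr_ge0.
Qed.

Lemma unit_coord_le q (x : 'cV[R]_q) k : dotv x x = 1 -> `|x k 0| <= 1.
Proof.
move=> x1; rewrite -(@ler_pXn2r _ 2) ?nnegrE // expr1n real_normK ?num_real //.
by rewrite -x1 coord_sqr_le.
Qed.

End dot_product.

(** * Linear forms of Gaussian vectors *)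

Section std_normal_theory.
Context {R : realType}.
Implicit Types (f : R -> R) (M : R).

(** By induction on the dimension: given the first coordinate x, the remaining
    coordinates contribute a normal variable independent of x. This is the only
    property of the Gaussian vector that is used below. *)
Lemma std_normal_linear q (a : 'cV[R]_q) f M : continuous f ->
  (forall x, 0 <= f x <= M) ->
  (\int[std_normal R q]_z (f (dotv a (col_of_tuple z)))%:E =
   \int[normal_prob 0 1]_x (f (Num.sqrt (dotv a a) * x)%R)%:E)%E.
Proof.
have mdot k (b : 'cV[R]_k) :
    measurable_fun setT (fun z : k.-tuple R => dotv b (col_of_tuple z)).
  under eq_fun do rewrite dotvE; apply: measurable_sum => i.
  apply: measurable_funM => //.
  by under eq_fun do rewrite mxE; exact: measurable_tnth.
elim: q a f => [|q IH] a f cf fM;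
  have mf : measurable_fun setT f by exact: continuous_measurable_fun.
  have nil (b : 'cV[R]_0) : dotv a b = 0 by rewrite dotvE big_ord0.
  rewrite /= integral_dirac //; last first.
    by apply/measurable_EFinP; apply: measurableT_comp => //; exact: mdot.
  rewrite diracT mul1e !nil sqrtr0.
  rewrite (eq_integral (cst (f 0)%:E)) => [|y _]; last by rewrite /= mul0r.
  by rewrite integral_cst //= [X in (_ * X)%E]probability_setT mule1.
pose a' : 'cV[R]_q := \col_i a (lift ord0 i) 0.
have a'E : dotv a a = a ord0 0 ^+ 2 + dotv a' a'.
  rewrite !dotvE big_ord_recl expr2; congr (_ + _).
  by apply: eq_bigr => i _; rewrite !mxE.
have a'0 : 0 <= dotv a' a' by rewrite dotvE sumr_ge0 // => i _; rewrite -expr2 sqr_ge0.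
have consE x (t : q.-tuple R) :
    dotv a (col_of_tuple (cons_pair (x, t))) = a ord0 0 * x + dotv a' (col_of_tuple t).
  rewrite !dotvE big_ord_recl !mxE /= (tnth_nth 0) /=; congr (_ + _).
  by apply: eq_bigr => i _; rewrite !mxE !(tnth_nth 0).
have f0 x : 0 <= f x by case/andP: (fM x).
rewrite [std_normal R q.+1]/= ge0_integral_distribution; last 2 first.
- by apply/measurable_EFinP; apply: measurableT_comp => //; exact: mdot.
- by move=> z; rewrite lee_fin.
rewrite fubini_tonelli1 /=; last 2 first.
- apply/measurable_EFinP; apply: measurableT_comp => //.
  rewrite (_ : (fun _ => _) = (fun z : measurableTypeR R * q.-tuple R =>
      a ord0 0 * z.1 + dotv a' (col_of_tuple z.2))); last first.
    by apply/funext => -[x t]; rewrite consE.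
  apply: measurable_funD; first exact: measurable_funM.
  exact: (measurableT_comp (mdot _ a')).
- by move=> z; rewrite lee_fin.
rewrite /fubini_F a'E.
under eq_integral => x _.
  under eq_integral do rewrite /= consE.
  rewrite (IH a' (fun y => f (a ord0 0 * x + y))); last 2 first.
  - move=> y; apply: continuous_comp; last exact: cf.
    by apply: cvgD; [exact: cvg_cst|exact: cvg_id].
  - by move=> y; exact: fM.
  over.
by rewrite (normal_linear2 _ (sqrtr_ge0 _) cf fM) sqr_sqrtr.
Qed.

End std_normal_theory.

(** * Convergence in probability *)

Section expectation_bounds.
Context {R : realType}.

(** Uniform continuity on [-M, M], with the second point allowed to leave it. *)
Lemma compact_modulus (f : R -> R) (M e : R) : continuous f -> 0 < e ->
  exists2 dl : R, 0 < dl &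
    forall x y, `|x| <= M -> `|x - y| <= dl -> `|f x - f y| <= e.
Proof.
move=> cf e0.
have cK : compact `[- M, M]%classic by exact: segment_compact.
have H (x : R) : `[- M, M]%classic x ->
   \forall x' \near x & dl \near (0 : R)^'+,
     forall y, `|x' - y| <= dl -> `|f x' - f y| <= e.
  move=> _; have /cvgrPdist_le/(_ (e / 2)) := cf x.
  rewrite divr_gt0 // => /(_ isT) /nbhs_ballP[r /= r0 fr].
  exists (ball x (r / 2), [set dl | dl < r / 2]) => /=.
    split; first by apply: nbhsx_ballx; rewrite divr_gt0.
    by apply: nbhs_right_lt; rewrite divr_gt0.
  move=> [x' dl] /= [xx' dlr] y x'y.
  have fx' : `|f x - f x'| <= e / 2.
    by apply: fr; apply: le_ball xx'; rewrite ler_pdivrMr // ler_peMr ?ler1n // ltW.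
  have fy : `|f x - f y| <= e / 2.
    apply: fr; rewrite /ball /= -(subrKA x') [r]splitr.
    apply: le_lt_trans (ler_normD _ _) _; apply: ltrD; first exact: xx'.
    exact: le_lt_trans x'y dlr.
  have -> : f x' - f y = (f x - f y) - (f x - f x') by ring.
  by rewrite [e]splitr; apply: le_trans (ler_normB _ _) _; exact: lerD.
have near0 := (compact_near_coveringP _).1 cK _ _ _ _ H.
have [dl [dl0 Hdl]] : exists dl : R, 0 < dl /\ `[- M, M]%classic `<=`
    (fun x => forall y, `|x - y| <= dl -> `|f x - f y| <= e).
  near (0 : R)^'+ => dl; exists dl; split; last by near: dl; exact: near0.
  by near: dl; exact: nbhs_right_gt.
exists dl => // x y xM xy; apply: (Hdl x) => //.
by rewrite /= in_itv /= -ler_norml.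
Unshelve. all: by end_near. Qed.

(** The modulus dl serves all probability spaces and all pairs of variables at
    once; this uniformity is what lets limits in n and over directions be
    exchanged later. *)
Lemma expectation_close (f : R -> R) (K M e : R) :
  continuous f -> (forall x, `|f x| <= K) -> 0 < e ->
  exists2 dl : R, 0 < dl &
    forall d (T : measurableType d) (P : probability T R) (Y Y' : T -> R) A,
      measurable_fun setT Y -> measurable_fun setT Y' ->
      measurable A -> (P A <= e%:E)%E ->
      (forall w, ~ A w -> `|Y w| <= M /\ `|Y w - Y' w| <= dl) ->
      `|\int[P]_w (f (Y w)) - \int[P]_w (f (Y' w))| <= (2 * K + 1) * e.
Proof.
move=> cf fK e0; have [dl dl0 Hdl] := compact_modulus M cf e0.
exists dl => // d T P Y Y' A mY mY' mA PA close.
have mf : measurable_fun setT f by exact: continuous_measurable_fun.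
have K0 : 0 <= K by apply: le_trans (fK 0).
have iY : P.-integrable setT (EFin \o (fun w => f (Y w))).
  by apply: (@bounded_integrable _ _ _ P _ (K)) => //; exact: measurableT_comp.
have iY' : P.-integrable setT (EFin \o (fun w => f (Y' w))).
  by apply: (@bounded_integrable _ _ _ P _ (K)) => //; exact: measurableT_comp.
rewrite -RintegralB //.
have mD : measurable_fun setT (fun w => f (Y w) - f (Y' w)).
  by apply: measurable_funB; exact: measurableT_comp.
have DK w : `|f (Y w) - f (Y' w)| <= 2 * K.
  by rewrite mulr_natl mulr2n; apply: le_trans (ler_normB _ _) _; exact: lerD.
apply: le_trans (le_normr_Rintegral _ _) _ => //.
  exact: (bounded_integrable P mD DK).
have mI : measurable_fun setT (\1_A : T -> R) by exact: measurable_indic.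
have iI : P.-integrable setT (EFin \o (\1_A : T -> R)).
  apply: (@bounded_integrable _ _ _ P _ (1)) => // w.
  by rewrite indicE; case: (w \in A); rewrite ?normr1 ?normr0.
have bnd w : `|e + 2 * K * \1_A w| <= e + 2 * K.
  rewrite indicE ger0_norm; last by rewrite addr_ge0 ?mulr_ge0 ?ler0n // ltW.
  by rewrite lerD2l ler_piMr ?mulr_ge0 ?lern1 ?ler_nat // leq_b1.
apply: (@le_trans _ _ (\int[P]_w (e + 2 * K * \1_A w))).
  apply: le_Rintegral => //.
  - apply: (@bounded_integrable _ _ _ P _ (2 * K)); first exact: measurableT_comp.
    by move=> w; rewrite normr_id.
  - apply: (@bounded_integrable _ _ _ P _ (e + 2 * K)) => //.
    by apply: measurable_funD => //; exact: measurable_funM.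
  - move=> w _; rewrite indicE; case: (asboolP (A w)) => Aw.
      rewrite mem_set // mulr1; apply: le_trans (DK w) _.
      by rewrite lerDr ltW.
    rewrite memNset // mulr0 addr0.
    by have [YM YY'] := close w Aw; exact: Hdl.
rewrite RintegralD //; last 2 first.
- by apply: (@bounded_integrable _ _ _ P _ (`|e|)) => //; exact: measurable_cst.
- apply: (@bounded_integrable _ _ _ P _ (2 * K)); first exact: measurable_funM.
  move=> w; rewrite indicE ger0_norm ?mulr_ge0 //.
  by rewrite ler_piMr ?mulr_ge0 // lern1 leq_b1.
rewrite RintegralZl // Rintegral_cst //.
have -> : fine (P setT) = 1 by rewrite probability_setT.
have I_le : \int[P]_w \1_A w <= e.
  rewrite /Rintegral integral_indic // setIT.
  by rewrite -lee_fin fineK // fin_num_measure.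
have : 2 * K * \int[P]_w \1_A w <= 2 * K * e by rewrite ler_wpM2l ?mulr_ge0.
lra.
Qed.

End expectation_bounds.

Lemma mx_entry_norm_le (R : realType) m n (A : 'M[R]_(m, n)) i j :
  `|A i j| <= `|A|.
Proof.
rewrite [leRHS]/Num.norm /= mx_normrE; apply/bigmax_geP; right => /=.
by exists (i, j).
Qed.

Section convergence.
Context {R : realType} (d : nat -> measure_display)
  (T : forall n, measurableType (d n)) (P : forall n, probability (T n) R).

(** Asymptotically almost sure events: those that contain, for every e > 0, an
    event of probability at least 1 - e along large n. They form a filter on the
    disjoint union of the probability spaces, and convergence to zero along this
    filter is convergence to zero in probability. Allowing any superset of an
    event avoids measurability conditions. *)
Definition aas : set_system {n & T n} := fun Q => forall e : R, 0 < e ->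
  \forall n \near \oo, exists A, [/\ measurable A, (P n A <= e%:E)%E &
    forall w, ~ A w -> Q (existT _ n w)].

Global Instance aas_filter : Filter aas.
Proof.
split.
- move=> e e0; apply: nearW => n; exists set0; split => //.
  by rewrite measure0 lee_fin ltW.
- move=> Q Q' FQ FQ' e e0.
  have e20 : 0 < e / 2 by rewrite divr_gt0.
  near=> n.
  have [A [mA PA QA]] : exists A, [/\ measurable A, (P n A <= (e / 2)%:E)%E &
    forall w, ~ A w -> Q (existT _ n w)] by near: n; exact: FQ.
  have [A' [mA' PA' QA']] : exists A, [/\ measurable A, (P n A <= (e / 2)%:E)%E &
    forall w, ~ A w -> Q' (existT _ n w)] by near: n; exact: FQ'.
  exists (A `|` A'); split; first exact: measurableU.
    by rewrite [e]splitr EFinD (le_trans (measureU2 _ mA mA')) // leeD.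
  by move=> w /not_orP[nA nA']; split; [exact: QA|exact: QA'].
- move=> Q Q' QQ' FQ e e0; apply: filterS (FQ e e0) => n [A [mA PA QA]].
  by exists A; split => // w /QA/QQ'.
Unshelve. all: by end_near. Qed.

(** Turns a sequence of random elements into one function on the space carrying
    the filter [aas]. *)
Definition on_total (E : Type) (D : forall n, T n -> E) (x : {n & T n}) :=
  D (projT1 x) (projT2 x).

Lemma near_aas (Q : forall n, T n -> Prop) :
  (\forall n \near \oo, forall w, Q n w) -> \forall x \near aas, on_total Q x.
Proof.
move=> FQ e e0; apply: filterS FQ => n Qn; exists set0; split => // [|w _].
  by rewrite measure0 lee_fin ltW.
exact: Qn.
Qed.

Lemma cvg_aas (u : nat -> R) (l : R) : u @ \oo --> l ->
  on_total (fun n (_ : T n) => u n) @ aas --> l.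
Proof.
move=> /cvgrPdist_le ul; apply/cvgrPdist_le => e /ul une.
by apply: (near_aas (Q := fun n _ => `|l - u n| <= e)); apply: filterS une.
Qed.

Definition tight (Y : forall n, T n -> R) := forall e : R, 0 < e ->
  exists M : R, \forall n \near \oo, exists A, [/\ measurable A,
    (P n A <= e%:E)%E & forall w, ~ A w -> `|Y n w| <= M].

Lemma tight_le (Y Y' : forall n, T n -> R) (C : R) : 0 <= C ->
  (\forall n \near \oo, forall w, `|Y' n w| <= C * `|Y n w|) ->
  tight Y -> tight Y'.
Proof.
move=> C0 YY' tY e /tY[M nM]; exists (C * M).
near=> n.
have [A [mA PA AM]] : exists A, [/\ measurable A,
    (P n A <= e%:E)%E & forall w, ~ A w -> `|Y n w| <= M] by near: n.
exists A; split => // w /AM YM.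
have /(_ w) : forall w, `|Y' n w| <= C * `|Y n w| by near: n.
by move=> /le_trans -> //; rewrite ler_wpM2l.
Unshelve. all: by end_near. Qed.

Lemma tightD (Y Y' : forall n, T n -> R) : tight Y -> tight Y' ->
  tight (fun n w => Y n w + Y' n w).
Proof.
move=> tY tY' e e0; have e20 : 0 < e / 2 by rewrite divr_gt0.
have [M nM] := tY _ e20; have [M' nM'] := tY' _ e20; exists (M + M').
near=> n.
have [A [mA PA AM]] : exists A, [/\ measurable A,
    (P n A <= (e / 2)%:E)%E & forall w, ~ A w -> `|Y n w| <= M] by near: n.
have [A' [mA' PA' AM']] : exists A, [/\ measurable A,
    (P n A <= (e / 2)%:E)%E & forall w, ~ A w -> `|Y' n w| <= M'] by near: n.
exists (A `|` A'); split; first exact: measurableU.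
  by rewrite [e]splitr EFinD (le_trans (measureU2 _ mA mA')) // leeD.
move=> w /not_orP[/AM YM /AM' Y'M]; apply: le_trans (ler_normD _ _) _.
exact: lerD.
Unshelve. all: by end_near. Qed.

Lemma tight_sum (I : finType) (Y : I -> forall n, T n -> R) :
  (forall i, tight (Y i)) -> tight (fun n w => \sum_i Y i n w).
Proof.
move=> tY; rewrite -[index_enum I]enumT.
suff H s : tight (fun n w => \sum_(i <- s) Y i n w) by exact: H.
elim: s => [|i s IH] e e0.
  exists 0; apply: nearW => n; exists set0; split => //.
    by rewrite measure0 lee_fin ltW.
  by move=> w _; rewrite big_nil normr0.
have [M nM] := tightD (tY i) IH e0; exists M; apply: filterS nM => n [A [mA PA AM]].
by exists A; split => // w /AM; rewrite big_cons.
Qed.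

Lemma tight_mul_cvg0 (Y D : forall n, T n -> R) : tight Y ->
  on_total D @ aas --> (0 : R) ->
  on_total (fun n w => Y n w * D n w) @ aas --> (0 : R).
Proof.
move=> tY /cvgr0Pnorm_le D0; apply/cvgr0Pnorm_le => eps eps0 e e0.
have e20 : 0 < e / 2 by rewrite divr_gt0.
have [M nM] := tY _ e20.
have M10 : 0 < `|M| + 1 by rewrite ltr_wpDl.
have D1 := D0 (eps / (`|M| + 1)) (divr_gt0 eps0 M10) (e / 2) e20.
near=> n.
have [A [mA PA AM]] : exists A, [/\ measurable A,
    (P n A <= (e / 2)%:E)%E & forall w, ~ A w -> `|Y n w| <= M] by near: n.
have [A' [mA' PA' AD]] : exists A, [/\ measurable A,
    (P n A <= (e / 2)%:E)%E & forall w, ~ A w ->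
      `|on_total D (existT _ n w)| <= eps / (`|M| + 1)] by near: n.
exists (A `|` A'); split; first exact: measurableU.
  by rewrite [e]splitr EFinD (le_trans (measureU2 _ mA mA')) // leeD.
move=> w /not_orP[/AM YM /AD Dw]; rewrite /on_total /= normrM.
apply: (@le_trans _ _ ((`|M| + 1) * (eps / (`|M| + 1)))).
  apply: ler_pM => //; apply: le_trans YM _.
  by apply: le_trans (ler_norm M) _; rewrite lerDl.
by rewrite mulrCA mulfV ?mulr1 // gt_eqF.
Unshelve. all: by end_near. Qed.

Lemma cvg_std_normal_Rintegral (Y : forall n, T n -> R) (f : R -> R) K :
  cvg_std_normal P Y -> continuous f -> (forall x, `|f x| <= K) ->
  (fun n => \int[P n]_w (f (Y n w))) @ \oo --> \int[normal_prob 0 1]_x (f x).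
Proof.
move=> cY cf fK; apply: fine_cvg; rewrite /Rintegral fineK.
  by apply: cY => //; exists K.
have mf : measurable_fun setT f by exact: continuous_measurable_fun.
apply: integrable_fin_num => //.
exact: (@bounded_integrable R _ _ (normal_prob 0 1) f K mf fK).
Qed.

(** Convergence in law is stated with extended-real integrals; the estimates are
    real-valued. *)
Lemma Rintegral_cvg_std_normal (Y : forall n, T n -> R) :
  (\forall n \near \oo, measurable_fun setT (Y n)) ->
  (forall (f : R -> R) K, continuous f -> (forall x, `|f x| <= K) ->
    (fun n => \int[P n]_w (f (Y n w))) @ \oo --> \int[normal_prob 0 1]_x (f x)) ->
  cvg_std_normal P Y.
Proof.
move=> mY cY f cf [K fK].
have mf : measurable_fun setT f by exact: continuous_measurable_fun.
have -> : (\int[normal_prob 0 1]_x (f x)%:E)%E = (\int[normal_prob 0 1]_x f x)%:E.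
  rewrite /Rintegral fineK //; apply: integrable_fin_num => //.
  exact: (@bounded_integrable R _ _ (normal_prob 0 1) f K mf fK).
apply: cvg_EFin; last exact: (cY f K).
apply: filterS mY => n mYn; apply: integrable_fin_num => //.
by apply: (@bounded_integrable _ _ _ _ _ K) => //; exact: measurableT_comp.
Qed.

End convergence.

Lemma ler_dist_trans (R : realDomainType) (a b c e : R) :
  a <= c -> `|a - b| <= e -> b <= c + e.
Proof. by move=> ac; rewrite ler_norml => /andP[]; lra. Qed.

Lemma Rintegral_subr_cst (R : realType) d (T : measurableType d)
    (P : probability T R) (g : T -> R) (K c : R) :
  measurable_fun setT g -> (forall x, `|g x| <= K) ->
  \int[P]_x (g x - c) = \int[P]_x g x - c.
Proof.
move=> mg gK; rewrite RintegralB //; last 2 first.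
- exact: (bounded_integrable P mg gK).
- by apply: (@bounded_integrable _ _ _ P _ `|c|) => //; exact: measurable_cst.
have P1 : fine (P setT) = 1 by rewrite probability_setT.
by rewrite Rintegral_cst // P1 mulr1.
Qed.

(** * Weak limits and moving directions *)

Section weak_limits.
Context {R : realType} (d : nat -> measure_display)
  (T : forall n, measurableType (d n)) (P : forall n, probability (T n) R).

Lemma normal_tail (e : R) : 0 < e -> exists k : nat,
  (normal_prob 0 1 [set x : R | (k%:R <= `|x|)%R] <= e%:E)%E.
Proof.
move=> e0; pose F (k : nat) : set R := [set x | k%:R <= `|x|].
have mF k : measurable (F k).
  rewrite [F k](_ : _ = (fun x : R => `|x|) @^-1` `[k%:R, +oo[); last first.
    by apply/seteqP; split => x /=; rewrite in_itv /= andbT.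
  by rewrite -[X in measurable X]setTI; exact: normr_measurable.
have F0 : \bigcap_k F k = set0.
  apply/seteqP; split => // x /(_ (Num.truncn `|x|).+1 I) /=.
  by apply/negP; rewrite -ltNge; exact: truncnS_gt.
have /fine_cvgP[_] : normal_prob 0 1 \o F @ \oo --> (0%R : R)%:E.
  rewrite -[X in _ --> X](measure0 (normal_prob 0 1)) -F0.
  apply: nonincreasing_cvg_mu => //.
  - by rewrite -ge0_fin_numE //; apply: fin_num_measure; exact: mF.
  - by rewrite F0.
  - apply/nonincreasing_seqP => k; apply/subsetPset => x /=; apply: le_trans.
    by rewrite ler_nat.
move=> /cvgr0_norm_le/(_ _ e0)[k _ /(_ k (leqnn k))] /= H.
exists k; rewrite -[leLHS]fineK; last by apply: fin_num_measure; exact: mF.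
rewrite lee_fin; exact: le_trans (ler_norm _) H.
Qed.

Lemma cvg_std_normal_tight (Y : forall n, T n -> R) :
  (\forall n \near \oo, measurable_fun setT (Y n)) ->
  cvg_std_normal P Y -> tight P Y.
Proof.
move=> mY cY e e0; have e20 : 0 < e / 2 by rewrite divr_gt0.
have [k tailk] := normal_tail e20.
(* A continuous cutoff: zero up to k and one from k + 1 on. *)
pose g (x : R) : R := Num.min 1 (Num.max 0 (`|x| - k%:R)).
have g0 x : 0 <= g x by rewrite le_min ler01 le_max lexx.
have g1 x : g x <= 1 by rewrite ge_min lexx.
have gn x : `|g x| <= 1 by rewrite ger0_norm.
have cg : continuous g.
  move=> x; apply: (@continuous_min _ _ (cst 1 : R -> R^o)
      (fun x : R => Num.max 0 (`|x| - k%:R) : R^o)); first exact: cvg_cst.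
  apply: (@continuous_max _ _ (cst 0 : R -> R^o)
      (fun x : R => `|x| - k%:R : R^o)); first exact: cvg_cst.
  by apply: cvgB; [exact: norm_continuous|exact: cvg_cst].
have mg : measurable_fun setT g by exact: continuous_measurable_fun.
have Eg : \int[normal_prob 0 1]_x (g x) <= e / 2.
  have mA : measurable [set x : R | (k%:R <= `|x|)%R].
    rewrite [X in measurable X](_ : _ = (fun x : R => `|x|) @^-1` `[k%:R, +oo[).
      by rewrite -[X in measurable X]setTI; exact: normr_measurable.
    by apply/seteqP; split => x /=; rewrite in_itv /= andbT.
  apply: (@le_trans _ _ (\int[normal_prob 0 1]_x \1_[set x : R | (k%:R <= `|x|)%R] x)).
    apply: le_Rintegral => //.
    - exact: (@bounded_integrable R _ _ (normal_prob 0 1) g 1 mg gn).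
    - apply: (@bounded_integrable R _ _ (normal_prob 0 1) _ 1).
        exact: measurable_indic.
      by move=> x; rewrite indicE; case: (_ \in _); rewrite ?normr1 ?normr0.
    - move=> x _; rewrite indicE; case: (asboolP (k%:R <= `|x|)) => kx.
        by rewrite mem_set.
      rewrite memNset // ge_min ge_max subr_le0 lexx /=.
      by move/negP: kx; rewrite -ltNge => /ltW ->; rewrite orbT.
  rewrite /Rintegral integral_indic // setIT -lee_fin fineK //.
  exact: fin_num_measure.
have := cvg_std_normal_Rintegral cY cg gn.
move=> /cvgrPdist_le/(_ _ e20) nE; exists (k%:R + 1).
near=> n.
have mYn : measurable_fun setT (Y n) by near: n.
have mnY : measurable_fun setT (fun w => `|Y n w|) by exact: measurableT_comp.
have En : \int[P n]_w (g (Y n w)) <= e.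
  have : `|\int[normal_prob 0 1]_x (g x) - \int[P n]_w (g (Y n w))| <= e / 2.
    by near: n.
  by move=> /(ler_dist_trans Eg); rewrite -splitr.
have mA : measurable [set w | k%:R + 1 < `|Y n w|].
  rewrite [X in measurable X](_ : _ = (fun w => `|Y n w|) @^-1` `]k%:R + 1, +oo[).
    by rewrite -[X in measurable X]setTI; exact: mnY.
  by apply/seteqP; split => x /=; rewrite in_itv /= andbT.
exists [set w | k%:R + 1 < `|Y n w|]; split => //; last first.
  by move=> w /= /negP; rewrite -leNgt.
rewrite -[leLHS]fineK ?fin_num_measure // lee_fin; apply: le_trans En.
rewrite [leLHS](_ : _ = \int[P n]_w \1_[set w | k%:R + 1 < `|Y n w|] w); last first.
  by rewrite /Rintegral integral_indic // setIT.
apply: le_Rintegral => //.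
- apply: (@bounded_integrable R _ _ (P n) _ 1).
    exact: measurable_indic.
  by move=> x; rewrite indicE; case: (_ \in _); rewrite ?normr1 ?normr0.
- apply: (@bounded_integrable R _ _ (P n) _ 1) => //.
  exact: measurableT_comp.
- move=> w _; rewrite indicE; case: (asboolP (k%:R + 1 < `|Y n w|)) => kx.
    rewrite mem_set // le_min lexx /= le_max; apply/orP; right.
    by rewrite lerBrDl ltW.
  by rewrite memNset.
Unshelve. all: by end_near. Qed.

Lemma slutsky (Y Y' : forall n, T n -> R) :
  (\forall n \near \oo, measurable_fun setT (Y n)) ->
  (\forall n \near \oo, measurable_fun setT (Y' n)) ->
  cvg_std_normal P Y ->
  on_total (fun n w => Y n w - Y' n w) @ aas P --> (0 : R) ->
  cvg_std_normal P Y'.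
Proof.
move=> mY mY' cY /cvgr0Pnorm_le D0; apply: Rintegral_cvg_std_normal => // f K cf fK.
apply/cvgrPdist_le => e e0.
have K0 : 0 <= K by apply: le_trans (fK 0).
pose e' := e / 2 / (2 * K + 1).
have K1 : 0 < 2 * K + 1 by rewrite ltr_wpDl // mulr_ge0.
have e'0 : 0 < e' by rewrite !divr_gt0.
have e20 : 0 < e' / 2 by rewrite divr_gt0.
have [M nM] := cvg_std_normal_tight mY cY e20.
have [dl dl0 close] := expectation_close M cf fK e'0.
have nD := D0 dl dl0 _ e20.
have /cvgrPdist_le cE := cvg_std_normal_Rintegral cY cf fK.
near=> n.
have [A [mA PA AM]] : exists A, [/\ measurable A,
    (P n A <= (e' / 2)%:E)%E & forall w, ~ A w -> `|Y n w| <= M] by near: n.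
have [A' [mA' PA' AD]] : exists A, [/\ measurable A,
    (P n A <= (e' / 2)%:E)%E & forall w, ~ A w ->
    `|on_total (fun n w => Y n w - Y' n w) (existT _ n w)| <= dl] by near: n.
have E1 : `|\int[normal_prob 0 1]_x (f x) - \int[P n]_w (f (Y n w))| <= e / 2.
  by near: n; apply: cE; rewrite divr_gt0.
have E2 : `|\int[P n]_w (f (Y n w)) - \int[P n]_w (f (Y' n w))| <= (2 * K + 1) * e'.
  apply: (close _ _ _ _ _ (A `|` A')).
  - by near: n.
  - by near: n.
  - exact: measurableU.
  - by rewrite [e']splitr EFinD (le_trans (measureU2 _ mA mA')) // leeD.
  - by move=> w /not_orP[/AM ? /AD].
have e'E : (2 * K + 1) * e' = e / 2 by rewrite /e' mulrCA mulfV ?mulr1 // gt_eqF.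
rewrite -(subrKA (\int[P n]_w (f (Y n w)))) [e]splitr.
by apply: le_trans (ler_normD _ _) _; rewrite lerD // -e'E.
Unshelve. all: by end_near. Qed.

Lemma cvg_std_normal_mul (Y r : forall n, T n -> R) :
  (\forall n \near \oo, measurable_fun setT (Y n)) ->
  (\forall n \near \oo, measurable_fun setT (fun w => Y n w * r n w)) ->
  cvg_std_normal P Y ->
  on_total r @ aas P --> (1 : R) ->
  cvg_std_normal P (fun n w => Y n w * r n w).
Proof.
move=> mY mYr cY r1; apply: (slutsky mY mYr cY).
rewrite (_ : on_total _ = on_total (fun n w => Y n w * (1 - r n w))); last first.
  by apply/funext => x; rewrite /on_total mulrBr mulr1.
apply: (tight_mul_cvg0 (D := fun n w => 1 - r n w)); first exact: cvg_std_normal_tight.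
rewrite -[X in _ --> X](subrr (1 : R)).
by apply: cvgB => //; exact: cvg_cst.
Qed.

Section vectors.
Variables (q : nat) (Z : forall n, T n -> 'cV[R]_q).
Local Arguments Z : clear implicits.
Hypothesis mZ : \forall n \near \oo, forall k, measurable_fun setT (fun w => Z n w k 0).
Hypothesis cZ : cvg_std_normal_vec P Z.

Lemma continuous_dotv (a : 'cV[R]_q) : continuous (dotv a).
Proof.
rewrite (_ : dotv a = fun z => \sum_i a i 0 * z i 0); last first.
  by apply/funext => y; rewrite dotvE.
apply: continuous_big => [|i _ y]; first exact: add_continuous.
by apply: continuousM; [exact: cst_continuous|exact: coord_continuous].
Qed.

Lemma measurable_dotv (a : 'cV[R]_q) n :
  (forall k, measurable_fun setT (fun w => Z n w k 0)) ->
  measurable_fun setT (fun w => dotv a (Z n w)).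
Proof.
move=> mZn; under eq_fun do rewrite dotvE.
by apply: measurable_sum => i; exact: measurable_funM.
Qed.

(** The continuous mapping theorem along a fixed unit vector. *)
Lemma dotv_cvg_fixed (a : 'cV[R]_q) : dotv a a = 1 ->
  cvg_std_normal P (fun n w => dotv a (Z n w)).
Proof.
move=> a1; apply: Rintegral_cvg_std_normal.
  by apply: filterS mZ => n; exact: measurable_dotv.
move=> f K cf fK.
have K0 : 0 <= K by apply: le_trans (fK 0).
(* Shifted to be nonnegative, as the formula for linear forms requires. *)
pose g (x : R) := f x + K.
have cg : continuous g by move=> x; apply: cvgD; [exact: cf|exact: cvg_cst].
have g0 x : 0 <= g x <= K + K.
  rewrite lerD2r; have := fK x; rewrite ler_norml => /andP[fl ->].
  by rewrite andbT -lerBlDr sub0r.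
have gn x : `|g x| <= K + K by case/andP: (g0 x) => g0x ?; rewrite ger0_norm.
have limg : (\int[std_normal R q]_z (g (dotv a (col_of_tuple z))))%R =
    \int[normal_prob 0 1]_x (g x).
  rewrite /Rintegral (std_normal_linear a cg g0); congr fine.
  by apply: eq_integral => x _; rewrite a1 sqrtr1 mul1r.
have mf : measurable_fun setT f by exact: continuous_measurable_fun.
have mg : measurable_fun setT g by exact: continuous_measurable_fun.
have intN : (\int[normal_prob 0 1]_x (f x) = \int[normal_prob 0 1]_x (g x) - K)%R.
  rewrite -(@Rintegral_subr_cst R _ _ (normal_prob 0 1) g _ K mg gn).
  by apply: eq_Rintegral => x _; rewrite /g addrK.
have fin : (\int[std_normal R q]_z (g (dotv a (col_of_tuple z)))%:E)%E \is a fin_num.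
  rewrite (std_normal_linear a cg g0); apply: integrable_fin_num => //.
  have mga : measurable_fun setT (fun x => g (Num.sqrt (dotv a a) * x)).
    by apply: measurableT_comp => //; exact: measurable_funM.
  exact: (@bounded_integrable R _ _ (normal_prob 0 1) _ _ mga (fun x => gn _)).
have cG : (fun n => \int[P n]_w (g (dotv a (Z n w)))) @ \oo -->
    \int[normal_prob 0 1]_x (g x).
  rewrite -limg; apply: fine_cvg; rewrite fineK //.
  apply: (cZ (f := fun z => g (dotv a z))); last by exists (K + K).
  move=> z; apply: continuous_comp; first exact: continuous_dotv.
  exact: cg.
have cG' : (fun n => \int[P n]_w (g (dotv a (Z n w))) - K) @ \oo -->
    \int[normal_prob 0 1]_x (g x) - K by apply: cvgB => //; exact: cvg_cst.
rewrite intN; apply: cvg_trans cG'; apply: near_eq_cvg.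
apply: filterS mZ => n mZn /=.
have mY := measurable_dotv a mZn.
have mgY : measurable_fun setT (fun w => g (dotv a (Z n w))) by exact: measurableT_comp.
rewrite -(Rintegral_subr_cst _ K mgY (fun w => gn _)).
by apply: eq_Rintegral => x _; rewrite /g addrK.
Qed.

Lemma tight_coord (k : 'I_q) : tight P (fun n w => Z n w k 0).
Proof.
rewrite (_ : (fun n w => Z n w k 0) = (fun n w => dotv (delta_mx k 0) (Z n w))); last first.
  apply: boolp.functional_extensionality_dep => n; apply/funext => w.
  by rewrite dotv_delta.
apply: cvg_std_normal_tight.
  by apply: filterS mZ => n; exact: measurable_dotv.
by apply: dotv_cvg_fixed; rewrite dotv_delta mxE !eqxx.
Qed.

Lemma tight_norm1 : tight P (fun n w => \sum_k `|Z n w k 0|).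
Proof.
apply: tight_sum => k; apply: (tight_le (C := 1) _ _ (tight_coord k)) => //.
by apply: nearW => n w; rewrite mul1r normr_id.
Qed.

(** The Cramer-Wold device along directions that move with n: the expectations
    E f(b.Z_n) converge uniformly in the unit vector b, by compactness of the
    sphere. *)
Lemma cramer_wold (a : nat -> 'cV[R]_q) :
  (\forall n \near \oo, dotv (a n) (a n) = 1) ->
  cvg_std_normal P (fun n w => dotv (a n) (Z n w)).
Proof.
move=> a1; apply: Rintegral_cvg_std_normal.
  by apply: filterS mZ => n; exact: measurable_dotv.
move=> f K cf fK; apply/cvgrPdist_le => e e0.
pose sphere : set 'rV[R]_q := [set b | dotv b^T b^T = 1].
have sphere_le1 b i : sphere b -> `|b 0 i| <= 1.
  by move=> /(unit_coord_le i); rewrite mxE.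
have cS : compact sphere.
  apply: (subclosed_compact _ (@rV_compact R q (fun=> `[(- 1 : R), 1]%classic)
      (fun=> @segment_compact R _ _))); last first.
    by move=> b b1 i; rewrite /= in_itv /= -ler_norml sphere_le1.
  rewrite /sphere (_ : mkset _ = (fun b : 'rV[R]_q => \sum_i b 0 i * b 0 i) @^-1` [set 1]).
    apply: closed_comp => [b _|]; last exact: closed_eq.
    move: b; apply: continuous_big => [|i _ y]; first exact: add_continuous.
    by apply: continuousM; exact: coord_continuous.
  have dotT b : dotv b^T b^T = \sum_i b 0 i * b 0 i.
    by rewrite dotvE; apply: eq_bigr => i _; rewrite !mxE.
  by apply/seteqP; split => b /=; rewrite dotT.
have K0 : 0 <= K by apply: le_trans (fK 0).
pose e' := e / 2 / (2 * K + 1).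
have K1 : 0 < 2 * K + 1 by rewrite ltr_wpDl // mulr_ge0.
have e'0 : 0 < e' by rewrite !divr_gt0.
have e'E : (2 * K + 1) * e' = e / 2 by rewrite /e' mulrCA mulfV ?mulr1 // gt_eqF.
have [M0 nM] := tight_norm1 e'0; pose M := `|M0| + 1.
have M1 : 0 < M by rewrite ltr_wpDl.
have [dl dl0 close] := expectation_close M cf fK e'0.
(* The estimate holds along b and, by tightness of Z, in a neighbourhood of b. *)
have H b : sphere b -> \forall b' \near b & n \near \oo,
    `|\int[normal_prob 0 1]_x (f x) - \int[P n]_w (f (dotv b'^T (Z n w)))| <= e.
  move=> b1; have /cvgrPdist_le cE :=
    cvg_std_normal_Rintegral (dotv_cvg_fixed b1) cf fK.
  exists (ball b (dl / M), fun n =>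
     [/\ forall k, measurable_fun setT (fun w => Z n w k 0),
       `|\int[normal_prob 0 1]_x (f x) - \int[P n]_w (f (dotv b^T (Z n w)))| <= e / 2 &
       exists A, [/\ measurable A, (P n A <= e'%:E)%E &
         forall w, ~ A w -> `|\sum_k `|Z n w k 0| | <= M0]]) => /=.
    split; first by apply: nbhsx_ballx; rewrite divr_gt0.
    near=> n; split; first by near: n.
      by near: n; apply: cE; rewrite divr_gt0.
    by near: n.
  move=> [b' n] /= [bb' [mZn E1 [A [mA PA AM]]]].
  have E2 : `|\int[P n]_w (f (dotv b^T (Z n w))) -
      \int[P n]_w (f (dotv b'^T (Z n w)))| <= (2 * K + 1) * e'.
    apply: (close _ _ _ _ _ A) => //; try exact: measurable_dotv.
    move=> w /AM Zw.
    have ZM : \sum_k `|Z n w k 0| <= M.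
      apply: le_trans (ler_norm _) (le_trans Zw _).
      by apply: le_trans (ler_norm _) _; rewrite lerDl.
    have lin (c : 'rV[R]_q) x : (forall k, `|c 0 k| <= x) -> 0 <= x ->
        `|dotv c^T (Z n w)| <= x * M.
      move=> cx x0; rewrite dotvE; apply: le_trans (ler_norm_sum _ _ _) _.
      apply: (@le_trans _ _ (x * \sum_k `|Z n w k 0|)); last by rewrite ler_wpM2l.
      rewrite mulr_sumr; apply: ler_sum => k _.
      by rewrite !mxE normrM ler_wpM2r.
    split; first by rewrite -[M]mul1r; apply: lin => // k; exact: sphere_le1.
    have -> : dotv b^T (Z n w) - dotv b'^T (Z n w) = dotv (b - b')^T (Z n w).
      rewrite !dotvE -sumrB; apply: eq_bigr => k _.
      by rewrite !mxE mulrBl.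
    rewrite -[dl](divfK (lt0r_neq0 M1)); apply: lin; last by rewrite divr_ge0 // ltW.
    move=> k; apply: le_trans (mx_entry_norm_le _ _ _) _.
    by move: bb'; rewrite mx_norm_ball /ball_ /= => /ltW.
  rewrite -(subrKA (\int[P n]_w (f (dotv b^T (Z n w))))) [e]splitr.
  by apply: le_trans (ler_normD _ _) _; rewrite lerD // -e'E.
have := (compact_near_coveringP _).1 cS _ _ _ _ H.
move=> nS; near=> n.
have Hn : sphere `<=` (fun b => `|\int[normal_prob 0 1]_x (f x) -
  \int[P n]_w (f (dotv b^T (Z n w)))| <= e) by near: n; exact: nS.
have := Hn (a n)^T; rewrite trmxK; apply.
by rewrite /sphere /= trmxK; near: n.
Unshelve. all: by end_near. Qed.

End vectors.

End weak_limits.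

Section nondegenerate.
Context {R : realType}.

Lemma normal_prob_small_itv (r : R) : 0 < r ->
  (normal_prob 0 1 [set` `](- r)%R, r[%R] <= (normal_peak (1 : R) * (r + r))%:E)%E.
Proof.
move=> r0; rewrite /normal_prob.
apply: (@le_trans _ _ (\int[lebesgue_measure]_(x in `](- r)%R, r[) (normal_peak (1 : R))%:E)%E).
  apply: ge0_le_integral => //=.
  - by move=> x _; rewrite lee_fin normal_pdf_ge0.
  - by apply/measurable_EFinP; apply: measurable_funTS; exact: measurable_normal_pdf.
  - by move=> x _; rewrite lee_fin normal_pdf_ub ?oner_neq0.
rewrite integral_cst //= lebesgue_measure_itv /= lte_fin gtrN // -EFinD opprK.
by rewrite EFinM.
Qed.

(** A variable that is identically zero is far from normal: the tent function f
    below has mean at most 1/2 under the normal law and equals 1 at 0. This is used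
    to exclude that a matrix in a normal limit is a zero default value. *)
Lemma cvg_std_normal_neq0 (d : nat -> measure_display)
    (T : forall n, measurableType (d n)) (P : forall n, probability (T n) R)
    (Y : forall n, T n -> R) :
  cvg_std_normal P Y -> \forall n \near \oo, exists w, Y n w != 0.
Proof.
move=> cY; have p0 : 0 < normal_peak (1 : R) by rewrite normal_peak_gt0 ?oner_neq0.
pose r : R := (4 * normal_peak 1)^-1.
have r0 : 0 < r by rewrite invr_gt0 mulr_gt0.
pose f (x : R) : R := Num.max 0 (1 - `|x| / r).
have f0 x : 0 <= f x by rewrite le_max lexx.
have f1 x : f x <= 1.
  by rewrite ge_max ler01 /= gerBl divr_ge0 // ltW.
have fn x : `|f x| <= 1 by rewrite ger0_norm.
have cf : continuous f.
  move=> x; apply: (@continuous_max _ _ (cst 0 : R -> R^o)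
      (fun x : R => 1 - `|x| / r : R^o)); first exact: cvg_cst.
  apply: cvgB; first exact: cvg_cst.
  by apply: cvgM; [exact: norm_continuous|exact: cvg_cst].
have mf : measurable_fun setT f by exact: continuous_measurable_fun.
have Ef : \int[normal_prob 0 1]_x (f x) <= 2^-1.
  apply: (@le_trans _ _ (\int[normal_prob 0 1]_x \1_(`](- r), r[%classic : set R) x)).
    apply: le_Rintegral => //.
    - exact: (@bounded_integrable R _ _ (normal_prob 0 1) f 1 mf fn).
    - apply: (@bounded_integrable R _ _ (normal_prob 0 1) _ 1).
        exact: measurable_indic.
      by move=> x; rewrite indicE; case: (_ \in _); rewrite ?normr1 ?normr0.
    - move=> x _; rewrite indicE; case: (asboolP (`](- r), r[%classic x)) => xr.
        by rewrite mem_set.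
      rewrite memNset // ge_max lexx /= subr_le0 ler_pdivlMr // mul1r leNgt.
      by apply/negP => rx; apply: xr; rewrite /= in_itv /= -ltr_norml.
  rewrite /Rintegral integral_indic // setIT -lee_fin fineK; last exact: fin_num_measure.
  apply: le_trans (normal_prob_small_itv r0) _; rewrite lee_fin /r.
  have -> : normal_peak (1 : R) * ((4 * normal_peak 1)^-1 + (4 * normal_peak 1)^-1) = 2^-1 :> R.
    by field; rewrite gt_eqF.
  by [].
have e0 : 0 < 4^-1 :> R by rewrite invr_gt0.
have /cvgrPdist_le/(_ _ e0) := cvg_std_normal_Rintegral cY cf fn.
apply: filterS => n; case: (pselect (exists w, Y n w != 0)) => // nY.
have Y0 w : Y n w = 0 by apply: contra_notP nY => /eqP; exists w.
rewrite (_ : \int[P n]_w f (Y n w) = 1) => [/(ler_dist_trans Ef)|]; first by lra.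
transitivity (\int[P n]_w (1 : R)).
  by apply: eq_Rintegral => w _; rewrite Y0 /f normr0 mul0r subr0; apply/max_idPr.
have P1 : fine (P n setT) = 1 by rewrite probability_setT.
by rewrite Rintegral_cst // P1 mulr1.
Qed.

End nondegenerate.

(** * First-order perturbation of a symmetric matrix *)

Section perturbation.
Context {R : realType}.

Lemma ord_strict_mono_id n (f : 'I_n -> 'I_n) :
  (forall i j : 'I_n, (i < j)%N -> (f i < f j)%N) -> forall i, f i = i.
Proof.
move=> fM.
have lo k : forall i : 'I_n, i = k :> nat -> (k <= f i)%N.
  elim: k => [//|k IH] i ik.
  have kn : (k < n)%N by rewrite ltnW // -ik.
  by apply: leq_ltn_trans (IH (Ordinal kn) erefl) _; apply: fM; rewrite ik.
have up k : forall i : 'I_n, (i + k).+1 = n -> ((f i + k).+1 <= n)%N.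
  elim: k => [|k IH] i ik; first by rewrite addn0.
  have kn : (i.+1 < n)%N.
    by apply: leq_trans (eq_leq ik); rewrite addnS !ltnS leq_addr.
  have := IH (Ordinal kn); rewrite /= addSnnS => /(_ ik).
  by apply: leq_trans; rewrite addnS ltnS -addSn leq_add2r; exact: fM.
move=> i; apply/val_inj/eqP; rewrite eqn_leq lo // andbT.
have := up (n - i.+1)%N i; rewrite -addSn subnKC // => /(_ erefl).
by rewrite -addSn -[X in (_ <= X)%N -> _](subnKC (ltn_ord i)) leq_add2r.
Qed.

(** Every term of the Leibniz formula has exactly one factor in row j. *)
Lemma det_small_row n (M : 'M[R]_n) (j : 'I_n) (e C : R) :
  1 <= C -> (forall l, `|M j l| <= e) -> (forall k l, `|M k l| <= C) ->
  `|\det M| <= #|'S_n|%:R * (C ^+ n * e).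
Proof.
move=> C1 Me MC; rewrite /determinant.
have C0 : 0 <= C by apply: le_trans C1.
have e0 : 0 <= e by apply: le_trans (Me j).
apply: le_trans (ler_norm_sum _ _ _) _.
rewrite mulr_natl -sumr_const; apply: ler_sum => s _.
rewrite normrM normrX normrN1 expr1n mul1r normr_prod (bigD1 j) //= mulrC.
apply: ler_pM => //; first by apply: prodr_ge0.
apply: (@le_trans _ _ (\prod_(i < n) C)); last by rewrite prodr_const card_ord.
rewrite [leRHS](bigD1 j) //= -[leLHS]mul1r; apply: ler_pM => //.
  by apply: prodr_ge0.
by apply: ler_prod => i _; rewrite normr_ge0 MC.
Qed.

Lemma char_poly_eval n (A : 'M[R]_n) x : (char_poly A).[x] = \det (x%:M - A).
Proof.
rewrite -[LHS]/(horner_eval x _) -det_map_mx; congr (\det _).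
by apply/matrixP => i j; rewrite !mxE /= horner_evalE hornerD hornerN hornerMn hornerX hornerC.
Qed.

Lemma scalar_sub_mxE n (A : 'M[R]_n) x i j :
  (x%:M - A) i j = x *+ (i == j) - A i j.
Proof. by rewrite !mxE. Qed.

(** The Gram matrix of a perturbed frame, in the basis of singular vectors. *)
Definition perturbed n (rho : 'rV[R]_n) (W : 'M[R]_n) : 'M[R]_n :=
  diag_mx rho *m (1%:M + W) *m diag_mx rho.

Lemma perturbedE n (rho : 'rV[R]_n) W i j :
  perturbed rho W i j = rho 0 i ^+ 2 *+ (i == j) + rho 0 i * rho 0 j * W i j.
Proof.
rewrite /perturbed mul_mx_diag mul_diag_mx !mxE.
by case: eqP => [<-|_]; rewrite ?mulr1n ?mulr0n; ring.
Qed.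

Definition pos_sign (x : R) : R := if 0 <= x then 1 else -1.

Section eigen.
Variables (n : nat) (rho : 'rV[R]_n) (W : 'M[R]_n) (g e : R).
Hypothesis g0 : 0 < g.
Hypothesis e1 : e <= 1.
Hypothesis rho01 : forall i, 0 <= rho 0 i <= 1.
Hypothesis gap : forall j k : 'I_n, (j < k)%N -> g <= rho 0 j ^+ 2 - rho 0 k ^+ 2.
Hypothesis We : forall i j, `|W i j| <= e.

Let rr0 i j : 0 <= rho 0 i * rho 0 j.
Proof. by apply: mulr_ge0; case/andP: (rho01 i); case/andP: (rho01 j). Qed.

Let rr1 i j : rho 0 i * rho 0 j <= 1.
Proof. by case/andP: (rho01 i) (rho01 j) => ? ? /andP[? ?]; exact: mulr_ile1. Qed.

Let rW i j : `|rho 0 i * rho 0 j * W i j| <= e.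
Proof. by rewrite normrM -[e]mul1r; apply: ler_pM => //; rewrite ger0_norm. Qed.

(** The j-th row of rho_j^2 - perturbed rho W is of order e, so its determinant is
    small and rho_j^2 is close to some eigenvalue; since the rho_j^2 are well
    separated, ordering the eigenvalues matches them with the rho_j^2 index by
    index. *)
Lemma eigval_close (lam : 'rV[R]_n) :
  (forall i j : 'I_n, (i <= j)%N -> lam 0 j <= lam 0 i) ->
  (forall x, \prod_(i < n) (x - lam 0 i) = \det (x%:M - perturbed rho W)) ->
  #|'S_n|%:R * (2 ^+ n * e) < (g / 2) ^+ n ->
  forall j, `|rho 0 j ^+ 2 - lam 0 j| < g / 2.
Proof.
move=> lam_sorted charE e_small.
have near j : exists k, `|rho 0 j ^+ 2 - lam 0 k| < g / 2.
  apply: contrapT => /forallNP far; move: e_small; apply/negP; rewrite -leNgt.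
  apply: (@le_trans _ _ (\prod_(k < n) `|rho 0 j ^+ 2 - lam 0 k|)).
    rewrite -[X in _ ^+ X]card_ord -prodr_const; apply: ler_prod => k _.
    by rewrite divr_ge0 ?(ltW g0) //= leNgt; exact/negP.
  rewrite -normr_prod charE; apply: (det_small_row (j := j)).
  - by rewrite ler1n.
  - move=> l; rewrite scalar_sub_mxE perturbedE.
    by rewrite opprD addrA subrr sub0r normrN.
  - move=> k l; rewrite scalar_sub_mxE perturbedE opprD addrA.
    rewrite -mulrnBl; apply: le_trans (ler_normB _ _) _.
    have -> : 2 = 1 + 1 :> R by [].
    apply: lerD; last exact: le_trans e1.
    case: (k == l); rewrite ?mulr1n ?mulr0n ?normr0 // ler_norml.
    rewrite lerBrDr; have := rr0 j j; have := rr0 k k; have := rr1 j j.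
    by have := rr1 k k; rewrite !expr2; lra.
pose f j := xchoose (near j).
have fP j : `|rho 0 j ^+ 2 - lam 0 (f j)| < g / 2 by exact: (xchooseP (near j)).
move=> j; rewrite -[X in lam 0 X](@ord_strict_mono_id _ f) //.
move=> i k ik; rewrite ltnNge; apply/negP => /lam_sorted.
have := fP i; have := fP k; have := gap ik.
by rewrite !ltr_norml => ? /andP[? ?] /andP[? ?]; lra.
Qed.

Variables (j : 'I_n) (lam : R) (y : 'cV[R]_n).
Hypothesis lam_close : `|rho 0 j ^+ 2 - lam| < g / 2.
Hypothesis eig : perturbed rho W *m y = lam *: y.
Hypothesis unit_y : dotv y y = 1.

Let N : R := n%:R.
Let c1 : R := N * (2 * N / g) ^+ 2.
Let c2 : R := 2 * (N * (2 * N / g)).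
Let c3 : R := c1 + N * (2 * N / g) + (1 + c2) * (2 * N / g).

Let N0 : 0 <= N. Proof. exact: ler0n. Qed.
Let Ng0 : 0 <= 2 * N / g. Proof. by rewrite divr_ge0 ?mulr_ge0 // ltW. Qed.
Let e0 : 0 <= e. Proof. exact: le_trans (We j j). Qed.

Let y1 k : `|y k 0| <= 1.
Proof. exact: unit_coord_le. Qed.

(** The k-th coordinate of the eigenvector equation. It gives everything below:
    for k <> j the factor on the left is at least g / 2 in size, which makes y_k of
    order e; so y_j is 1 up to order e^2, and substituting these bounds back on the
    right-hand side yields the first-order terms. *)
Lemma eigen_coord k : (lam - rho 0 k ^+ 2) * y k 0 =
  \sum_l rho 0 k * rho 0 l * W k l * y l 0.
Proof.
have := congr1 (fun v : 'cV_n => v k 0) eig; rewrite !mxE => eigk.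
rewrite mulrBl -eigk; apply/eqP; rewrite subr_eq; apply/eqP.
under eq_bigr do rewrite -/(perturbed rho W k _) perturbedE mulrDl.
rewrite big_split /= addrC; congr (_ + _).
rewrite (bigD1 k) //= eqxx mulr1n big1 ?addr0 // => l lk.
by rewrite eq_sym (negbTE lk) mulr0n mul0r.
Qed.

Lemma sum_coord_le k (x : R) (Q : pred 'I_n) :
  0 <= x -> (forall l, Q l -> `|y l 0| <= x) ->
  `|\sum_(l | Q l) rho 0 k * rho 0 l * W k l * y l 0| <= N * (e * x).
Proof.
move=> x0 yx; apply: le_trans (ler_norm_sum _ _ _) _.
rewrite /N -[X in X%:R]card_ord mulr_natl -sumr_const.
rewrite big_mkcond /=; apply: ler_sum => l _; case: ifP => Ql.
  by rewrite normrM; apply: ler_pM => //; exact: yx.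
by rewrite mulr_ge0.
Qed.

Lemma eigvec_off_diag k : k != j -> `|y k 0| <= 2 * N / g * e.
Proof.
move=> kj.
have gk : g / 2 <= `|lam - rho 0 k ^+ 2|.
  have : g <= `|rho 0 j ^+ 2 - rho 0 k ^+ 2|.
    case: (ltngtP k j) kj => [kj _|jk _|/val_inj -> /eqP //].
      by rewrite distrC; apply: le_trans (gap kj) (ler_norm _).
    by apply: le_trans (gap jk) (ler_norm _).
  have : `|rho 0 j ^+ 2 - rho 0 k ^+ 2| <=
      `|rho 0 j ^+ 2 - lam| + `|lam - rho 0 k ^+ 2|.
    by rewrite -[X in `|X| <= _](subrKA lam); exact: ler_normD.
  by move: lam_close; lra.
have := @sum_coord_le k 1 xpredT ler01 (fun l _ => y1 l).
rewrite -eigen_coord normrM mulr1 => H.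
have -> : 2 * N / g * e = N * e / (g / 2) by field; rewrite gt_eqF.
rewrite ler_pdivlMr ?divr_gt0 // mulrC.
by apply: le_trans H; rewrite ler_wpM2r.
Qed.

Lemma eigvec_diag_sqr : 1 - y j 0 ^+ 2 <= c1 * e ^+ 2.
Proof.
rewrite -unit_y dotvE (bigD1 j) //= -expr2 addrAC subrr add0r.
rewrite /c1 -mulrA -exprMn /N -[X in X%:R * _]card_ord mulr_natl -sumr_const.
rewrite big_mkcond /=; apply: ler_sum => l _; case: ifP => [lj|_]; last exact: sqr_ge0.
rewrite -expr2 -(@real_normK _ (y l 0)) ?num_real //.
have := eigvec_off_diag lj => H; rewrite ler_pXn2r ?nnegrE //.
exact: le_trans H.
Qed.

Hypothesis e_small : c1 * e ^+ 2 <= 3 / 4.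

Let yj : 2^-1 <= `|y j 0|.
Proof.
rewrite -(@ler_pXn2r _ 2) ?nnegrE ?invr_ge0 // real_normK ?num_real //.
have := eigvec_diag_sqr; have -> : (2^-1 : R) ^+ 2 = 1 / 4 by field.
by move: e_small; lra.
Qed.

Lemma eigval_expansion :
  `|lam - rho 0 j ^+ 2 - rho 0 j ^+ 2 * W j j| <= c2 * e ^+ 2.
Proof.
have H := @sum_coord_le j (2 * N / g * e) (fun l => l != j)
  (mulr_ge0 Ng0 e0) eigvec_off_diag.
have E : (lam - rho 0 j ^+ 2 - rho 0 j ^+ 2 * W j j) * y j 0 =
    \sum_(l | l != j) rho 0 j * rho 0 l * W j l * y l 0.
  rewrite mulrBl eigen_coord (bigD1 j) //= addrAC expr2.
  by rewrite subrr add0r.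
rewrite -E normrM in H.
have : `|lam - rho 0 j ^+ 2 - rho 0 j ^+ 2 * W j j| * 2^-1 <= N * (e * (2 * N / g * e)).
  by apply: le_trans H; rewrite ler_wpM2l.
have -> : N * (e * (2 * N / g * e)) = c2 * e ^+ 2 * 2^-1.
  by rewrite /c2; field; rewrite gt_eqF.
by rewrite ler_pM2r ?invr_gt0.
Qed.

Let s := pos_sign (y j 0).

Let sy : s * y j 0 = `|y j 0|.
Proof.
by rewrite /s /pos_sign; case: ger0P => _; rewrite ?mul1r ?mulN1r.
Qed.

Let sn : `|s| = 1.
Proof. by rewrite /s /pos_sign; case: ifP; rewrite ?normrN normr1. Qed.

Lemma eigvec_diag : `|s * y j 0 - 1| <= c1 * e ^+ 2.
Proof.
rewrite sy distrC ger0_norm ?subr_ge0 //.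
apply: le_trans eigvec_diag_sqr; rewrite -(@real_normK _ (y j 0)) ?num_real //.
have := y1 j; have := normr_ge0 (y j 0); set a := `|_|; nra.
Qed.

Lemma eigvec_expansion k : k != j ->
  `|(rho 0 j ^+ 2 - rho 0 k ^+ 2) * (s * y k 0) - rho 0 k * rho 0 j * W k j|
    <= c3 * e ^+ 2.
Proof.
move=> kj; have H := @sum_coord_le k (2 * N / g * e) (fun l => l != j)
  (mulr_ge0 Ng0 e0) eigvec_off_diag.
set r := \sum_(l | _) _ in H.
have -> : (rho 0 j ^+ 2 - rho 0 k ^+ 2) * (s * y k 0) - rho 0 k * rho 0 j * W k j =
   rho 0 k * rho 0 j * W k j * (s * y j 0 - 1) + s * r
   - s * ((lam - rho 0 j ^+ 2) * y k 0).
  have := eigen_coord k; rewrite (bigD1 j) //= -/r => Ek.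
  have -> : r = (lam - rho 0 k ^+ 2) * y k 0 - rho 0 k * rho 0 j * W k j * y j 0.
    by rewrite Ek addrAC subrr add0r.
  ring.
have c10 : 0 <= c1 by rewrite mulr_ge0 // sqr_ge0.
have c20 : 0 <= c2 by apply: mulr_ge0 => //; exact: mulr_ge0.
apply: le_trans (ler_normB _ _) _.
have T1 : `|rho 0 k * rho 0 j * W k j * (s * y j 0 - 1) + s * r| <=
    c1 * e ^+ 2 + N * (2 * N / g) * e ^+ 2.
  apply: le_trans (ler_normD _ _) _; apply: lerD.
    rewrite normrM -[leRHS]mul1r; apply: ler_pM => //; last exact: eigvec_diag.
    exact: le_trans (rW k j) e1.
  rewrite normrM sn mul1r; apply: le_trans H _.
  by have -> : N * (e * (2 * N / g * e)) = N * (2 * N / g) * e ^+ 2 by ring.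
have T2 : `|s * ((lam - rho 0 j ^+ 2) * y k 0)| <= (1 + c2) * (2 * N / g) * e ^+ 2.
  rewrite normrM sn mul1r normrM.
  have -> : (1 + c2) * (2 * N / g) * e ^+ 2 = (1 + c2) * e * (2 * N / g * e) by ring.
  apply: ler_pM => //; last exact: eigvec_off_diag.
  have -> : lam - rho 0 j ^+ 2 =
      (lam - rho 0 j ^+ 2 - rho 0 j ^+ 2 * W j j) + rho 0 j * rho 0 j * W j j.
    by rewrite expr2 subrK.
  apply: le_trans (ler_normD _ _) _; rewrite mulrDl mul1r addrC.
  apply: lerD => //; apply: le_trans eigval_expansion _.
  by rewrite ler_wpM2l // expr2 ler_piMr.
apply: le_trans (lerD T1 T2) _.
by rewrite /c3 !mulrDl.
Qed.

End eigen.

End perturbation.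

(** * Uniform perturbation bounds for spaced singular values *)

Section frame_perturbation.
Context {R : realType}.

(** When the characteristic polynomial does not split, [eigvals] is 0 by default,
    and a unit eigenvector for it lies in the kernel. A nonsingular matrix that has
    one must therefore have a split characteristic polynomial. *)
Lemma eigvals_nonsingular n (A : 'M[R]_n.+1) (x : 'cV[R]_n.+1) :
  is_eigvec A ord0 x -> (forall z : 'cV[R]_n.+1, A *m z = 0 -> z = 0) ->
  (forall i j : 'I_n.+1, (i <= j)%N -> eigvals A 0 j <= eigvals A 0 i) /\
  char_poly A = \prod_(i < n.+1) ('X - (eigvals A 0 i)%:P).
Proof.
move=> [Ax x1 _] A0; rewrite /eigvals; case: xgetP => [mu -> //|no].
move: Ax; rewrite /eigvals; case: xgetP => [mu _ /no //|_].
rewrite mxE scale0r => /A0 x0; move: x1; rewrite x0 /dotv mulmx0 mxE => /esym.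
by move/eqP; rewrite oner_eq0.
Qed.

Lemma char_poly_prod n (A : 'M[R]_n) (lam : 'rV[R]_n) x :
  char_poly A = \prod_(i < n) ('X - (lam 0 i)%:P) ->
  \prod_(i < n) (x - lam 0 i) = \det (x%:M - A).
Proof.
move=> E; rewrite -char_poly_eval E horner_prod.
by apply: eq_bigr => i _; rewrite hornerXsubC.
Qed.

Lemma det_orthogonal_conj n (V A : 'M[R]_n) x : V^T *m V = 1%:M ->
  \det (x%:M - V *m A *m V^T) = \det (x%:M - A).
Proof.
move=> VV; have VV' := mulmx1C VV.
have -> : x%:M - V *m A *m V^T = V *m (x%:M - A) *m V^T.
  rewrite mulmxBr mulmxBl; congr (_ - _).
  by rewrite mul_mx_scalar -scalemxAl VV' scalemx1.
rewrite !det_mulmx mulrAC -det_mulmx VV' det1 mul1r //.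
Qed.

Lemma perturbed_scale n (c : R) (rho : 'rV[R]_n) (W : 'M[R]_n) :
  perturbed (c *: rho) W = c ^+ 2 *: perturbed rho W.
Proof.
by apply/matrixP => i j; rewrite [RHS]mxE !perturbedE !mxE; case: (i == j);
   rewrite ?mulr1n ?mulr0n; ring.
Qed.

(** In the sum norm W contracts by n e < 1, so 1 + W has no kernel. *)
Lemma perturbed_nonsingular n (ell : 'rV[R]_n) (W : 'M[R]_n) (e : R) :
  (forall i, 0 < ell 0 i) -> (forall i j, `|W i j| <= e) -> n%:R * e < 1 ->
  forall z : 'cV[R]_n, perturbed ell W *m z = 0 -> z = 0.
Proof.
move=> ell0 We ne z; rewrite /perturbed -!mulmxA => E.
have [u uD] : exists u : 'cV[R]_n, u = diag_mx ell *m z by exists (diag_mx ell *m z).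
rewrite -uD in E.
have uE : (1%:M + W) *m u = 0.
  apply/matrixP => i j; have := congr1 (fun M : 'cV[R]_n => M i j) E.
  rewrite mul_diag_mx mxE [RHS]mxE => /eqP; rewrite mulf_eq0 gt_eqF //=.
  by move=> /eqP ->; rewrite mxE.
have uk k : u k 0 = - \sum_l W k l * u l 0.
  have := congr1 (fun M : 'cV[R]_n => M k 0) uE.
  rewrite mulmxDl mul1mx mxE [(W *m u) _ _]mxE mxE => /eqP.
  by rewrite addr_eq0 => /eqP.
have H : \sum_k `|u k 0| <= n%:R * e * \sum_k `|u k 0|.
  have Hk k : `|u k 0| <= e * \sum_l `|u l 0|.
    rewrite uk normrN; apply: le_trans (ler_norm_sum _ _ _) _.
    by rewrite mulr_sumr; apply: ler_sum => l _; rewrite normrM ler_wpM2r.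
  apply: le_trans (ler_sum _ (fun k _ => Hk k)) _.
  by rewrite sumr_const card_ord -[X in X <= _]mulr_natl mulrA.
have s0 : 0 <= \sum_k `|u k 0| by apply: sumr_ge0.
have : \sum_k `|u k 0| == 0.
  rewrite eq_le s0 andbT -(pmulr_rle0 _ (_ : 0 < 1 - n%:R * e)) ?subr_gt0 //.
  by rewrite mulrBl mul1r subr_le0.
rewrite psumr_eq0 // => /allP u0; apply/matrixP => i j; rewrite ord1 mxE.
have := u0 i (mem_index_enum _); rewrite normr_eq0 uD mul_diag_mx mxE mulf_eq0.
by rewrite gt_eqF //= => /eqP.
Qed.

(** Scale-free conditioning: a bounded condition number K and relative gaps eta. *)
Definition spaced n (K eta : R) (ell : 'rV[R]_n) :=
  [/\ forall i, 0 < ell 0 i, forall i j, ell 0 i <= K * ell 0 j &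
    forall i j : 'I_n, (i < j)%N -> (1 + eta) * ell 0 j <= ell 0 i].

Lemma spaced_ratio n (K eta : R) (l : 'rV[R]_n) : 1 <= K -> 0 < eta -> spaced K eta l ->
  forall i k : 'I_n, k != i -> `|l 0 k * l 0 i / (l 0 i ^+ 2 - l 0 k ^+ 2)| <= K ^+ 2 / eta.
Proof.
move=> K1 eta0 [l0 lK ls]; have K0 : 0 <= K by apply: le_trans K1.
suff H (i k : 'I_n) : (i < k)%N -> `|l 0 k * l 0 i / (l 0 i ^+ 2 - l 0 k ^+ 2)| <= K ^+ 2 / eta.
  move=> i k; rewrite neq_ltn => /orP[ki|ik]; last exact: H.
  by rewrite [l 0 k * _]mulrC -normrN -mulrN -invrN opprB; exact: H.
move=> ik; have li := l0 i; have lk := l0 k.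
have gap : eta * l 0 k ^+ 2 <= l 0 i ^+ 2 - l 0 k ^+ 2.
  have := ls i k ik; set x := l 0 i; set y := l 0 k => xy.
  have : ((1 + eta) * y) ^+ 2 <= x ^+ 2.
    by rewrite lerXn2r ?nnegrE ?(ltW li) // mulr_ge0 ?addr_ge0 // ltW.
  have : 0 <= y ^+ 2 by exact: sqr_ge0.
  rewrite exprMn; have -> : (1 + eta) ^+ 2 = 1 + 2 * eta + eta ^+ 2 by ring.
  by have := sqr_ge0 eta; nra.
have gap0 : 0 < l 0 i ^+ 2 - l 0 k ^+ 2.
  by apply: lt_le_trans gap; rewrite mulr_gt0 // exprn_gt0.
rewrite ger0_norm; last by rewrite divr_ge0 ?mulr_ge0 // ltW.
rewrite ler_pdivrMr //.
apply: (@le_trans _ _ (K ^+ 2 / eta * (eta * l 0 k ^+ 2))); last first.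
  by rewrite ler_wpM2l // divr_ge0 ?exprn_ge0 // ltW.
have -> : K ^+ 2 / eta * (eta * l 0 k ^+ 2) = (K ^+ 2 * l 0 k) * l 0 k.
  by field; rewrite gt_eqF.
rewrite mulrC ler_wpM2r ?(ltW lk) //; apply: le_trans (lK i k) _.
by rewrite ler_wpM2r ?(ltW lk) // expr2 ler_peMl.
Qed.

(** The eigenvalue lam and the coordinates y of a unit eigenvector agree, up to
    b and up to the sign of y, with their first-order expansions in W. *)
Definition first_order n (ell : 'rV[R]_n) (W : 'M[R]_n) (b : R) (j : 'I_n)
    (lam : R) (y : 'cV[R]_n) :=
  [/\ `|lam / ell 0 j ^+ 2 - 1 - W j j| <= b,
      `|pos_sign (y j 0) * y j 0 - 1| <= b &
      forall k, k != j -> `|pos_sign (y j 0) * y k 0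
        - ell 0 k * ell 0 j / (ell 0 j ^+ 2 - ell 0 k ^+ 2) * W k j| <= b].

(** The constants only depend on K, eta and the dimension because everything is
    invariant under scaling: after division by the largest singular value, all of
    them lie in [1/K, 1] and the gaps of their squares are bounded below. *)
Lemma frame_perturbation p (K eta : R) : 1 <= K -> 0 < eta ->
  exists e0 C : R, [/\ 0 < e0, 0 <= C &
  forall (ell : 'rV[R]_p.+1) (W V : 'M[R]_p.+1) (lam : 'rV[R]_p.+1) (e : R),
    spaced K eta ell -> V^T *m V = 1%:M ->
    (forall i j, `|W i j| <= e) -> e <= e0 ->
    (forall i j : 'I_p.+1, (i <= j)%N -> lam 0 j <= lam 0 i) ->
    (forall x, \prod_(i < p.+1) (x - lam 0 i) =
      \det (x%:M - V *m perturbed ell W *m V^T)) ->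
    (forall j k : 'I_p.+1, (j < k)%N -> lam 0 k < lam 0 j) /\
    (forall (j : 'I_p.+1) (x : 'cV[R]_p.+1),
       V *m perturbed ell W *m V^T *m x = lam 0 j *: x -> dotv x x = 1 ->
       first_order ell W (C * e ^+ 2) j (lam 0 j) (V^T *m x))].
Proof.
move=> K1 eta0; have K0 : 0 < K by apply: lt_le_trans K1.
pose N : R := p.+1%:R; have N0 : 0 < N by rewrite ltr0n.
(* A lower bound for the gaps of the normalized squares, which are at
   least K^-2 and whose consecutive ratios are at least (1 + eta)^2. *)
pose g : R := 2 * eta / K ^+ 2.
have g0 : 0 < g by rewrite divr_gt0 ?exprn_gt0 // mulr_gt0.
pose c1 : R := N * (2 * N / g) ^+ 2.
pose c2 : R := 2 * (N * (2 * N / g)).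
pose c3 : R := c1 + N * (2 * N / g) + (1 + c2) * (2 * N / g).
have Ng0 : 0 < 2 * N / g by rewrite divr_gt0 // mulr_gt0.
have c10 : 0 < c1 by rewrite mulr_gt0 // exprn_gt0.
have c20 : 0 < c2 by rewrite mulr_gt0 // mulr_gt0.
have c30 : 0 < c3.
  by apply: addr_gt0; [apply: addr_gt0 => //; exact: mulr_gt0|
    apply: mulr_gt0 => //; exact: addr_gt0].
(* The three bounds in e0 give entries at most 1, the localization of the
   eigenvalues, and the lower bound 1/2 on the diagonal coordinate. *)
pose a : R := #|'S_p.+1|%:R * 2 ^+ p.+1.
have a0 : 0 <= a by rewrite mulr_ge0 ?exprn_ge0.
pose e0 : R := Num.min 1 (Num.min ((g / 2) ^+ p.+1 / (a + 1)) (3 / 4 / (c1 + 1))).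
have a1 : 0 < a + 1 by rewrite ltr_wpDl.
have c11 : 0 < c1 + 1 by rewrite addr_gt0.
have g20 : 0 < g / 2 by rewrite divr_gt0.
exists e0, (c1 + c2 * K ^+ 2 + c3 / g); split.
- by rewrite !lt_min ltr01 /= (divr_gt0 (exprn_gt0 _ g20) a1) /= !divr_gt0.
- by rewrite !addr_ge0 ?mulr_ge0 ?invr_ge0 ?exprn_ge0 // ltW.
move=> ell W V lam e [ell0 ellK ellS] VV We ee0 lamS charE.
have en0 : 0 <= e by apply: le_trans (We ord0 ord0).
have [e1 ea ec] : [/\ e <= 1, a * e < (g / 2) ^+ p.+1 & c1 * e ^+ 2 <= 3 / 4].
  move: ee0; rewrite !le_min => /and3P[e1 ea ec]; split => //.
    move: ea; rewrite ler_pdivlMr // => ea.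
    have [->|en] := eqVneq e 0; first by rewrite mulr0 exprn_gt0.
    apply: lt_le_trans ea.
    by rewrite mulrC ltr_pM2l ?ltrDl // lt_neqAle eq_sym en.
  move: ec; rewrite ler_pdivlMr // => ec; apply: le_trans ec.
  rewrite expr2 mulrA mulrC ler_wpM2l // mulrC.
  apply: le_trans (_ : 1 * c1 <= _); last by rewrite mul1r lerDl.
  by rewrite ler_wpM2r // ltW.
pose sg := ell 0 ord0; have sg0 : 0 < sg by exact: ell0.
pose rho : 'rV[R]_p.+1 := sg^-1 *: ell.
have rhoE i : rho 0 i = ell 0 i / sg by rewrite mxE mulrC.
have ellE : ell = sg *: rho by rewrite scalerA divff ?scale1r // gt_eqF.
have ell_le (i j : 'I_p.+1) : (i <= j)%N -> ell 0 j <= ell 0 i.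
  rewrite leq_eqVlt => /orP[/eqP/val_inj -> //|ij]; apply: le_trans (ellS _ _ ij).
  by rewrite ler_peMl ?lerDl // ltW.
have rho01 i : 0 <= rho 0 i <= 1.
  rewrite rhoE; apply/andP; split; first by rewrite divr_ge0 // ltW.
  by rewrite ler_pdivrMr // mul1r ell_le.
have rhoK i : K^-1 <= rho 0 i.
  rewrite rhoE ler_pdivlMr // ler_pdivrMl //; exact: ellK.
have gap (j k : 'I_p.+1) : (j < k)%N -> g <= rho 0 j ^+ 2 - rho 0 k ^+ 2.
  move=> jk; have rjk : (1 + eta) * rho 0 k <= rho 0 j.
    by rewrite !rhoE mulrA ler_pM2r ?invr_gt0 // ellS.
  have : K^-1 ^+ 2 <= rho 0 k ^+ 2.
    by rewrite ler_pXn2r ?nnegrE ?invr_ge0 ?(ltW K0) //; case/andP: (rho01 k).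
  rewrite /g -exprVn; have : ((1 + eta) * rho 0 k) ^+ 2 <= rho 0 j ^+ 2.
    rewrite ler_pXn2r ?nnegrE //; last by case/andP: (rho01 j).
    by rewrite mulr_ge0 ?addr_ge0 ?(ltW eta0) //; case/andP: (rho01 k).
  rewrite exprMn; set b := _ ^+ 2; set c := rho 0 k ^+ 2; set dd := K^-1 ^+ 2.
  have c0' : 0 <= c by exact: sqr_ge0.
  have -> : b = 1 + 2 * eta + eta ^+ 2 by rewrite /b; ring.
  by move=> H1 H2; nra.
pose lam' : 'rV[R]_p.+1 := (sg ^- 2) *: lam.
have lam'E i : lam' 0 i = lam 0 i / sg ^+ 2 by rewrite mxE mulrC.
have sg20 : 0 < sg ^+ 2 by rewrite exprn_gt0.
have charE' x : \prod_(i < p.+1) (x - lam' 0 i) = \det (x%:M - perturbed rho W).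
  have -> : x%:M - perturbed rho W =
      sg ^- 2 *: ((sg ^+ 2 * x)%:M - perturbed ell W).
    rewrite ellE perturbed_scale scalerBr scalerA mulVf ?gt_eqF // scale1r.
    by rewrite scale_scalar_mx mulKf // gt_eqF.
  rewrite detZ -(det_orthogonal_conj _ _ VV) -charE.
  rewrite -[X in _ ^+ X * _]card_ord -prodr_const -big_split /=.
  apply: eq_bigr => i _; rewrite lam'E; field; by rewrite gt_eqF.
have close := eigval_close g0 e1 rho01 gap We (lam := lam') _ charE' _.
have {}close j : `|rho 0 j ^+ 2 - lam' 0 j| < g / 2.
  apply: close; last by rewrite mulrA.
  by move=> i k ik; rewrite !lam'E ler_pM2r ?invr_gt0 // lamS.
have cC1 : c1 <= c1 + c2 * K ^+ 2 + c3 / g.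
  by rewrite -addrA lerDl addr_ge0 ?mulr_ge0 ?invr_ge0 ?exprn_ge0 // ltW.
have cC2 : c2 * K ^+ 2 <= c1 + c2 * K ^+ 2 + c3 / g.
  rewrite addrAC lerDr addr_ge0 ?mulr_ge0 ?invr_ge0 // ltW //.
have cC3 : c3 / g <= c1 + c2 * K ^+ 2 + c3 / g.
  rewrite lerDr addr_ge0 ?(ltW c10) // mulr_ge0 ?(ltW c20) //.
  by rewrite exprn_ge0 // ltW.
have e20 : 0 <= e ^+ 2 by exact: sqr_ge0.
split.
- move=> j k jk; rewrite -(ltr_pM2r (_ : 0 < sg ^- 2)) ?invr_gt0 // -!lam'E.
  have := gap _ _ jk; have := close j; have := close k.
  by rewrite !ltr_norml => /andP[? ?] /andP[? ?]; lra.
- move=> j x eigx x1; pose y := V^T *m x; rewrite -/y.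
have VV' := mulmx1C VV.
have eigy : perturbed rho W *m y = lam' 0 j *: y.
  have : perturbed ell W *m y = lam 0 j *: y.
    by rewrite /y scalemxAr -eigx !mulmxA VV mul1mx.
  rewrite ellE perturbed_scale -scalemxAl => H.
  have := congr1 (fun v => sg ^- 2 *: v) H.
  by rewrite !scalerA mulVf ?gt_eqF // scale1r lam'E mulrC.
have y1 : dotv y y = 1.
  by rewrite /dotv /y trmx_mul trmxK -mulmxA (mulmxA V) VV' mul1mx.
have rj0 : 0 < rho 0 j by apply: lt_le_trans (rhoK j); rewrite invr_gt0.
split.
- have := eigval_expansion g0 rho01 gap We (close j) eigy y1 ec.
  have -> : lam 0 j / ell 0 j ^+ 2 - 1 - W j j =
      (lam' 0 j - rho 0 j ^+ 2 - rho 0 j ^+ 2 * W j j) / rho 0 j ^+ 2.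
    rewrite lam'E rhoE; field; rewrite !gt_eqF //; exact: ell0.
  rewrite normrM normrV ?unitfE ?gt_eqF ?exprn_gt0 // (ger0_norm (sqr_ge0 _)) => H.
  rewrite ler_pdivrMr ?exprn_gt0 //; apply: le_trans H _.
  apply: (@le_trans _ _ (c2 * K ^+ 2 * e ^+ 2 * rho 0 j ^+ 2)); last first.
    by rewrite ler_wpM2r ?sqr_ge0 // ler_wpM2r.
  have : 1 <= K ^+ 2 * rho 0 j ^+ 2.
    rewrite -exprMn; apply: exprn_ege1; rewrite -ler_pdivrMl // mulr1.
    exact: rhoK.
  have -> : c2 * K ^+ 2 * e ^+ 2 * rho 0 j ^+ 2 =
    c2 * e ^+ 2 * (K ^+ 2 * rho 0 j ^+ 2) by ring.
  by move=> H1; rewrite ler_peMr // mulr_ge0 // ltW.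
- have := eigvec_diag g0 rho01 gap We (close j) eigy y1.
  by move=> H; apply: le_trans H _; rewrite ler_wpM2r.
- move=> k kj.
  have := eigvec_expansion g0 e1 rho01 gap We (close j) eigy y1 ec kj.
  set D := rho 0 j ^+ 2 - rho 0 k ^+ 2 => H.
  have gD : g <= `|D|.
    case: (ltngtP k j) kj => [kj _|jk _|/val_inj -> /eqP //].
      by rewrite /D distrC; apply: le_trans (gap _ _ kj) (ler_norm _).
    by apply: le_trans (gap _ _ jk) (ler_norm _).
  have D0 : D != 0 by rewrite -normr_gt0; apply: lt_le_trans gD.
  have DE : ell 0 j ^+ 2 - ell 0 k ^+ 2 = sg ^+ 2 * D.
    by rewrite /D !rhoE; field; rewrite gt_eqF.
  have -> : pos_sign (y j 0) * y k 0 -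
      ell 0 k * ell 0 j / (ell 0 j ^+ 2 - ell 0 k ^+ 2) * W k j =
      (D * (pos_sign (y j 0) * y k 0) - rho 0 k * rho 0 j * W k j) / D.
    by rewrite DE !rhoE; field; rewrite D0 gt_eqF.
  rewrite normrM normrV ?unitfE // ler_pdivrMr ?normr_gt0 //.
  apply: le_trans H _; apply: (@le_trans _ _ (c3 / g * e ^+ 2 * `|D|)); last first.
    by rewrite ler_wpM2r // ler_wpM2r.
  have -> : c3 / g * e ^+ 2 * `|D| = c3 * e ^+ 2 * (`|D| / g) by ring.
  by rewrite ler_peMr ?mulr_ge0 ?(ltW c30) // ler_pdivlMr // mul1r.
Qed.

End frame_perturbation.

(** * Half-vectorization and whitening *)

Section half_vectorization.
Context {R : realType}.
Implicit Types p q : nat.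

Section pairs.
Variable p : nat.
Implicit Types i j k l : 'I_p.

Definition sort_pair i j : 'I_p * 'I_p := if (i <= j)%N then (i, j) else (j, i).

Lemma sort_pair_upper i j : sort_pair i j \in upper_pairs p.
Proof. by rewrite inE /sort_pair; case: (leqP i j) => [ij|/ltnW ij] /=. Qed.

(** The position of the entry (i, j) of a symmetric matrix in its half-vectorization. *)
Definition half_idx i j : 'I_#|upper_pairs p| :=
  enum_rank_in (sort_pair_upper i j) (sort_pair i j).

Lemma half_idxK i j : enum_val (half_idx i j) = sort_pair i j.
Proof. by rewrite enum_rankK_in // sort_pair_upper. Qed.

Definition half_vec (W : 'M[R]_p) : 'cV[R]_#|upper_pairs p| := (Dmx p)^T *m vec W.

Lemma half_vecE (W : 'M[R]_p) s :
  half_vec W s 0 = W (enum_val s).1 (enum_val s).2.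
Proof.
rewrite mxE (bigD1 (vec_idx (enum_val s).1 (enum_val s).2)) //= vecE.
rewrite [X in X * _]mxE [X in X * _]mxE eqxx mul1r big1 ?addr0 // => r rs.
by rewrite [X in X * _]mxE [X in X * _]mxE (negbTE rs) mul0r.
Qed.

Lemma half_vec_sym (W : 'M[R]_p) i j : W^T = W -> half_vec W (half_idx i j) 0 = W i j.
Proof.
move=> WT; rewrite half_vecE half_idxK /sort_pair; case: leqP => //= _.
by rewrite -[in RHS]WT mxE.
Qed.

Lemma DGDE n (U : 'M[R]_(n, p)) s t : DGD U s t =
  n%:R * \sum_(h < n) U h (enum_val s).1 * U h (enum_val s).2 *
    U h (enum_val t).1 * U h (enum_val t).2.
Proof.
rewrite -GmxE; set a := vec_idx (enum_val s).1 _; set b := vec_idx (enum_val t).1 _.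
rewrite /DGD mxE (bigD1 b) //= big1 ?addr0 => [|r rb]; last first.
  by rewrite [X in _ * X]mxE (negbTE rb) mulr0.
rewrite [X in _ * X]mxE eqxx mulr1 mxE (bigD1 a) //= big1 ?addr0 => [|r ra].
  by rewrite 2!mxE eqxx mul1r.
by rewrite 2!mxE (negbTE ra) mul0r.
Qed.

Lemma DGD_half_idx n (U : 'M[R]_(n, p)) i j k l :
  DGD U (half_idx i j) (half_idx k l) = Gmx U (vec_idx i j) (vec_idx k l).
Proof.
rewrite DGDE GmxE !half_idxK; congr (_ * _); apply: eq_bigr => h _.
by rewrite /sort_pair; case: (leqP i j) => _; case: (leqP k l) => _ /=; ring.
Qed.

(** The vector that represents the linear form W |-> \sum_k c_k W_(k, i) on
    half-vectorized symmetric matrices. *)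
Definition col_form (c : 'I_p -> R) i : 'cV[R]_#|upper_pairs p| :=
  \sum_k c k *: delta_mx (half_idx k i) 0.

Lemma col_formE c i (W : 'M[R]_p) : W^T = W ->
  dotv (col_form c i) (half_vec W) = \sum_k c k * W k i.
Proof.
move=> WT; rewrite /dotv /col_form raddf_sum mulmx_suml summxE.
apply: eq_bigr => k _.
by rewrite -[LHS]/(dotv _ _) dotvZl dotv_delta half_vec_sym.
Qed.

Lemma qform_col_form n (U : 'M[R]_(n, p)) c i : qform (DGD U) (col_form c i) =
  \sum_k \sum_l c k * c l * Gmx U (vec_idx i k) (vec_idx i l).
Proof.
rewrite /qform {1}/col_form /dotv raddf_sum mulmx_suml summxE.
apply: eq_bigr => k _; rewrite -[LHS]/(dotv _ _) dotvZl dotv_delta.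
rewrite /col_form mulmx_sumr summxE mulr_sumr; apply: eq_bigr => l _.
rewrite -scalemxAr mxE mulrA; congr (_ * _).
rewrite -colE mxE DGD_half_idx !GmxE; congr (_ * _).
by apply: eq_bigr => h _; ring.
Qed.

End pairs.

(** Here H is G^(-1/2). A linear form x.u is (H^-1 x).(H u), and the norm of H^-1 x
    is the standard deviation of x.u when H u has the identity as covariance. *)
Section whitening.
Variables (q : nat) (G H : 'M[R]_q) (c0 C0 : R).
Hypothesis c00 : 0 < c0.
Hypothesis Glo : loewner_le c0%:M G.
Hypothesis Gup : loewner_le G C0%:M.

Lemma qform_scalar c (x : 'cV[R]_q) : qform c%:M x = c * dotv x x.
Proof. by rewrite /qform mul_scalar_mx dotvZr. Qed.

Lemma qformB (A B : 'M[R]_q) x : qform (A - B) x = qform A x - qform B x.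
Proof. by rewrite /qform mulmxBl dotvBr. Qed.

Lemma qform_lower x : c0 * dotv x x <= qform G x.
Proof. by have := Glo.2 x; rewrite qformB qform_scalar subr_ge0. Qed.

Lemma qform_upper x : qform G x <= C0 * dotv x x.
Proof. by have := Gup.2 x; rewrite qformB qform_scalar subr_ge0. Qed.

Lemma loewner_unitmx : G \in unitmx.
Proof.
rewrite -unitmx_tr -row_free_unit -kermx_eq0; apply/eqP/row_matrixP => i.
rewrite row0; set v := row i _.
have vG : v *m G^T = 0 by apply/sub_kermxP; exact: row_sub.
have Gv : G *m v^T = 0 by rewrite -[G]trmxK -trmx_mul vG trmx0.
have qv : qform G v^T = 0 by rewrite /qform Gv /dotv mulmx0 mxE.
have : dotv v^T v^T = 0.
  apply/eqP; rewrite eq_le dotv_ge0 andbT.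
  by rewrite -(pmulr_rle0 _ c00) -qv qform_lower.
by move/dotv_eq0 => v0; rewrite -[v]trmxK v0 trmx0.
Qed.

Hypothesis HT : H^T = H.
Hypothesis HH : H *m H = invmx G.

Lemma whitening_unit : H \in unitmx.
Proof.
have : H *m H \in unitmx by rewrite HH unitmx_inv loewner_unitmx.
by rewrite unitmx_mul andbb.
Qed.

Lemma whitening_inv_sqr : invmx H *m invmx H = G.
Proof.
have U := whitening_unit.
have e : H *m H *m G = 1%:M by rewrite HH mulVmx // loewner_unitmx.
by rewrite -[invmx H *m invmx H]mulmx1 -e !mulmxA mulmxKV // mulVmx // mul1mx.
Qed.

Lemma whitening_invT : (invmx H)^T = invmx H.
Proof. by rewrite trmx_inv HT. Qed.

Lemma whitening_norm x : dotv (invmx H *m x) (invmx H *m x) = qform G x.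
Proof.
by rewrite /qform -whitening_inv_sqr -mulmxA [RHS]dotv_mulmx whitening_invT.
Qed.

Lemma whitening_form x u : dotv x u = dotv (invmx H *m x) (H *m u).
Proof.
by rewrite -{1}whitening_invT -dotv_mulmx mulmxA mulVmx ?mul1mx // whitening_unit.
Qed.

Lemma whitening_form_le x u b : 0 <= b -> qform G x <= b ^+ 2 ->
  `|dotv x u| <= b * \sum_k `|(H *m u) k 0|.
Proof.
move=> b0 xb; rewrite whitening_form dotvE.
apply: le_trans (ler_norm_sum _ _ _) _; rewrite mulr_sumr; apply: ler_sum => k _.
rewrite normrM ler_wpM2r // -(@ler_pXn2r _ 2) ?nnegrE // real_normK ?num_real //.
by apply: le_trans (coord_sqr_le _ _) _; rewrite whitening_norm.
Qed.

End whitening.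

End half_vectorization.

(** * Bernoulli samples *)

Section bernoulli_sampling.
Context {R : realType} (d : measure_display) (T : measurableType d)
  (P : probability T R) (n : nat) (B : 'I_n -> {RV P >-> bool}).

(** The sample takes finitely many values, so every function of it is measurable.
    In particular the choice of eigenvectors and eigenvalues raises no measurability
    question. *)
Lemma sample_measurable (Q : ('I_n -> bool) -> Prop) :
  measurable [set w | Q (fun i => B i w)].
Proof.
have -> : [set w | Q (fun i => B i w)] =
    \bigcup_(b in [set b : {ffun 'I_n -> bool} | Q b])
      \bigcap_(i in [set: 'I_n]) (B i @^-1` [set b i]).
  apply/seteqP; split => w /=.
    move=> Qw; exists [ffun i => B i w] => /=.
      rewrite (_ : fun_of_fin _ = fun i => B i w) //.
      by apply/funext => i; rewrite ffunE.
    by move=> i _ /=; rewrite ffunE.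
  move=> [b Qb Bb]; rewrite (_ : (fun i => B i w) = b) //.
  by apply/funext => i; exact: Bb.
apply: fin_bigcup_measurable => // b _; apply: fin_bigcap_measurable => // i _.
by rewrite -[X in measurable X]setTI; exact: measurable_funP.
Qed.

Lemma sample_measurable_fun (g : ('I_n -> bool) -> R) :
  measurable_fun setT (fun w => g (fun i => B i w)).
Proof.
move=> _ Y _; rewrite setTI.
exact: (sample_measurable (fun b => Y (g b))).
Qed.

Lemma Rintegral_sum (I : Type) (s : seq I) (f : I -> T -> R) (K : I -> R) :
  (forall i, measurable_fun setT (f i)) -> (forall i w, `|f i w| <= K i) ->
  \int[P]_w (\sum_(i <- s) f i w) = \sum_(i <- s) \int[P]_w f i w.
Proof.
move=> mf fK; elim: s => [|i s IH].
  rewrite big_nil; transitivity (\int[P]_w (0 : R)).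
    by apply: eq_Rintegral => w _; rewrite big_nil.
  by rewrite Rintegral_cst // mul0r.
rewrite big_cons -IH -RintegralD //.
- by apply: eq_Rintegral => w _; rewrite big_cons.
- exact: (bounded_integrable P (mf i) (fK i)).
- apply: (@bounded_integrable _ _ _ P _ (\sum_(i <- s) K i)).
    by apply: measurable_sum.
  move=> w; apply: le_trans (ler_norm_sum _ _ _) _.
  by apply: ler_sum => j _; exact: fK.
Qed.

Lemma chebyshev_bounded (f : T -> R) (K e : R) :
  measurable_fun setT f -> (forall w, `|f w| <= K) -> 0 < e ->
  (P [set w | (e < `|f w|)%R] <= (\int[P]_w (f w ^+ 2) / e ^+ 2)%:E)%E.
Proof.
move=> mf fK e0.
have mA : measurable [set w | e < `|f w|].
  rewrite [X in measurable X](_ : _ = (fun w => `|f w|) @^-1` `]e, +oo[).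
    have mnf : measurable_fun setT (fun w => `|f w|) by exact: measurableT_comp.
    by rewrite -[X in measurable X]setTI; exact: mnf.
  by apply/seteqP; split => x /=; rewrite in_itv /= andbT.
rewrite -[leLHS]fineK ?fin_num_measure // lee_fin ler_pdivlMr ?exprn_gt0 //.
rewrite [X in X * _](_ : _ = \int[P]_w \1_[set w | e < `|f w|] w); last first.
  by rewrite /Rintegral integral_indic // setIT.
have iA : P.-integrable setT (EFin \o (\1_[set w | e < `|f w|] : T -> R)).
  apply: (@bounded_integrable _ _ _ P _ 1); first exact: measurable_indic.
  by move=> x; rewrite indicE; case: (_ \in _); rewrite ?normr1 ?normr0.
rewrite -RintegralZr //; apply: le_Rintegral => //.
- apply: (@bounded_integrable _ _ _ P _ (e ^+ 2)).
    by apply: measurable_funM => //; exact: measurable_indic.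
  move=> x; rewrite indicE; case: (_ \in _); rewrite ?mul1r ?mul0r ?normr0 ?sqr_ge0 //.
  by rewrite ger0_norm // sqr_ge0.
- apply: (@bounded_integrable _ _ _ P _ (K ^+ 2)); first exact: measurable_funX.
  move=> x; rewrite normrX ler_pXn2r ?nnegrE //.
  exact: le_trans (fK x).
- move=> w _; rewrite indicE; case: (asboolP (e < `|f w|)) => ef.
    rewrite mem_set // mul1r -(@real_normK _ (f w)) ?num_real //.
    by rewrite ler_pXn2r ?nnegrE // ltW.
  by rewrite memNset // mul0r sqr_ge0.
Qed.

Variable (g : R).
Hypothesis g0 : 0 < g.
Hypothesis g1 : g <= 1.
Hypothesis iidB : iid_bernoulli B g.

Let A j := [set w | B j w].

Let mA j : measurable (A j).
Proof. exact: (sample_measurable (fun b => b j)). Qed.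

Let PA j : P (A j) = g%:E.
Proof.
have -> : A j = B j @^-1` [set true] by apply/seteqP; split => w.
have := iidB.2 j [set true].
rewrite bernoulli_probE ?(ltW g0) // !diracE mem_set // memNset // mule1 mule0 adde0.
by move=> <-.
Qed.

Let PAA j k : j != k -> P (A j `&` A k) = (g ^+ 2)%:E.
Proof.
move=> jk; have := iidB.1 [set j; k]%SET (fun=> [set true]) (fun=> I).
rewrite (_ : \bigcap_(_ in _) _ = A j `&` A k); last first.
  apply/seteqP; split => w /=.
    by move=> H; split; [apply: (H j)|apply: (H k)]; rewrite /= !inE eqxx ?orbT.
  by move=> [wj wk] i /=; rewrite !inE => /orP[]/eqP ->.
move=> ->; rewrite big_setU1 ?inE //= big_set1.
have E i : B i @^-1` [set true] = A i by apply/seteqP; split => w.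
by rewrite !E !PA expr2 EFinM.
Qed.

Let x j w : R := (B j w)%:R / g - 1.

Let mx j : measurable_fun setT (x j).
Proof. exact: (sample_measurable_fun (fun b => (b j)%:R / g - 1)). Qed.

Let xK j w : `|x j w| <= g^-1 + 1.
Proof.
apply: le_trans (ler_normB _ _) _; rewrite normr1 lerD2r.
by case: (B j w); rewrite ?mul1r ?mul0r ?normr0 ?invr_ge0 ?(ltW g0) // ger0_norm // invr_ge0 ltW.
Qed.

Let indA j w : (B j w)%:R = \1_(A j) w :> R.
Proof.
rewrite indicE; case: (boolP (B j w)) => Bw.
  by rewrite (_ : w \in A j) // mem_set.
by rewrite memNset //; exact/negP.
Qed.

Lemma int_xx j k : \int[P]_w (x j w * x k w) = (g^-1 - 1) *+ (j == k).
Proof.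
have intI (D : set T) : measurable D -> \int[P]_w \1_D w = fine (P D).
  by move=> mD; rewrite /Rintegral integral_indic // setIT.
have iI (D : set T) c : measurable D -> P.-integrable setT (EFin \o (fun w => c * (\1_D w : R))).
  move=> mD; apply: (@bounded_integrable _ _ _ P _ `|c|).
    by apply: measurable_funM => //; exact: measurable_indic.
  by move=> w; rewrite indicE normrM ler_piMr //; case: (_ \in _); rewrite ?normr1 ?normr0.
have iZ (D : set T) c : measurable D -> \int[P]_w (c * \1_D w) = c * fine (P D).
  move=> mD; rewrite RintegralZl // ?intI //.
  by have := iI D 1 mD; under eq_fun do rewrite mul1r.
have mAA : measurable (A j `&` A k) by exact: measurableI.
transitivity (\int[P]_w ((g ^- 2 * \1_(A j `&` A k) w - g^-1 * \1_(A j) w)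
     - (g^-1 * \1_(A k) w - 1 * \1_setT w))).
  apply: eq_Rintegral => w _; rewrite /x !indA indicI indicT /=.
  by field; rewrite gt_eqF.
have iD : P.-integrable setT (EFin \o (fun w => g ^- 2 * (\1_(A j `&` A k) w : R) - g^-1 * \1_(A j) w)).
  have := integrableB measurableT (iI _ (g ^- 2) mAA) (iI _ g^-1 (mA j)).
  by apply: eq_integrable.
have iE : P.-integrable setT (EFin \o (fun w => g^-1 * (\1_(A k) w : R) - 1 * \1_setT w)).
  have := integrableB measurableT (iI _ g^-1 (mA k)) (iI _ 1 measurableT).
  by apply: eq_integrable.
rewrite RintegralB // RintegralB // ?iI // RintegralB // ?iI // !iZ //.
have -> : fine (P setT) = 1 by rewrite probability_setT.
rewrite !PA; have [<-|jk] := eqVneq j k; last first.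
  by rewrite (PAA jk) /= mulr0n; field; rewrite gt_eqF.
by rewrite setIid PA /= mulr1n; field; rewrite gt_eqF.
Qed.

(** The law of large numbers for weighted Bernoulli samples: by independence the
    variance of the weighted mean is at most its largest weight divided by g. *)
Lemma bernoulli_lln (a : 'I_n -> R) (b e : R) :
  (forall j, 0 <= a j <= b) -> \sum_j a j = 1 -> 0 < e ->
  exists D, [/\ measurable D, (P D <= (b / g / e ^+ 2)%:E)%E &
    forall w, ~ D w -> `|\sum_j a j * (B j w)%:R / g - 1| <= e].
Proof.
move=> ab a1 e0; pose f w := \sum_j a j * x j w.
have fE w : \sum_j a j * (B j w)%:R / g - 1 = f w.
  rewrite -[X in _ - X]a1 -sumrB; apply: eq_bigr => j _.
  by rewrite /x mulrBr mulr1 mulrA.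
have mf : measurable_fun setT f.
  exact: (sample_measurable_fun (fun b => \sum_j a j * ((b j)%:R / g - 1))).
have fK w : `|f w| <= g^-1 + 1.
  apply: le_trans (ler_norm_sum _ _ _) _.
  apply: (@le_trans _ _ (\sum_j a j * (g^-1 + 1))); last by rewrite -mulr_suml a1 mul1r.
  apply: ler_sum => j _; case/andP: (ab j) => aj _.
  by rewrite normrM ger0_norm // ler_wpM2l.
have Ef : \int[P]_w (f w ^+ 2) <= b / g.
  have -> : \int[P]_w (f w ^+ 2) = \sum_j \sum_k a j * a k * ((g^-1 - 1) *+ (j == k)).
    transitivity (\int[P]_w (\sum_j \sum_k a j * a k * (x j w * x k w))).
      apply: eq_Rintegral => w _; rewrite /f expr2 mulr_suml.
      apply: eq_bigr => j _; rewrite mulr_sumr.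
      by apply: eq_bigr => k _; ring.
    rewrite (Rintegral_sum _ (K := fun j => \sum_k `|a j * a k| * (g^-1 + 1) ^+ 2)).
    - apply: eq_bigr => j _.
      rewrite (Rintegral_sum _ (K := fun k => `|a j * a k| * (g^-1 + 1) ^+ 2)).
      + apply: eq_bigr => k _; rewrite RintegralZl ?int_xx //.
        apply: (@bounded_integrable _ _ _ P _ ((g^-1 + 1) ^+ 2)).
          exact: measurable_funM.
        by move=> w; rewrite normrM expr2; apply: ler_pM.
      + by move=> k; apply: measurable_funM => //; exact: measurable_funM.
      + move=> k w; rewrite normrM ler_wpM2l // normrM expr2.
        by apply: ler_pM.
    - move=> j; apply: measurable_sum => k.
      by apply: measurable_funM => //; exact: measurable_funM.
    - move=> j w; apply: le_trans (ler_norm_sum _ _ _) _; apply: ler_sum => k _.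
      by rewrite normrM ler_wpM2l // normrM expr2; apply: ler_pM.
  apply: (@le_trans _ _ (\sum_j a j * (b / g))); last by rewrite -mulr_suml a1 mul1r.
  apply: ler_sum => j _; rewrite (bigD1 j) //= big1 ?addr0 => [|k kj]; last first.
    by rewrite eq_sym (negbTE kj) mulr0n mulr0.
  case/andP: (ab j) => aj abj; rewrite eqxx mulr1n -mulrA ler_wpM2l //.
  by apply: ler_pM => //; rewrite ?subr_ge0 ?invf_ge1 // gerBl.
exists [set w | e < `|f w|]; split.
- exact: (sample_measurable (fun b => e < `|\sum_j a j * ((b j)%:R / g - 1)|)).
- apply: le_trans (chebyshev_bounded mf fK e0) _.
  by rewrite lee_fin ler_pM2r // invr_gt0 exprn_gt0.
- by move=> w /= /negP; rewrite -leNgt fE.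
Qed.

End bernoulli_sampling.

(** * Sums of fourth powers *)

Section quartic.
Context {R : realType}.

Lemma sqr_sum_le n (a : 'I_n -> R) :
  (\sum_k a k) ^+ 2 <= n%:R * \sum_k a k ^+ 2.
Proof.
have -> : (\sum_k a k) ^+ 2 = \sum_k \sum_l a k * a l.
  by rewrite expr2 mulr_suml; apply: eq_bigr => k _; rewrite mulr_sumr.
have -> : n%:R * \sum_k a k ^+ 2 = \sum_k \sum_l (a k ^+ 2 + a l ^+ 2) / 2.
  transitivity (\sum_k (n%:R * a k ^+ 2 + \sum_l a l ^+ 2) / 2).
    rewrite -mulr_suml big_split /= sumr_const card_ord -mulr_sumr.
    rewrite -[X in (_ + X) / 2]mulr_natl.
    by field.
  apply: eq_bigr => k _.
  by rewrite -mulr_suml big_split /= sumr_const card_ord mulr_natl.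
apply: ler_sum => k _; apply: ler_sum => l _.
have := sqr_ge0 (a k - a l); rewrite sqrrB ler_pdivlMr //; lra.
Qed.

Lemma pow4_sum_le n (a : 'I_n -> R) :
  (\sum_k a k) ^+ 4 <= n%:R ^+ 3 * \sum_k a k ^+ 4.
Proof.
have -> : (\sum_k a k) ^+ 4 = ((\sum_k a k) ^+ 2) ^+ 2 by rewrite -exprM.
apply: (@le_trans _ _ ((n%:R * \sum_k a k ^+ 2) ^+ 2)).
  rewrite ler_pXn2r ?nnegrE ?sqr_ge0 ?sqr_sum_le //.
  by rewrite mulr_ge0 // sumr_ge0 // => k _; exact: sqr_ge0.
have -> : n%:R ^+ 3 * \sum_k a k ^+ 4 = n%:R ^+ 2 * (n%:R * \sum_k a k ^+ 4) by ring.
rewrite exprMn ler_wpM2l ?sqr_ge0 //.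
apply: le_trans (sqr_sum_le _) _; rewrite ler_wpM2l //.
by apply: ler_sum => k _; rewrite -exprM.
Qed.

(** With x the perturbed value and M the sum norm of a, factor x^4 - a_i^4: the
    factor x - a_i is at most dl M, and the cofactor is at most 15 M^3 because
    |x| <= 2 M. *)
Lemma pow4_perturb n (i : 'I_n) (a z : 'I_n -> R) (dl : R) :
  dl <= 1 -> (forall k, `|z k - (k == i)%:R| <= dl) ->
  `|(\sum_k a k * z k) ^+ 4 - a i ^+ 4| <= 16 * dl * (\sum_k `|a k|) ^+ 4.
Proof.
move=> dl1 zdl; set x := \sum_k a k * z k; set M := \sum_k `|a k|.
have M0 : 0 <= M by apply: sumr_ge0.
have dl0 : 0 <= dl by apply: le_trans (zdl i).
have yM : `|a i| <= M by rewrite /M (bigD1 i) //= lerDl sumr_ge0.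
have xy : `|x - a i| <= dl * M.
  have -> : x - a i = \sum_k a k * (z k - (k == i)%:R).
    under [RHS]eq_bigr do rewrite mulrBr.
    rewrite sumrB; congr (_ - _); rewrite (bigD1 i) //= eqxx mulr1 big1 ?addr0 // => k ki.
    by rewrite (negbTE ki) mulr0.
  apply: le_trans (ler_norm_sum _ _ _) _; rewrite /M mulr_sumr.
  by apply: ler_sum => k _; rewrite normrM mulrC ler_wpM2r.
have xM : `|x| <= 2 * M.
  have -> : x = (x - a i) + a i by rewrite subrK.
  apply: le_trans (ler_normD _ _) _.
  have -> : 2 * M = M + M by ring.
  apply: lerD => //; apply: le_trans xy _.
  by rewrite ler_piMl.
have -> : x ^+ 4 - a i ^+ 4 =
    (x - a i) * (x ^+ 3 + x ^+ 2 * a i + x * a i ^+ 2 + a i ^+ 3) by ring.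
rewrite normrM; have -> : 16 * dl * M ^+ 4 = (dl * M) * (16 * M ^+ 3) by ring.
apply: ler_pM => //.
have x3 : `|x ^+ 3| <= 8 * M ^+ 3.
  have -> : 8 * M ^+ 3 = (2 * M) ^+ 3 by ring.
  by rewrite normrX lerXn2r ?nnegrE // mulr_ge0.
have x2 : `|x ^+ 2 * a i| <= 4 * M ^+ 3.
  have -> : 4 * M ^+ 3 = (2 * M) ^+ 2 * M by ring.
  by rewrite normrM normrX; apply: ler_pM => //; rewrite ?exprn_ge0 // lerXn2r ?nnegrE // mulr_ge0.
have x1 : `|x * a i ^+ 2| <= 2 * M ^+ 3.
  have -> : 2 * M ^+ 3 = (2 * M) * M ^+ 2 by ring.
  by rewrite normrM normrX; apply: ler_pM => //; rewrite ?exprn_ge0 // lerXn2r ?nnegrE.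
have x0 : `|a i ^+ 3| <= M ^+ 3 by rewrite normrX lerXn2r ?nnegrE.
apply: le_trans (ler_normD _ _) _.
apply: le_trans (lerD (ler_normD _ _) (lexx _)) _.
apply: le_trans (lerD (lerD (ler_normD _ _) (lexx _)) (lexx _)) _.
have : 0 <= M ^+ 3 by exact: exprn_ge0.
lra.
Qed.

End quartic.

(** * The asymptotic variance of an eigenvector *)

Section eigvec_variance.
Context {R : realType}.

(** The coefficient of W_(k, i) in the first-order expansion of c^T v_i. *)
Definition eigvec_coef p (lam : 'rV[R]_p) (v : 'I_p -> 'cV[R]_p) (i : 'I_p)
    (c : 'cV[R]_p) (k : 'I_p) : R :=
  if k == i then 0
  else Num.sqrt (lam 0 i * lam 0 k) / (lam 0 i - lam 0 k) * dotv c (v k).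

(** The bridge between Delta and the central limit theorem: c^T Delta c is the
    variance of the linear form with coefficients [eigvec_coef], since
    lam_i sqrt(lam_k lam_l) = sqrt(lam_i lam_k) sqrt(lam_i lam_l). *)
Lemma qform_Deltamx n p (U : 'M[R]_(n, p)) (lam : 'rV[R]_p) (v : 'I_p -> 'cV[R]_p)
    (i : 'I_p) (c : 'cV[R]_p) : (forall k, 0 <= lam 0 k) ->
  qform (Deltamx lam v (Gmx U) i) c =
  qform (DGD U) (col_form (eigvec_coef lam v i c) i).
Proof.
move=> lam0; rewrite qform_col_form /qform /Deltamx mulmx_suml.
have dot_sum (I : finType) (Q : pred I) (f : I -> 'cV[R]_p) :
    dotv c (\sum_(k | Q k) f k) = \sum_(k | Q k) dotv c (f k).
  by rewrite /dotv mulmx_sumr summxE.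
rewrite dot_sum big_mkcond /=; apply: eq_bigr => k _; rewrite {1}/eigvec_coef.
case: eqVneq => [->|ki] /=.
  by rewrite big1 // => l _; rewrite !mul0r.
rewrite mulmx_suml dot_sum big_mkcond /=; apply: eq_bigr => l _.
rewrite /eigvec_coef; case: eqVneq => [->|li] /=.
  by rewrite mulr0 mul0r.
rewrite -scalemxAl dotvZr.
have -> : dotv c (v k *m (v l)^T *m c) = dotv c (v k) * dotv c (v l).
  rewrite -mulmxA [(v l)^T *m c]mx11_scalar mul_mx_scalar dotvZr.
  by rewrite -[X in X * _]/(dotv (v l) c) (dotvC (v l)) mulrC.
have -> : lam 0 i * Num.sqrt (lam 0 k * lam 0 l) =
    Num.sqrt (lam 0 i * lam 0 k) * Num.sqrt (lam 0 i * lam 0 l).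
  rewrite -sqrtrM ?mulr_ge0 // -[X in X * _]ger0_norm // -sqrtr_sqr -sqrtrM ?sqr_ge0 //.
  by congr Num.sqrt; ring.
by rewrite invfM; ring.
Qed.

(** The coefficient ab / (a^2 - b^2) is stable under relative perturbations of a^2
    and b^2, with constants governed by the relative gap 1 / M. *)
Lemma eigvec_coef_perturb (a b r s M rho : R) : 0 < a -> 0 < b ->
  a ^+ 2 - b ^+ 2 != 0 ->
  a ^+ 2 <= M * `|a ^+ 2 - b ^+ 2| -> b ^+ 2 <= M * `|a ^+ 2 - b ^+ 2| ->
  `|a * b / (a ^+ 2 - b ^+ 2)| <= M ->
  `|r| <= rho -> `|s| <= rho -> rho <= 1 -> 4 * M * rho <= 1 ->
  `|Num.sqrt ((a ^+ 2 * (1 + r)) * (b ^+ 2 * (1 + s)))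
     / (a ^+ 2 * (1 + r) - b ^+ 2 * (1 + s)) - a * b / (a ^+ 2 - b ^+ 2)|
    <= 2 * M * (3 + 2 * M) * rho.
Proof.
move=> a0 b0 D0 aM bM abM rR sR R1 MR.
have rho0 : 0 <= rho by apply: le_trans rR.
have M0 : 0 <= M by apply: le_trans abM.
set D := a ^+ 2 - b ^+ 2 in D0 aM bM abM *.
have Dn : 0 < `|D| by rewrite normr_gt0.
have r1 : 0 <= 1 + r by move: rR; rewrite ler_norml => /andP[]; lra.
have s1 : 0 <= 1 + s by move: sR; rewrite ler_norml => /andP[]; lra.
(* The numerator is multiplied by t and the denominator by 1 + u below. *)
pose t := Num.sqrt ((1 + r) * (1 + s)).
have t0 : 0 <= t by exact: sqrtr_ge0.
have t2 : t ^+ 2 = (1 + r) * (1 + s) by rewrite sqr_sqrtr // mulr_ge0.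
have -> : Num.sqrt ((a ^+ 2 * (1 + r)) * (b ^+ 2 * (1 + s))) = a * b * t.
  have -> : (a ^+ 2 * (1 + r)) * (b ^+ 2 * (1 + s)) =
    (a * b) ^+ 2 * ((1 + r) * (1 + s)) by ring.
  by rewrite sqrtrM ?sqr_ge0 // sqrtr_sqr ger0_norm // mulr_ge0 // ltW.
pose u := a ^+ 2 / D * r - b ^+ 2 / D * s.
have uR : `|u| <= 2 * M * rho.
  have aD : `|a ^+ 2 / D| <= M.
    by rewrite normrM normrV ?unitfE // ger0_norm ?sqr_ge0 // ler_pdivrMr.
  have bD : `|b ^+ 2 / D| <= M.
    by rewrite normrM normrV ?unitfE // ger0_norm ?sqr_ge0 // ler_pdivrMr.
  apply: le_trans (ler_normB _ _) _.
  have -> : 2 * M * rho = M * rho + M * rho by ring.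
  by rewrite !normrM; apply: lerD; rewrite -?normrM; [rewrite normrM|rewrite normrM]; apply: ler_pM.
have u1 : 1 / 2 <= 1 + u by move: uR; rewrite ler_norml => /andP[]; lra.
have u10 : 0 < 1 + u by lra.
have DE : a ^+ 2 * (1 + r) - b ^+ 2 * (1 + s) = D * (1 + u).
  by rewrite /u; have -> : D * (1 + (a ^+ 2 / D * r - b ^+ 2 / D * s)) = D + (a ^+ 2 * r - b ^+ 2 * s);
     [field|rewrite /D; ring].
have tR : `|t - 1| <= 3 * rho.
  have : `|t ^+ 2 - 1| <= 3 * rho.
    have -> : t ^+ 2 - 1 = r + s + r * s by rewrite t2; ring.
    have rs : `|r * s| <= rho.
      by rewrite normrM -[rho]mulr1; apply: ler_pM => //; exact: le_trans sR R1.
    apply: le_trans (ler_normD _ _) _; have := ler_normD r s; lra.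
  have -> : t ^+ 2 - 1 = (t - 1) * (t + 1) by ring.
  rewrite normrM (ger0_norm (_ : 0 <= t + 1)) ?addr_ge0 //.
  by apply: le_trans; rewrite ler_peMr // lerDr.
rewrite DE; have -> : a * b * t / (D * (1 + u)) - a * b / D =
    (a * b / D) * (((t - 1) - u) / (1 + u)).
  by field; rewrite D0 gt_eqF.
rewrite normrM; have -> : 2 * M * (3 + 2 * M) * rho =
    M * (2 * (3 + 2 * M) * rho) by ring.
apply: ler_pM => //; rewrite normrM normrV ?unitfE ?gt_eqF // (gtr0_norm u10).
rewrite ler_pdivrMr //; apply: (@le_trans _ _ ((3 + 2 * M) * rho)).
  apply: le_trans (ler_normB _ _) _; rewrite mulrDl; exact: lerD.
have : 0 <= (3 + 2 * M) * rho by rewrite mulr_ge0 // addr_ge0 // mulr_ge0.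
set x := (3 + 2 * M) * rho; have -> : 2 * (3 + 2 * M) * rho = 2 * x by rewrite /x; ring.
nra.
Qed.

Lemma align_signE p (x y : 'cV[R]_p) : align_sign x y = pos_sign (dotv x y) *: y.
Proof. by rewrite /align_sign /pos_sign; case: ifP; rewrite ?scale1r ?scaleN1r. Qed.

Lemma inv_sqrt_erealE (x : R) : 0 < x -> inv_sqrt_ereal x%:E = (Num.sqrt x)^-1.
Proof.
by move=> x0; rewrite /inv_sqrt_ereal /= inver sqrtr_eq0 leNgt x0.
Qed.

Lemma Delta_form_fin p (lam : 'rV[R]_p) (v : 'I_p -> 'cV[R]_p) (G : 'M[R]_(p * p))
    (i : 'I_p) (c : 'cV[R]_p) : (forall j k : 'I_p, (j < k)%N -> lam 0 k < lam 0 j) ->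
  Delta_form lam v G i c = (qform (Deltamx lam v G i) c)%:E.
Proof.
move=> lamS; rewrite /Delta_form; case: ifP => // /negP[].
apply/injectiveP => j k jk; apply/val_inj/eqP; apply: contraTT isT => njk.
have : (j < k)%N || (k < j)%N by rewrite -neq_ltn.
by case/orP => /lamS; rewrite jk ltxx.
Qed.

End eigvec_variance.

(** * Limits along the filter of asymptotically almost sure events *)

Section limits.
Context {R : realType}.

Lemma limn_esup_lt_near (u : nat -> \bar R) x :
  (limn_esup u < x)%E -> \forall n \near \oo, (u n < x)%E.
Proof.
rewrite /limn_esup /limf_esup => /ereal_inf_lt[_ /= [A FA <-] ltx].
apply: filterS FA => n An; apply: le_lt_trans ltx.
by apply: ereal_sup_ubound; exists n.
Qed.

Lemma limn_einf_gt_near (u : nat -> \bar R) x :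
  (x < limn_einf u)%E -> \forall n \near \oo, (x < u n)%E.
Proof.
rewrite /limn_einf => xu.
have /limn_esup_lt_near : (limn_esup (\- u)%E < - x)%E by rewrite lteNr.
by apply: filterS => n; rewrite lteN2.
Qed.

(** The inverse, with value 0 at 0, is the pointwise limit of the continuous
    functions x / (x^2 + 1 / k). *)
Lemma measurable_inv : measurable_fun setT (@GRing.inv R).
Proof.
pose h (k : nat) (x : R) : R := x / (x ^+ 2 + k.+1%:R^-1).
have pos k (x : R) : 0 < x ^+ 2 + k.+1%:R^-1 by rewrite ltr_wpDl ?sqr_ge0.
apply: (@measurable_fun_cvg _ _ _ _ h).
  move=> k; apply: continuous_measurable_fun => x; rewrite /h.
  apply: cvgM; first exact: cvg_id.
  apply: cvgV; first by rewrite gt_eqF.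
  by apply: cvgD; [exact: exprn_continuous|exact: cvg_cst].
move=> x _; have [->|x0] := eqVneq x 0.
  rewrite invr0 (_ : h ^~ 0 = cst 0); first exact: cvg_cst.
  by apply/funext => k; rewrite /h mul0r.
have -> : x^-1 = x / (x ^+ 2 + 0) by field.
apply: cvgM; first exact: cvg_cst.
apply: cvgV; first by rewrite addr0 sqrf_eq0.
by apply: cvgD; [exact: cvg_cst|exact: cvg_harmonic].
Qed.

Section aas_calculus.
Context (d : nat -> measure_display)
  (T : forall n, measurableType (d n)) (P : forall n, probability (T n) R).
Implicit Types D E : forall n, T n -> R.

Lemma aas_apply2 (Q1 Q2 Q : forall n, T n -> Prop) :
  (forall n w, Q1 n w -> Q2 n w -> Q n w) ->
  (\forall x \near aas P, on_total Q1 x) ->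
  (\forall x \near aas P, on_total Q2 x) ->
  \forall x \near aas P, on_total Q x.
Proof.
move=> HQ A1 A2; near=> x; apply: HQ; near: x; [exact: A1|exact: A2].
Unshelve. all: by end_near. Qed.

Lemma aas_squeeze D E (C : R) :
  (\forall x \near aas P, on_total (E := Prop) (fun n w => `|D n w| <= C * `|E n w|) x) ->
  on_total E @ aas P --> (0 : R) -> on_total D @ aas P --> (0 : R).
Proof.
move=> DE E0; apply/cvgr0Pnorm_le => e e0.
have C1 : 0 < `|C| + 1 by rewrite ltr_wpDl.
have e1 : 0 < e / (`|C| + 1) by rewrite divr_gt0.
near=> x.
have E1 : `|on_total E x| <= e / (`|C| + 1).
  by near: x; exact: (cvgr0Pnorm_le _).1 E0 _ e1.
have D1 : `|on_total D x| <= C * `|on_total E x| by near: x; exact: DE.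
apply: le_trans D1 _.
apply: (@le_trans _ _ ((`|C| + 1) * (e / (`|C| + 1)))); last first.
  by rewrite mulrCA mulfV ?mulr1 // gt_eqF.
apply: le_trans (_ : (`|C| + 1) * `|on_total E x| <= _).
  by rewrite ler_wpM2r // (le_trans (ler_norm _)) // lerDl.
by rewrite ler_wpM2l // ltW.
Unshelve. all: by end_near. Qed.

Lemma aas_eq_cvg D E l :
  (\forall x \near aas P, on_total (fun n w => D n w = E n w) x) ->
  on_total E @ aas P --> (l : R) -> on_total D @ aas P --> (l : R).
Proof.
move=> DE; apply: cvg_trans; apply: near_eq_cvg.
by apply: (filterS _ DE) => x; rewrite /on_total => ->.
Qed.

Lemma cvg_std_normal_near_eq (Y Y' : forall n, T n -> R) :
  (\forall n \near \oo, measurable_fun setT (Y n)) ->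
  (\forall n \near \oo, measurable_fun setT (Y' n)) ->
  cvg_std_normal P Y ->
  (\forall x \near aas P, on_total (fun n w => Y n w = Y' n w) x) ->
  cvg_std_normal P Y'.
Proof.
move=> mY mY' cY YY'; apply: (slutsky mY mY' cY).
apply: (aas_eq_cvg (E := fun n _ => 0)); last exact: (@cvg_aas R d T P (cst 0) 0 (cvg_cst _)).
by apply: (filterS _ YY') => x; rewrite /on_total => ->; rewrite subrr.
Qed.

End aas_calculus.

End limits.

(** The identity on which everything rests: sampling replaces the identity between
    the two diagonal factors by 1 + W. *)
Lemma gram_thin (R : realType) n p (S : 'M[R]_n) (X U : 'M[R]_(n, p))
    (l : 'rV[R]_p) (V : 'M[R]_p) : X = U *m diag_mx l *m V^T ->
  gram (S *m X) = V *m perturbed l (U^T *m S^T *m S *m U - 1%:M) *m V^T.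
Proof.
move=> ->; rewrite /gram /perturbed addrC subrK.
by rewrite !trmx_mul trmxK tr_diag_mx !mulmxA.
Qed.

(** * The sampling error of the Gram matrix *)

Section subsampled_svd.
Context {R : realType} (p : nat) (d : nat -> measure_display)
  (T : forall n : nat, measurableType (d n))
  (P : forall n : nat, probability (T n) R).
Variables (m : nat -> nat) (B : forall n : nat, 'I_n -> {RV (P n) >-> bool})
  (X U : forall n : nat, 'M[R]_(n, p.+1))
  (ell : nat -> 'rV[R]_p.+1) (V : nat -> 'M[R]_p.+1)
  (ev : 'I_p.+1 -> 'M[R]_p.+1 -> 'cV[R]_p.+1) (c0 C0 : R).
Local Arguments B : clear implicits.
Local Notation q := #|upper_pairs p.+1|.

Let gamma n : R := (m n)%:R / n%:R.
Let S n (w : T n) : 'M[R]_n := subsample_mx (m n) (fun i => B n i w).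
Local Arguments S : clear implicits.
Let rate n : R := Num.sqrt ((m n)%:R / (1 - gamma n)).
Let Lam n := eigvals (gram (X n)).
Let Lamhat n (w : T n) := eigvals (gram (S n w *m X n)).
Local Arguments Lamhat : clear implicits.
Let W n (w : T n) : 'M[R]_p.+1 :=
  (U n)^T *m (S n w)^T *m S n w *m U n - 1%:M.
Local Arguments W : clear implicits.
Let H n := inv_sqrt_mx (DGD (U n)).
Let Z n (w : T n) : 'cV[R]_q := rate n *: (H n *m half_vec (W n w)).
Local Arguments Z : clear implicits.

Hypothesis mn : \forall n \near \oo, (m n < n)%N.
Hypothesis moo : m @ \oo --> \oo.
Hypothesis svd : \forall n \near \oo,
  thin_svd (X n) (U n) (ell n) (V n) /\ forall i, 0 < ell n 0 i.
Hypothesis cond : (limn_esup (fun n => (ell n 0 ord0 / ell n 0 ord_max)%:E) < +oo)%E.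
Hypothesis gaps : (1 < limn_einf (fun n => \big[mine/+oo]_(i < p)
    (ell n 0 (widen_ord (leqnSn p) i) / ell n 0 (lift ord0 i))%:E))%E.
Hypothesis evP : forall (i : 'I_p.+1) (Xi : 'M[R]_p.+1),
    Xi^T = Xi -> is_eigvec Xi i (ev i Xi).
Hypothesis c00 : 0 < c0.
Hypothesis c0C0 : c0 < C0.
Hypothesis loew : \forall n \near \oo,
    loewner_le c0%:M (DGD (U n)) /\ loewner_le (DGD (U n)) C0%:M.
Hypothesis clt : cvg_std_normal_vec P Z.

(** Gaps between consecutive singular values bound all gaps, by monotonicity. *)
Lemma spaced_near : exists K eta : R, [/\ 1 <= K, 0 < eta &
  \forall n \near \oo, spaced K eta (ell n)].
Proof.
have [r r1 rlim] : exists2 r : R, 1 < r & (r%:E < limn_einf (fun n =>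
    \big[mine/+oo]_(i < p)
    (ell n 0 (widen_ord (leqnSn p) i) / ell n 0 (lift ord0 i))%:E))%E.
  move: gaps; case: limn_einf => [l|_|//].
    by rewrite lte_fin => l1; exists ((1 + l) / 2); rewrite ?lte_fin; lra.
  by exists 2; rewrite ?ltry ?ltr1n.
have [K Klim] : exists K : R,
    (limn_esup (fun n => (ell n 0 ord0 / ell n 0 ord_max)%:E) < K%:E)%E.
  move: cond; case: limn_esup => [l _|//|_]; last by exists 0; rewrite ltNye.
  by exists (l + 1); rewrite lte_fin ltrDl.
exists (Num.max 1 K), (r - 1); split; rewrite ?le_max ?lexx ?subr_gt0 //.
have nK := limn_esup_lt_near Klim; have nr := limn_einf_gt_near rlim.
near=> n.
have [[_ _ sorted_ell ell_ge0 _] ell0] :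
  thin_svd (X n) (U n) (ell n) (V n) /\ forall i, 0 < ell n 0 i by near: n.
split=> // [i j|i j ij].
  apply: (@le_trans _ _ (ell n 0 ord0)); first exact: sorted_ell.
  have Kn : ell n 0 ord0 / ell n 0 ord_max < K.
    by rewrite -lte_fin; near: n; exact: nK.
  move: Kn; rewrite ltr_pdivrMr // => /ltW Kn; apply: le_trans Kn _.
  apply: (@le_trans _ _ (Num.max 1 K * ell n 0 ord_max)).
    by rewrite ler_wpM2r ?(ltW (ell0 _)) // le_max lexx orbT.
  by rewrite ler_wpM2l ?le_max ?ler01 // sorted_ell // leq_ord.
rewrite addrC subrK.
have ip : (i < p)%N by rewrite (leq_trans ij) // -ltnS.
pose i' := Ordinal ip.
have ri : (r%:E < (ell n 0 (widen_ord (leqnSn p) i') / ell n 0 (lift ord0 i'))%:E)%E.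
  have rn : (r%:E < \big[mine/+oo]_(i < p)
    (ell n 0 (widen_ord (leqnSn p) i) / ell n 0 (lift ord0 i))%:E)%E.
    by near: n; exact: nr.
  by apply: lt_le_trans rn _; exact: bigmin_le.
move: ri; rewrite lte_fin ltr_pdivlMr // => /ltW ri.
have -> : i = widen_ord (leqnSn p) i' by exact: val_inj.
apply: le_trans ri; rewrite ler_wpM2l ?(ltW (lt_trans ltr01 r1)) //.
exact: sorted_ell.
Unshelve. all: by end_near. Qed.

Lemma gamma01 : \forall n \near \oo, 0 < gamma n < 1.
Proof.
have m0 : \forall n \near \oo, (0 < m n)%N by exact: (moo (nbhs_infty_gt 0%N)).
near=> n.
have mn' : (m n < n)%N by near: n.
have m0' : (0 < m n)%N by near: n.
have n0 : (0 < n)%N by exact: leq_trans mn'.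
by rewrite /gamma divr_gt0 ?ltr0n //= ltr_pdivrMr ?ltr0n // mul1r ltr_nat.
Unshelve. all: by end_near. Qed.

Lemma rate_pinfty : rate @ \oo --> +oo.
Proof.
apply/cvgryPge => A; near=> n.
have /andP[g0 g1] : 0 < gamma n < 1 by near: n; exact: gamma01.
apply: (@le_trans _ _ (Num.sqrt (m n)%:R)); last first.
  rewrite /rate ler_sqrt ?divr_ge0 ?subr_ge0 ?(ltW g1) //.
  by rewrite ler_peMr // invf_ge1 ?subr_gt0 // gerBl ltW.
apply: (@le_trans _ _ `|A|); first exact: ler_norm.
rewrite -[leLHS]ger0_norm // -sqrtr_sqr ler_sqrt //.
apply: (@le_trans _ _ (Num.truncn (`|A| ^+ 2)).+1%:R); first by rewrite ltW // truncnS_gt.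
rewrite ler_nat; near: n; exact: (moo (nbhs_infty_ge _)).
Unshelve. all: by end_near. Qed.

Lemma rate_gt0 : \forall n \near \oo, 0 < rate n.
Proof. by have /cvgryPgt := rate_pinfty; exact. Qed.

Lemma rateV : (fun n => (rate n)^-1) @ \oo --> (0 : R).
Proof. by apply/gtr0_cvgV0; [exact: rate_gt0|exact: rate_pinfty]. Qed.

Lemma Wsym n w : (W n w)^T = W n w.
Proof. by rewrite /W linearB /= !trmx_mul !trmxK trmx1 !mulmxA. Qed.

Lemma statistic_measurable n (F : 'M[R]_n -> R) :
  measurable_fun setT (fun w => F (S n w)).
Proof. exact: (sample_measurable_fun (B n) (fun b => F (subsample_mx (m n) b))). Qed.

Lemma Zmeasurable : \forall n \near \oo, forall k,
  measurable_fun setT (fun w => Z n w k 0).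
Proof.
apply: nearW => n k; exact: (@statistic_measurable n (fun s =>
  (rate n *: (H n *m half_vec ((U n)^T *m s^T *m s *m U n - 1%:M))) k 0)).
Qed.

(** [inv_sqrt_mx] is 0 by default when no inverse square root exists; the limit law
    excludes this for large n, as Z would then vanish. *)
Lemma whitening_near : \forall n \near \oo,
  [/\ loewner_le c0%:M (DGD (U n)), loewner_le (DGD (U n)) C0%:M,
      (H n)^T = H n & H n *m H n = invmx (DGD (U n))].
Proof.
pose s : 'I_q := half_idx ord0 ord0.
have := cvg_std_normal_neq0 (dotv_cvg_fixed Zmeasurable clt (a := delta_mx s 0) _).
rewrite dotv_delta mxE !eqxx => /(_ erefl) nZ.
near=> n.
have [lo up] : loewner_le c0%:M (DGD (U n)) /\ loewner_le (DGD (U n)) C0%:M.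
  by near: n.
have [w] : exists w, dotv (delta_mx s 0) (Z n w) != 0 by near: n.
rewrite /Z /H /inv_sqrt_mx; case: xgetP => [A _ [[AT _] AA] _ //|_].
by rewrite mul0mx scaler0 dotv_delta mxE eqxx.
Unshelve. all: by end_near. Qed.

(** A random bound on the entries of W that vanishes like 1 / rate. *)
Let E n (w : T n) : R := (rate n)^-1 * ((1 + C0) * \sum_k `|Z n w k 0|).
Local Arguments E : clear implicits.

Lemma E_ge0 n w : 0 <= E n w.
Proof.
rewrite /E !mulr_ge0 ?invr_ge0 ?sqrtr_ge0 ?addr_ge0 ?sumr_ge0 //.
exact: ltW (lt_trans c00 c0C0).
Qed.

Lemma W_le_E : \forall n \near \oo, forall w i j, `|W n w i j| <= E n w.
Proof.
near=> n => w i j.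
have [lo up HT HH] : [/\ loewner_le c0%:M (DGD (U n)), loewner_le (DGD (U n)) C0%:M,
      (H n)^T = H n & H n *m H n = invmx (DGD (U n))] by near: n; exact: whitening_near.
have r0 : 0 < rate n by near: n; exact: rate_gt0.
have C00 : 0 < C0 := lt_trans c00 c0C0.
rewrite /E mulrC ler_pdivlMr // mulrC -[X in X * _](gtr0_norm r0) -normrM.
rewrite -(half_vec_sym i j (Wsym w)) -dotv_delta -dotvZr.
have := whitening_form_le c00 lo HT HH (x := delta_mx (half_idx i j) 0)
  (rate n *: half_vec (W n w)) (b := 1 + C0).
rewrite -scalemxAr; apply; first by rewrite addr_ge0 // ltW.
apply: le_trans (qform_upper up _) _.
rewrite dotv_delta mxE !eqxx mulr1 expr2; nra.
Unshelve. all: by end_near. Qed.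

Lemma rateE_tight : tight P (fun n w => rate n * E n w).
Proof.
apply: (tight_le (C := 1 + C0) _ _ (tight_norm1 Zmeasurable clt)).
  by rewrite addr_ge0 // ltW // (lt_trans c00).
near=> n => w; have r0 : 0 < rate n by near: n; exact: rate_gt0.
rewrite /E mulVKf ?gt_eqF // normrM ger0_norm //.
by rewrite addr_ge0 // ltW // (lt_trans c00).
Unshelve. all: by end_near. Qed.

Lemma E_cvg0 : on_total E @ aas P --> (0 : R).
Proof.
apply: (aas_eq_cvg (E := fun n w => rate n * E n w * (rate n)^-1)); last first.
  apply: (tight_mul_cvg0 (D := fun n _ => (rate n)^-1)) rateE_tight _.
  exact: cvg_aas rateV.
apply: (@near_aas R d T P (fun n w => E n w = rate n * E n w * (rate n)^-1)).
near=> n => w; have r0 : 0 < rate n by near: n; exact: rate_gt0.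
by rewrite mulrAC mulfV ?mul1r // gt_eqF.
Unshelve. all: by end_near. Qed.

Lemma rateE2_cvg0 : on_total (fun n w => rate n * E n w ^+ 2) @ aas P --> (0 : R).
Proof.
apply: (aas_eq_cvg (E := fun n w => rate n * E n w * E n w)).
  by apply: nearW => -[n w]; rewrite /on_total /= expr2 mulrA.
exact: tight_mul_cvg0 rateE_tight E_cvg0.
Qed.

Lemma E_small (e : R) : 0 < e -> \forall x \near aas P, on_total E x <= e.
Proof.
move=> e0; have := (cvgr0Pnorm_le _).1 E_cvg0 e e0.
move=> nE; near=> x; apply: le_trans (ler_norm _) _; near: x; exact: nE.
Unshelve. all: by end_near. Qed.

(** After standardization, a.W is the value of the whitened vector Z in the unit
    direction H^-1 a / |H^-1 a|, where |H^-1 a|^2 = a^T (D^T G D) a. *)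
Lemma form_clt (a : nat -> 'cV[R]_q) :
  (\forall n \near \oo, 0 < qform (DGD (U n)) (a n)) ->
  cvg_std_normal P (fun n w => rate n / Num.sqrt (qform (DGD (U n)) (a n))
    * dotv (a n) (half_vec (W n w))).
Proof.
move=> a0; pose s n := Num.sqrt (qform (DGD (U n)) (a n)).
pose b n := (s n)^-1 *: (invmx (H n) *m a n).
have nb : \forall n \near \oo, dotv (b n) (b n) = 1 /\
    forall w, dotv (b n) (Z n w) = rate n / s n * dotv (a n) (half_vec (W n w)).
  near=> n.
  have [lo up HT HH] : [/\ loewner_le c0%:M (DGD (U n)), loewner_le (DGD (U n)) C0%:M,
      (H n)^T = H n & H n *m H n = invmx (DGD (U n))] by near: n; exact: whitening_near.
  have an : 0 < qform (DGD (U n)) (a n) by near: n.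
  split.
    rewrite /b dotvZl dotvZr (whitening_norm c00 lo HT HH) mulrA -expr2 exprVn.
    by rewrite sqr_sqrtr ?(ltW an) // mulVf // gt_eqF.
  move=> w; rewrite /b /Z dotvZl dotvZr -(whitening_form c00 lo HT HH).
  by rewrite mulrA [_^-1 * _]mulrC.
have cb : cvg_std_normal P (fun n w => dotv (b n) (Z n w)).
  by apply: (cramer_wold Zmeasurable clt); apply: filterS nb => n [].
apply: (cvg_std_normal_near_eq _ _ cb).
- by apply: filterS Zmeasurable => n; exact: measurable_dotv.
- apply: nearW => n; exact: (@statistic_measurable n (fun S => rate n / s n *
    dotv (a n) (half_vec ((U n)^T *m S^T *m S *m U n - 1%:M)))).
- apply: (@near_aas R d T P (fun n w => dotv (b n) (Z n w) =
    rate n / s n * dotv (a n) (half_vec (W n w)))).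
  by apply: filterS nb => n [].
Unshelve. all: by end_near. Qed.

(** * Expansion of the sampled spectrum *)

Lemma gram_sample : \forall n \near \oo, forall w,
  (V n)^T *m V n = 1%:M /\
  gram (S n w *m X n) = V n *m perturbed (ell n) (W n w) *m (V n)^T.
Proof.
near=> n => w.
have [[_ VV _ _ XE] _] :
  thin_svd (X n) (U n) (ell n) (V n) /\ forall i, 0 < ell n 0 i by near: n.
by split => //; exact: gram_thin.
Unshelve. all: by end_near. Qed.

Lemma gram_population : \forall n \near \oo,
  (V n)^T *m V n = 1%:M /\
  gram (X n) = V n *m perturbed (ell n) 0 *m (V n)^T.
Proof.
near=> n.
have [[UU VV _ _ XE] _] :
  thin_svd (X n) (U n) (ell n) (V n) /\ forall i, 0 < ell n 0 i by near: n.
split => //; rewrite -[X n]mul1mx (gram_thin _ XE); congr (_ *m perturbed _ _ *m _).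
by rewrite trmx1 !mulmx1 UU subrr.
Unshelve. all: by end_near. Qed.

Lemma gram_sym n k (Y : 'M[R]_(n, k)) : (gram Y)^T = gram Y.
Proof. by rewrite /gram trmx_mul trmxK. Qed.

(** As long as W is small the perturbed Gram matrix is nonsingular, so [eigvals]
    does not take its default value. *)
Lemma eigvals_perturbed n (V' W' Y : 'M[R]_p.+1) (e : R) :
  (forall i, 0 < ell n 0 i) -> V'^T *m V' = 1%:M ->
  (forall i j, `|W' i j| <= e) -> p.+1%:R * e < 1 ->
  Y^T = Y -> Y = V' *m perturbed (ell n) W' *m V'^T ->
  (forall i j : 'I_p.+1, (i <= j)%N -> eigvals Y 0 j <= eigvals Y 0 i) /\
  char_poly Y = \prod_(i < p.+1) ('X - (eigvals Y 0 i)%:P).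
Proof.
move=> ell0 VV We e1 YT YE; apply: (eigvals_nonsingular (evP ord0 YT)) => z.
rewrite YE => Yz; have VV' := mulmx1C VV.
have : perturbed (ell n) W' *m (V'^T *m z) = 0.
  have := congr1 (mulmx V'^T) Yz.
  by rewrite mulmx0 -!mulmxA (mulmxA V'^T) VV mul1mx.
move=> /(perturbed_nonsingular ell0 We e1) Vz.
by rewrite -[z]mul1mx -VV' -mulmxA Vz mulmx0.
Qed.

Lemma Lamhat_spec : exists2 e0 : R, 0 < e0 &
  \forall n \near \oo, forall w, E n w <= e0 ->
    (forall i j : 'I_p.+1, (i <= j)%N -> Lamhat n w 0 j <= Lamhat n w 0 i) /\
    char_poly (gram (S n w *m X n)) = \prod_(i < p.+1) ('X - (Lamhat n w 0 i)%:P).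
Proof.
have N0 : 0 < p.+1%:R *+ 2 :> R by rewrite pmulrn_lgt0 // ltr0n.
exists (p.+1%:R *+ 2)^-1; first by rewrite invr_gt0.
near=> n => w Ew.
have [_ ell0] : thin_svd (X n) (U n) (ell n) (V n) /\ forall i, 0 < ell n 0 i by near: n.
have [VV YE] : (V n)^T *m V n = 1%:M /\
  gram (S n w *m X n) = V n *m perturbed (ell n) (W n w) *m (V n)^T.
  by move: w {Ew}; near: n; exact: gram_sample.
apply: (eigvals_perturbed ell0 VV (e := E n w) _ _ (gram_sym _) YE).
  by move: w {Ew YE}; near: n; exact: W_le_E.
apply: (@le_lt_trans _ _ (p.+1%:R * (p.+1%:R *+ 2)^-1)); first by rewrite ler_wpM2l.
rewrite ltr_pdivrMr // mul1r mulr2n ltrDl ltr0n //.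
Unshelve. all: by end_near. Qed.

(** The row lam is arbitrary here, since the squared singular values of S X will be
    used as well as the eigenvalues of its Gram matrix. *)
Lemma sample_expansion : exists e0 C : R, [/\ 0 < e0, 0 <= C &
  \forall n \near \oo, forall w (lam : 'rV[R]_p.+1), E n w <= e0 ->
    (forall i j : 'I_p.+1, (i <= j)%N -> lam 0 j <= lam 0 i) ->
    (forall x, \prod_(i < p.+1) (x - lam 0 i) =
      \det (x%:M - gram (S n w *m X n))) ->
    (forall j k : 'I_p.+1, (j < k)%N -> lam 0 k < lam 0 j) /\
    forall (j : 'I_p.+1) (x : 'cV[R]_p.+1),
      gram (S n w *m X n) *m x = lam 0 j *: x -> dotv x x = 1 ->
      first_order (ell n) (W n w) (C * E n w ^+ 2) j (lam 0 j) ((V n)^T *m x)].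
Proof.
have [K [eta [K1 eta0 sep]]] := spaced_near.
have [e0 [C [e00 C0' H0]]] := frame_perturbation p K1 eta0.
exists e0, C; split => //; near=> n => w lam Ew lamS.
have [VV YE] : (V n)^T *m V n = 1%:M /\
  gram (S n w *m X n) = V n *m perturbed (ell n) (W n w) *m (V n)^T.
  by move: w {Ew}; near: n; exact: gram_sample.
rewrite YE => lamE; apply: (H0 _ _ _ _ _ _ VV _ Ew lamS lamE).
  by near: n.
by move: w {Ew YE lamE}; near: n; exact: W_le_E.
Unshelve. all: by end_near. Qed.

(** The case W = 0 of the perturbation bounds, where the error term vanishes. *)
Lemma population_spectrum : \forall n \near \oo,
  (forall j k : 'I_p.+1, (j < k)%N -> Lam n 0 k < Lam n 0 j) /\
  forall j, Lam n 0 j = ell n 0 j ^+ 2.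
Proof.
have [K [eta [K1 eta0 sep]]] := spaced_near.
have [e0 [C [e00 C0' H0]]] := frame_perturbation p K1 eta0.
near=> n.
have [_ ell0] : thin_svd (X n) (U n) (ell n) (V n) /\ forall i, 0 < ell n 0 i by near: n.
have [VV YE] : (V n)^T *m V n = 1%:M /\
  gram (X n) = V n *m perturbed (ell n) 0 *m (V n)^T.
  by near: n; exact: gram_population.
have W0 (i j : 'I_p.+1) : `|(0 : 'M[R]_p.+1) i j| <= 0 by rewrite mxE normr0.
have [LamS LamE] : (forall i j : 'I_p.+1, (i <= j)%N -> Lam n 0 j <= Lam n 0 i) /\
    char_poly (gram (X n)) = \prod_(i < p.+1) ('X - (Lam n 0 i)%:P).
  by apply: (eigvals_perturbed ell0 VV W0 _ (gram_sym _) YE); rewrite mulr0.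
have sepn : spaced K eta (ell n) by near: n.
have := H0 (ell n) 0 (V n) (Lam n) 0 sepn VV W0 (ltW e00) LamS.
rewrite -YE => /(_ (fun x => char_poly_prod x LamE))[distinct fo]; split => // j.
have [evj ev1 _] := evP j (gram_sym (X n)).
have [+ _ _] := fo j (ev j (gram (X n))) evj ev1.
rewrite mxE subr0 expr0n /= mulr0 normr_le0 subr_eq0 => /eqP.
by move=> /(congr1 ( *%R^~ (ell n 0 j ^+ 2))); rewrite divfK ?mul1r // gt_eqF // exprn_gt0.
Unshelve. all: by end_near. Qed.

(** * Central limit theorem for the eigenvalues *)

Lemma aas_small_E (e : R) (Q : forall n, T n -> Prop) : 0 < e ->
  (\forall n \near \oo, forall w, E n w <= e -> Q n w) ->
  \forall x \near aas P, on_total Q x.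
Proof.
move=> e0 nQ; have nQ' := near_aas P nQ.
by apply: aas_apply2 nQ' (E_small e0) => n w; exact.
Qed.

Lemma qform_delta k (A : 'M[R]_k) s : qform A (delta_mx s 0) = A s s.
Proof. by rewrite /qform dotv_delta -colE mxE. Qed.

Lemma Gmx_diag_bounds : \forall n \near \oo, forall i j : 'I_p.+1,
  c0 <= Gmx (U n) (vec_idx i j) (vec_idx i j) <= C0.
Proof.
apply: filterS loew => n [lo up] i j; rewrite -DGD_half_idx -qform_delta.
have D1 : dotv (delta_mx (half_idx i j) 0) (delta_mx (half_idx i j) 0) = 1 :> R.
  by rewrite dotv_delta mxE !eqxx.
have := qform_lower lo (delta_mx (half_idx i j) 0).
have := qform_upper up (delta_mx (half_idx i j) 0).
by rewrite D1 !mulr1 => -> ->.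
Qed.

(** Dividing by the sampled instead of the true eigenvalue changes the relative
    error by a term of second order only. *)
Lemma eigval_linearization i : exists C : R, 0 <= C /\
  \forall x \near aas P, on_total (fun n w =>
    0 < Lamhat n w 0 i /\
    `|(Lamhat n w 0 i)^-1 * (Lamhat n w 0 i - Lam n 0 i) - W n w i i|
      <= C * E n w ^+ 2) x.
Proof.
have [e0 [C [e00 C00 nexp]]] := sample_expansion.
have [e1 e10 nlam] := Lamhat_spec.
pose e := Num.min (Num.min e0 e1) (Num.min 1 (2 * (C + 1))^-1).
have C1 : 0 < 2 * (C + 1) by rewrite mulr_gt0 // ltr_wpDl.
exists (2 * (C + (C + 1))); split; first by rewrite mulr_ge0 // !addr_ge0.
apply: (aas_small_E (e := e)); first by rewrite !lt_min e00 e10 ltr01 invr_gt0.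
near=> n => w; rewrite !le_min => /andP[/andP[E0 E1] /andP[E2 E3]].
have [_ ell0] : thin_svd (X n) (U n) (ell n) (V n) /\ forall i, 0 < ell n 0 i by near: n.
have [_ LamE] : (forall j k : 'I_p.+1, (j < k)%N -> Lam n 0 k < Lam n 0 j) /\
  forall j, Lam n 0 j = ell n 0 j ^+ 2 by near: n; exact: population_spectrum.
have [LhS LhE] : (forall i j : 'I_p.+1, (i <= j)%N -> Lamhat n w 0 j <= Lamhat n w 0 i) /\
    char_poly (gram (S n w *m X n)) = \prod_(i < p.+1) ('X - (Lamhat n w 0 i)%:P).
  by move: w E1 {E0 E2 E3}; near: n.
have [_ fo] : (forall j k : 'I_p.+1, (j < k)%N -> Lamhat n w 0 k < Lamhat n w 0 j) /\
    forall (j : 'I_p.+1) (x : 'cV[R]_p.+1),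
      gram (S n w *m X n) *m x = Lamhat n w 0 j *: x -> dotv x x = 1 ->
      first_order (ell n) (W n w) (C * E n w ^+ 2) j (Lamhat n w 0 j) ((V n)^T *m x).
  move: (Lamhat n w) LhS (fun x => char_poly_prod x LhE) => lam lamS lamE.
  move: w E0 lam lamS lamE {E1 E2 E3 LhE}.
  by near: n; apply: filterS nexp => k Hk w Ew lam; exact: Hk.
have [evj ev1 _] := evP i (gram_sym (S n w *m X n)).
have [+ _ _] := fo i _ evj ev1.
have We : `|W n w i i| <= E n w by move: w {E0 E1 E2 E3 LhS LhE fo evj ev1}; near: n;
  apply: filterS W_le_E => k Hk w; exact: Hk.
have li : 0 < ell n 0 i ^+ 2 by rewrite exprn_gt0.
rewrite LamE; set lh := Lamhat n w 0 i; set l2 := ell n 0 i ^+ 2 in li *.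
have En := E_ge0 w.
move: We En E2 E3; set ee := E n w; set wi := W n w i i => We En E2 E3.
set r := lh / l2 - 1.
have lhE : lh = l2 * (1 + r) by rewrite /r; field; rewrite gt_eqF.
move=> Hr; have Cee : C * ee ^+ 2 <= C * ee by rewrite ler_wpM2l // expr2 ler_piMr.
have rC : `|r| <= (C + 1) * ee.
  have -> : r = (r - wi) + wi by rewrite subrK.
  by apply: le_trans (ler_normD _ _) _; rewrite mulrDl mul1r; lra.
have r2 : `|r| <= 1 / 2.
  apply: le_trans rC _; move: E3; rewrite -[_^-1]mul1r ler_pdivlMr //; lra.
have r1 : 1 / 2 <= 1 + r by move: r2; rewrite ler_norml => /andP[]; lra.
have r10 : 0 < 1 + r by lra.
split; first by rewrite lhE mulr_gt0.
have -> : lh^-1 * (lh - l2) - wi = ((r - wi) - wi * r) / (1 + r).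
  by rewrite lhE; field; rewrite !gt_eqF.
rewrite normrM normrV ?unitfE ?gt_eqF // (gtr0_norm r10) ler_pdivrMr //.
apply: (@le_trans _ _ ((C + (C + 1)) * ee ^+ 2)).
  apply: le_trans (ler_normB _ _) _; rewrite mulrDl; apply: lerD => //.
  rewrite normrM expr2 mulrA mulrC; apply: ler_pM => //.
have : 0 <= (C + (C + 1)) * ee ^+ 2 by rewrite mulr_ge0 ?sqr_ge0 // !addr_ge0.
set z := (C + (C + 1)) * ee ^+ 2 => z0.
by rewrite -[X in X * (1 + r)]mulrA -/z mulrAC; nra.
Unshelve. all: by end_near. Qed.

Lemma eigval_coef i : \forall n \near \oo,
  0 < Gmx (U n) (vec_idx i i) (vec_idx i i) /\
  Num.sqrt ((m n)%:R / ((1 - gamma n) * (n%:R * \sum_(k < n) U n k i ^+ 4))) =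
  rate n / Num.sqrt (Gmx (U n) (vec_idx i i) (vec_idx i i)).
Proof.
near=> n.
have /(_ i i)/andP[Gi _] : forall i j : 'I_p.+1,
  c0 <= Gmx (U n) (vec_idx i j) (vec_idx i j) <= C0 by near: n; exact: Gmx_diag_bounds.
have G0 : 0 < Gmx (U n) (vec_idx i i) (vec_idx i i) by exact: lt_le_trans Gi.
have /andP[g0 g1] : 0 < gamma n < 1 by near: n; exact: gamma01.
split => //.
have -> : n%:R * \sum_(k < n) U n k i ^+ 4 = Gmx (U n) (vec_idx i i) (vec_idx i i).
  by rewrite GmxE; congr (_ * _); apply: eq_bigr => k _; ring.
rewrite invfM mulrA sqrtrM ?sqrtrV ?(ltW G0) // divr_ge0 // subr_ge0 ltW.
Unshelve. all: by end_near. Qed.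

Lemma eigval_measurable n i (a : R) :
  measurable_fun setT (fun w => a * ((Lamhat n w 0 i)^-1 * (Lamhat n w 0 i - Lam n 0 i))).
Proof.
exact: (@statistic_measurable n (fun s => a *
  ((eigvals (gram (s *m X n)) 0 i)^-1 * (eigvals (gram (s *m X n)) 0 i - Lam n 0 i)))).
Qed.

(** The form is W_(i, i), whose variance G_(ii)(ii) / rate^2 is the
    normalization in the statistic. *)
Lemma eigval_clt i : cvg_std_normal P (fun n w =>
  Num.sqrt ((m n)%:R / ((1 - gamma n) * (n%:R * \sum_(k < n) U n k i ^+ 4)))
  * ((Lamhat n w 0 i)^-1 * (Lamhat n w 0 i - Lam n 0 i))).
Proof.
pose a (n : nat) : 'cV[R]_q := delta_mx (half_idx i i) 0.
have qa n : qform (DGD (U n)) (a n) = Gmx (U n) (vec_idx i i) (vec_idx i i).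
  by rewrite qform_delta DGD_half_idx.
have := form_clt (a := a) _.
under eq_near do rewrite qa.
have nc := eigval_coef i.
move=> /(_ (filterS (fun n => @proj1 _ _) nc)) H0.
apply: (slutsky _ _ H0).
- apply: nearW => n; exact: (@statistic_measurable n (fun S => rate n /
    Num.sqrt (qform (DGD (U n)) (a n)) *
    dotv (a n) (half_vec ((U n)^T *m S^T *m S *m U n - 1%:M)))).
- by apply: nearW => n; exact: eigval_measurable.
have [C [C00 nlin]] := eigval_linearization i.
apply: (aas_squeeze (C := C / Num.sqrt c0) _ rateE2_cvg0).
have nc' : \forall n \near \oo, forall w : T n,
    [/\ forall j k : 'I_p.+1, c0 <= Gmx (U n) (vec_idx j k) (vec_idx j k) <= C0,
      0 < Gmx (U n) (vec_idx i i) (vec_idx i i) &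
      Num.sqrt ((m n)%:R / ((1 - gamma n) * (n%:R * \sum_(k < n) U n k i ^+ 4))) =
      rate n / Num.sqrt (Gmx (U n) (vec_idx i i) (vec_idx i i))].
  by apply: filterS2 Gmx_diag_bounds nc => n G0 [G1 G2].
have nc2 := near_aas P nc'.
apply: (aas_apply2 _ nlin nc2) => n w.
move=> [_ lin] [/(_ i i)/andP[Gi _] G0 cE]; rewrite /on_total /= cE qa.
rewrite {1}/a dotv_delta half_vec_sym ?Wsym // -mulrBr -normrN -mulrN opprB normrM.
have rn : 0 <= rate n by exact: sqrtr_ge0.
rewrite ger0_norm ?divr_ge0 ?sqrtr_ge0 //.
rewrite [X in _ <= _ * X]ger0_norm; last by rewrite mulr_ge0 // sqr_ge0.
have -> : C / Num.sqrt c0 * (rate n * E n w ^+ 2) =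
   (rate n / Num.sqrt c0) * (C * E n w ^+ 2) by ring.
apply: ler_pM => //; first by rewrite divr_ge0 ?sqrtr_ge0.
by rewrite ler_wpM2l // lef_pV2 ?posrE ?sqrtr_gt0 // ler_sqrt // ltW.
Qed.

(** * Studentized eigenvalues *)

Hypothesis iid : \forall n \near \oo, iid_bernoulli (B n) (gamma n).
Hypothesis leverage : forall Phi : 'M[R]_p.+1,
    (forall i j : 'I_p.+1, (j < i)%N -> Phi i j = 0) -> Phi != 0 ->
    (fun n => (\big[Num.max/0]_(i < n) qform Phi (row i (U n))^T ^+ 2)
              / (\sum_(i < n) qform Phi (row i (U n))^T ^+ 2)) @ \oo --> (0 : R).

(** From S X v = l u one reads off u = S U (L V^T v) / l, and L V^T v / l is close
    to the i-th unit vector by the expansion of the eigenvector. The fourth power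
    removes the sign of u, and the square root of n / m. *)
Lemma left_vector_expansion i : exists e C : R, [/\ 0 < e, 0 <= C &
  \forall n \near \oo, forall w (U' : 'M[R]_(n, p.+1)) (l' : 'rV[R]_p.+1) (V' : 'M[R]_p.+1),
    E n w <= e -> thin_svd (S n w *m X n) U' l' V' ->
    exists2 z : 'I_p.+1 -> R, forall k, `|z k - (k == i)%:R| <= C * E n w &
      forall j, U' j i ^+ 4 =
        (n%:R / (m n)%:R) ^+ 2 * (B n j w)%:R * (\sum_k U n j k * z k) ^+ 4].
Proof.
have [e0 [C [e00 C00 nexp]]] := sample_expansion.
have [K [eta [K1 eta0 sep]]] := spaced_near.
pose th := K ^+ 2 / eta.
have th0 : 0 <= th by rewrite divr_ge0 ?sqr_ge0 // ltW.
have K0 : 0 <= K by apply: le_trans K1.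
pose e := Num.min e0 (Num.min 1 (2 * (C + 1))^-1).
have C1 : 0 < 2 * (C + 1) by rewrite mulr_gt0 // ltr_wpDl.
exists e, (2 * (C + (C + 1)) + 2 * K * (C + th)); split.
- by rewrite !lt_min e00 ltr01 invr_gt0.
- apply: addr_ge0; first by rewrite mulr_ge0 // !addr_ge0.
  by rewrite mulr_ge0 ?mulr_ge0 ?addr_ge0.
apply: filter_app nexp; apply: filter_app W_le_E; near=> n => HW Hexp w U' l' V'; rewrite !le_min => /and3P[E0 E2 E3].
move=> [U'U' V'V' l'S l'0 SXE].
have [[_ _ _ _ XE] ell0] : thin_svd (X n) (U n) (ell n) (V n) /\ forall i, 0 < ell n 0 i by near: n.
have sepn : spaced K eta (ell n) by near: n.
pose lam : 'rV[R]_p.+1 := \row_k l' 0 k ^+ 2.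
have gE : gram (S n w *m X n) = V' *m diag_mx lam *m V'^T.
  rewrite SXE /gram !trmx_mul trmxK tr_diag_mx -!mulmxA (mulmxA U'^T) U'U' mul1mx.
  rewrite !mulmxA -[V' *m _ *m diag_mx l']mulmxA mulmx_diag.
  by congr (_ *m diag_mx _ *m _); apply/rowP => k; rewrite !mxE expr2.
have lamE x : \prod_(k < p.+1) (x - lam 0 k) = \det (x%:M - gram (S n w *m X n)).
  rewrite gE det_orthogonal_conj //.
  have -> : x%:M - diag_mx lam = diag_mx (\row_k (x - lam 0 k)).
    apply/matrixP => j k; rewrite [LHS]mxE [X in _ + X]mxE !mxE.
    by case: eqP => [->|_]; rewrite ?mulr1n ?mulr0n ?subr0.
  by rewrite det_diag; apply: eq_bigr => k _; rewrite [RHS]mxE.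
have lamS (j k : 'I_p.+1) : (j <= k)%N -> lam 0 k <= lam 0 j.
  by move=> jk; rewrite !mxE lerXn2r ?nnegrE // l'S.
have V'x : V'^T *m (V' *m delta_mx i 0) = delta_mx i 0 :> 'cV[R]_p.+1.
  by rewrite mulmxA V'V' mul1mx.
have diag_delta (u : 'rV[R]_p.+1) :
    diag_mx u *m delta_mx i 0 = u 0 i *: delta_mx i 0 :> 'cV[R]_p.+1.
  apply/matrixP => j k; rewrite mul_diag_mx !mxE.
  by case: eqP => [->|_]; rewrite ?mulr0.
pose x : 'cV[R]_p.+1 := V' *m delta_mx i 0.
have eigx : gram (S n w *m X n) *m x = lam 0 i *: x.
  by rewrite gE -mulmxA V'x -mulmxA diag_delta -scalemxAr.
have x1 : dotv x x = 1.
  by rewrite {2}/x dotv_mulmx V'x dotv_delta mxE !eqxx.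
have [_ fo] := Hexp w lam E0 lamS lamE.
have [Hr Hy Hk] := fo i x eigx x1.
set y := (V n)^T *m x in Hr Hy Hk.
have We j k : `|W n w j k| <= E n w := HW w j k.
set s := pos_sign (y i 0) in Hy Hk.
have s4 : s ^+ 4 = 1 by rewrite /s /pos_sign; case: ifP => _; ring.
have En := E_ge0 w.
move: Hr Hy Hk En E2 E3 (We i i) (We ^~ i) => {We} + + + + + + Wii Wi.
rewrite /lam mxE; set ee := E n w in Wii Wi *.
set wi := W n w i i in Wii *; set t := l' 0 i.
set r := t ^+ 2 / ell n 0 i ^+ 2 - 1.
move=> Hr Hy Hk En E2 E3; clearbody ee.
have li := ell0 i.
have Cee : C * ee ^+ 2 <= C * ee by rewrite ler_wpM2l // expr2 ler_piMr.
have rC : `|r| <= (C + 1) * ee.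
  have -> : r = (r - wi) + wi by rewrite subrK.
  by apply: le_trans (ler_normD _ _) _; rewrite mulrDl mul1r; lra.
have r2 : `|r| <= 1 / 2.
  apply: le_trans rC _; move: E3; rewrite -[_^-1]mul1r ler_pdivlMr //; lra.
pose rt := t / ell n 0 i.
have rt0 : 0 <= rt by rewrite divr_ge0 ?l'0 // ltW.
have rtE : rt ^+ 2 = 1 + r by rewrite /rt /r; field; rewrite gt_eqF.
have rt1 : 1 / 2 <= rt.
  by move: r2; rewrite ler_norml => /andP[]; move: rtE rt0; nra.
have rtr : `|rt - 1| <= `|r|.
  have {1}-> : r = rt ^+ 2 - 1 by rewrite rtE addrAC subrr add0r.
  have -> : rt ^+ 2 - 1 = (rt - 1) * (rt + 1) by ring.
  rewrite normrM ler_peMr // ger0_norm; lra.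
have t0 : 0 < t by rewrite -(divfK (lt0r_neq0 li) t) -/rt mulr_gt0 //; lra.
have rtV : rt^-1 <= 2 by rewrite -[leRHS]invrK lef_pV2 ?posrE ?invr_gt0 //; lra.
exists (fun k => ell n 0 k * (s * y k 0) / t).
  move=> k; have tE : t = rt * ell n 0 i by rewrite /rt divfK // gt_eqF.
  have [->|ki] := eqVneq k i.
    have -> : ell n 0 i * (s * y i 0) / t - 1 = ((s * y i 0 - 1) - (rt - 1)) / rt.
      by rewrite tE; field; rewrite !gt_eqF //; lra.
    rewrite normrM [X in _ * X]ger0_norm ?invr_ge0 //.
    apply: (@le_trans _ _ ((C + (C + 1)) * ee * 2)).
      apply: ler_pM; rewrite ?invr_ge0 //.
      apply: le_trans (ler_normB _ _) _; rewrite mulrDl; apply: lerD.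
        exact: le_trans Hy Cee.
      exact: le_trans rtr rC.
    have : 0 <= 2 * K * (C + th) * ee by rewrite !mulr_ge0 // addr_ge0.
    by rewrite [X in _ -> _ <= X]mulrDl; lra.
  have -> : ell n 0 k * (s * y k 0) / t - 0 = (ell n 0 k / ell n 0 i) * (s * y k 0) / rt.
    by rewrite tE; field; rewrite !gt_eqF //; lra.
  rewrite normrM [X in _ * X]ger0_norm ?invr_ge0 // normrM.
  have lk : `|ell n 0 k / ell n 0 i| <= K.
    case: sepn => _ /(_ k i) lK _; rewrite ger0_norm ?divr_ge0 ?(ltW (ell0 _)) //.
    by rewrite ler_pdivrMr.
  have yk : `|s * y k 0| <= (C + th) * ee.
    have {1}-> : s * y k 0 = (s * y k 0 - ell n 0 k * ell n 0 i /
        (ell n 0 i ^+ 2 - ell n 0 k ^+ 2) * W n w k i) +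
        ell n 0 k * ell n 0 i / (ell n 0 i ^+ 2 - ell n 0 k ^+ 2) * W n w k i.
      by rewrite subrK.
    apply: le_trans (ler_normD _ _) _; rewrite mulrDl; apply: lerD.
      exact: le_trans (Hk k ki) Cee.
    rewrite normrM; apply: ler_pM => //; exact: spaced_ratio K1 eta0 sepn _ _ ki.
  apply: (@le_trans _ _ (K * ((C + th) * ee) * 2)).
    by apply: ler_pM; rewrite ?mulr_ge0 ?invr_ge0 //; apply: ler_pM.
  have : 0 <= 2 * (C + (C + 1)) * ee by rewrite !mulr_ge0 // !addr_ge0.
  by rewrite [X in _ -> _ <= X]mulrDl; lra.
move=> j.
have Uj : t * U' j i = Num.sqrt (n%:R / (m n)%:R) * (B n j w)%:R *
    \sum_k U n j k * (ell n 0 k * y k 0).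
  have : S n w *m X n *m x = t *: (U' *m delta_mx i 0).
    by rewrite SXE -mulmxA V'x -mulmxA diag_delta -scalemxAr.
  rewrite XE => /(congr1 (fun M : 'cV[R]_n => M j 0)); rewrite -colE.
  rewrite -!mulmxA -/y /S /subsample_mx -scalemxAl mxE mul_diag_mx mxE.
  rewrite [RHS]mxE [X in _ = _ * X]mxE => <-.
  rewrite -mulrA; congr (_ * (_ * _)); first by rewrite mxE.
  rewrite mxE; apply: eq_bigr => k _.
  by rewrite mul_diag_mx mxE.
have -> : \sum_k U n j k * (ell n 0 k * (s * y k 0) / t) =
    s / t * \sum_k U n j k * (ell n 0 k * y k 0).
  by rewrite mulr_sumr; apply: eq_bigr => k _; ring.
set sm := \sum_k _ in Uj *.
have -> : U' j i = Num.sqrt (n%:R / (m n)%:R) * (B n j w)%:R * sm / t.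
  by rewrite -Uj mulrC mulKf // gt_eqF.
rewrite !exprMn s4 mul1r; have -> : Num.sqrt (n%:R / (m n)%:R) ^+ 4 =
    (n%:R / (m n)%:R) ^+ 2 :> R.
  by rewrite -[4%N]/(2 * 2)%N exprM sqr_sqrtr // divr_ge0.
have -> : (B n j w)%:R ^+ 4 = (B n j w)%:R :> R.
  by case: (B n j w); rewrite ?expr1n ?expr0n.
ring.
Unshelve. all: by end_near. Qed.

(** The leverage condition for the matrix with a single entry 1 at (i, i). *)
Lemma leverage_coord i : (fun n => (\big[Num.max/0]_(j < n) U n j i ^+ 4)
  / (\sum_(j < n) U n j i ^+ 4)) @ \oo --> (0 : R).
Proof.
have := @leverage (delta_mx i i).
have -> : delta_mx i i != 0 :> 'M[R]_p.+1.
  by apply/eqP => /matrixP/(_ i i)/eqP; rewrite !mxE !eqxx oner_eq0.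
have up (j k : 'I_p.+1) : (k < j)%N -> (delta_mx i i : 'M[R]_p.+1) j k = 0.
  by rewrite mxE; case: eqP => // ->; case: eqP => // ->; rewrite ltnn.
have q4 n (j : 'I_n) : qform (delta_mx i i) (row j (U n))^T ^+ 2 = U n j i ^+ 4.
  rewrite /qform dotvE (bigD1 i) //= big1 ?addr0 => [|k ki]; last first.
    rewrite [X in _ * X]mxE big1 ?mulr0 // => l _.
    by rewrite mxE (negbTE ki) mul0r.
  rewrite [X in _ * X]mxE (bigD1 i) //= big1 ?addr0 => [|k ki]; last first.
    by rewrite mxE (negbTE ki) andbF mul0r.
  by rewrite !mxE !eqxx mul1r -expr2 -exprM.
move=> /(_ up isT); apply: cvg_trans; apply: near_eq_cvg; apply: nearW => n /=.
by congr (_ / _); apply: eq_bigr => j _; rewrite q4.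
Qed.

Lemma sum_pow4 i : \forall n \near \oo, [/\ (0 < n)%N,
  n%:R * \sum_(j < n) U n j i ^+ 4 = Gmx (U n) (vec_idx i i) (vec_idx i i),
  c0 <= n%:R * \sum_(j < n) U n j i ^+ 4 <= C0 &
  0 < \sum_(j < n) U n j i ^+ 4].
Proof.
near=> n.
have n0 : (0 < n)%N.
  have mn' : (m n < n)%N by near: n.
  exact: leq_trans mn'.
have Gi : c0 <= Gmx (U n) (vec_idx i i) (vec_idx i i) <= C0.
  by move: i; near: n; apply: filterS Gmx_diag_bounds => n Hn i; exact: Hn.
have GE : n%:R * \sum_(j < n) U n j i ^+ 4 = Gmx (U n) (vec_idx i i) (vec_idx i i).
  by rewrite GmxE; congr (_ * _); apply: eq_bigr => k _; ring.
split; rewrite ?GE //.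
rewrite -(@pmulr_rgt0 _ n%:R) ?ltr0n // GE.
by case/andP: Gi => /(lt_le_trans c00).
Unshelve. all: by end_near. Qed.

Section studentization.
Variables (i : 'I_p.+1) (g0 : R).
Hypothesis g00 : 0 < g0.
Hypothesis gamma_low : \forall n \near \oo, g0 < gamma n.

Let s4 n := \sum_(j < n) U n j i ^+ 4.

(** The weights U_(j, i)^4 / s4 sum to 1 and their maximum tends to 0 by the leverage
    condition, so the weighted sample frequency concentrates around gamma. *)
Lemma sampled_pow4_cvg : on_total (fun n w =>
  \sum_j U n j i ^+ 4 / s4 n * (B n j w)%:R / gamma n) @ aas P --> (1 : R).
Proof.
apply/cvgrPdist_le => eps eps0 e e0.
have b0 : 0 < e * eps ^+ 2 * g0 by rewrite !mulr_gt0 // exprn_gt0.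
have /cvgr0Pnorm_le/(_ _ b0) nb := leverage_coord i.
near=> n.
have /andP[gn0 gn1] : 0 < gamma n < 1 by near: n; exact: gamma01.
have gl : g0 < gamma n by near: n.
have iidn : iid_bernoulli (B n) (gamma n) by near: n.
have [_ _ _ sn] : [/\ (0 < n)%N,
  n%:R * \sum_(j < n) U n j i ^+ 4 = Gmx (U n) (vec_idx i i) (vec_idx i i),
  c0 <= n%:R * \sum_(j < n) U n j i ^+ 4 <= C0 &
  0 < \sum_(j < n) U n j i ^+ 4] by near: n; exact: sum_pow4.
pose b := (\big[Num.max/0]_(j < n) U n j i ^+ 4) / s4 n.
have bn : b <= e * eps ^+ 2 * g0.
  by rewrite /b; apply: le_trans (ler_norm _) _; near: n; exact: nb.
have ab j : 0 <= U n j i ^+ 4 / s4 n <= b.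
  have U4 : 0 <= U n j i ^+ 4 by rewrite -[4%N]/(2 * 2)%N exprM sqr_ge0.
  rewrite divr_ge0 ?(ltW sn) //= ler_pM2r ?invr_gt0 //.
  exact: (le_bigmax _ (fun j => U n j i ^+ 4) j).
have a1 : \sum_j U n j i ^+ 4 / s4 n = 1 by rewrite -mulr_suml mulfV // gt_eqF.
have [D [mD PD HD]] := bernoulli_lln gn0 (ltW gn1) iidn ab a1 eps0.
exists D; split => //; last by move=> w /HD; rewrite distrC.
apply: le_trans PD _; rewrite lee_fin ler_pdivrMr ?exprn_gt0 // ler_pdivrMr //.
apply: le_trans bn _; rewrite ler_wpM2l ?(ltW gl) //.
by rewrite mulr_ge0 ?exprn_ge0 // ltW.
Unshelve. all: by end_near. Qed.

Variables (Ut : forall n : nat, T n -> 'M[R]_(n, p.+1))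
  (Lt : forall n : nat, T n -> 'rV[R]_p.+1)
  (Vt : forall n : nat, T n -> 'M[R]_p.+1).
Local Arguments Ut : clear implicits.
Local Arguments Lt : clear implicits.
Local Arguments Vt : clear implicits.
Hypothesis svd_sample : \forall n \near \oo, forall w : T n,
  thin_svd (S n w *m X n) (Ut n w) (Lt n w) (Vt n w).

Let st4 n (w : T n) := \sum_(j < n) Ut n w j i ^+ 4.
Local Arguments st4 : clear implicits.

(** The expansion of the left singular vector costs an error of order E, because
    sum_j (sum_k |U_(j, k)|)^4 is of order 1 / n like s4. *)
Lemma left_pow4_cvg :
  on_total (fun n w => gamma n * st4 n w / s4 n) @ aas P --> (1 : R).
Proof.
have [e [C [e0 C0' nexp]]] := left_vector_expansion i.
pose N : R := p.+1%:R.
pose C' := g0^-1 * (16 * C * (N ^+ 4 * (C0 / c0))).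
pose e' := Num.min e (C + 1)^-1.
have C1 : 0 < C + 1 by rewrite ltr_wpDl.
have D0 : on_total (fun n w => gamma n * st4 n w / s4 n -
    \sum_j U n j i ^+ 4 / s4 n * (B n j w)%:R / gamma n) @ aas P --> (0 : R).
  apply: (aas_squeeze (C := C') _ E_cvg0).
  apply: (aas_small_E (e := e')); first by rewrite lt_min e0 invr_gt0.
  apply: filter_app nexp; near=> n => Hexp w; rewrite le_min => /andP[Ee E1].
  have /andP[gn0 gn1] : 0 < gamma n < 1 by near: n; exact: gamma01.
  have gl : g0 < gamma n by near: n.
  have [n0 _ /andP[sl _] sn] : [/\ (0 < n)%N,
    n%:R * \sum_(j < n) U n j i ^+ 4 = Gmx (U n) (vec_idx i i) (vec_idx i i),
    c0 <= n%:R * \sum_(j < n) U n j i ^+ 4 <= C0 &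
    0 < \sum_(j < n) U n j i ^+ 4] by near: n; exact: sum_pow4.
  have Gk k : n%:R * \sum_(j < n) U n j k ^+ 4 <= C0.
    have /(_ k k)/andP[_] : forall i j : 'I_p.+1,
      c0 <= Gmx (U n) (vec_idx i j) (vec_idx i j) <= C0 by near: n; exact: Gmx_diag_bounds.
    rewrite GmxE (eq_bigr (fun j => U n j k ^+ 4)) // => j _; ring.
  have svdn : thin_svd (S n w *m X n) (Ut n w) (Lt n w) (Vt n w).
    by move: w {Ee E1}; near: n.
  have [z zC UE] := Hexp w _ _ _ Ee svdn.
  have CE1 : C * E n w <= 1.
    apply: (@le_trans _ _ (C * (C + 1)^-1)); first by rewrite ler_wpM2l.
    by rewrite ler_pdivrMr // mul1r lerDl.
  have n0' : 0 < n%:R :> R by rewrite ltr0n.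
  have m0 : 0 < (m n)%:R :> R by rewrite -(divfK (lt0r_neq0 n0') (m n)%:R) mulr_gt0.
  have -> : gamma n * st4 n w / s4 n -
      \sum_j U n j i ^+ 4 / s4 n * (B n j w)%:R / gamma n =
      (gamma n)^-1 * (\sum_j (B n j w)%:R *
        ((\sum_k U n j k * z k) ^+ 4 - U n j i ^+ 4)) / s4 n.
    rewrite /st4 mulr_sumr mulr_suml -sumrB mulr_sumr mulr_suml.
    apply: eq_bigr => j _; rewrite UE /gamma; field.
    by rewrite !gt_eqF.
  have En := E_ge0 w; rewrite [leRHS](_ : _ = C' * E n w); last by rewrite ger0_norm.
  rewrite !normrM [X in X * _ * _]ger0_norm ?invr_ge0 ?(ltW gn0) //.
  rewrite [X in _ * _ * X]ger0_norm ?invr_ge0 ?(ltW sn) //.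
  have sumM : \sum_j (\sum_k `|U n j k|) ^+ 4 <= N ^+ 4 * (C0 / n%:R).
    apply: (@le_trans _ _ (\sum_(j < n) N ^+ 3 * \sum_k U n j k ^+ 4)).
      apply: ler_sum => j _; apply: le_trans (pow4_sum_le _) _.
      rewrite ler_wpM2l ?exprn_ge0 //; apply: ler_sum => k _.
      by rewrite -normrX ger0_norm // -[4%N]/(2 * 2)%N exprM sqr_ge0.
    rewrite -mulr_sumr exchange_big /= [N ^+ 4]exprSr -mulrA ler_wpM2l ?exprn_ge0 //.
    rewrite /N mulr_natl -[X in _ <= _ *+ X]card_ord -sumr_const.
    by apply: ler_sum => k _; rewrite ler_pdivlMr // mulrC.
  have key : `|\sum_j (B n j w)%:R * ((\sum_k U n j k * z k) ^+ 4 - U n j i ^+ 4)|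
      <= 16 * (C * E n w) * (N ^+ 4 * (C0 / n%:R)).
    apply: le_trans (ler_norm_sum _ _ _) _.
    apply: (@le_trans _ _ (\sum_j 16 * (C * E n w) * (\sum_k `|U n j k|) ^+ 4)).
      apply: ler_sum => j _; rewrite normrM.
      apply: le_trans _ (pow4_perturb (U n j) CE1 zC).
      by rewrite ler_piMl //; case: (B n j w); rewrite ?normr1 ?normr0.
    rewrite -mulr_sumr ler_wpM2l // mulr_ge0 // mulr_ge0 //.
  have -> : C' * E n w = g0^-1 * (16 * (C * E n w) * (N ^+ 4 * (C0 / n%:R))) * (n%:R / c0).
    by rewrite /C'; field; rewrite !gt_eqF.
  have sV : (s4 n)^-1 <= n%:R / c0.
    rewrite -[leRHS]invrK lef_pV2 ?posrE ?invr_gt0 ?divr_gt0 //.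
    by rewrite invf_div ler_pdivrMr // mulrC.
  apply: ler_pM => //; rewrite ?mulr_ge0 ?invr_ge0 ?(ltW sn) ?(ltW gn0) //.
  apply: ler_pM => //; rewrite ?invr_ge0 ?(ltW gn0) //.
  by rewrite lef_pV2 ?posrE // ltW.
have := cvgD D0 sampled_pow4_cvg; rewrite add0r.
set L := on_total _; set M := on_total _ => LM.
have <- : L + M = on_total (fun n w => gamma n * st4 n w / s4 n).
  by apply/funext => x; rewrite /L /M /on_total fctE /= subrK.
exact: LM.
Unshelve. all: by end_near. Qed.

Hypothesis Ut_measurable : \forall n \near \oo, forall (j : 'I_n) (k : 'I_p.+1),
  measurable_fun setT (fun w : T n => Ut n w j k).

(** The ratio of the two normalizations is (gamma * st4 / s4)^(-1/2), which tends
    to 1 in probability. *)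
Lemma eigval_clt_studentized : cvg_std_normal P (fun n w =>
  (Num.sqrt ((1 - gamma n) * \sum_(j < n) Ut n w j i ^+ 4))^-1
  * ((Lamhat n w 0 i)^-1 * (Lamhat n w 0 i - Lam n 0 i))).
Proof.
pose coef n := Num.sqrt ((m n)%:R / ((1 - gamma n) * (n%:R * s4 n))).
pose coeft n (w : T n) := (Num.sqrt ((1 - gamma n) * st4 n w))^-1.
pose rat n (w : T n) := coeft n w / coef n.
have nc : \forall n \near \oo, coef n != 0 /\
    forall w, rat n w = (Num.sqrt (gamma n * st4 n w / s4 n))^-1.
  near=> n.
  have /andP[gn0 gn1] : 0 < gamma n < 1 by near: n; exact: gamma01.
  have [n0 _ _ sn] : [/\ (0 < n)%N,
    n%:R * \sum_(j < n) U n j i ^+ 4 = Gmx (U n) (vec_idx i i) (vec_idx i i),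
    c0 <= n%:R * \sum_(j < n) U n j i ^+ 4 <= C0 &
    0 < \sum_(j < n) U n j i ^+ 4] by near: n; exact: sum_pow4.
  have n0' : 0 < n%:R :> R by rewrite ltr0n.
  have g1 : 0 < 1 - gamma n by rewrite subr_gt0.
  have cE : coef n = Num.sqrt (gamma n / ((1 - gamma n) * s4 n)).
    have mE : (m n)%:R = gamma n * n%:R by rewrite divfK // gt_eqF.
    by rewrite /coef mE; congr Num.sqrt; field; rewrite !gt_eqF.
  have gs : 0 < gamma n / ((1 - gamma n) * s4 n) by rewrite divr_gt0 // mulr_gt0.
  split; first by rewrite cE gt_eqF // sqrtr_gt0.
  move=> w; rewrite /rat /coeft cE -invfM -sqrtrM; last first.
    rewrite mulr_ge0 ?(ltW g1) // sumr_ge0 // => j _.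
    by rewrite -[4%N]/(2 * 2)%N exprM sqr_ge0.
  congr (Num.sqrt _)^-1; field; rewrite !gt_eqF //.
have rat1 : on_total rat @ aas P --> (1 : R).
  apply: (aas_eq_cvg (E := fun n w => (Num.sqrt (gamma n * st4 n w / s4 n))^-1)).
    apply: (@near_aas R d T P (fun n w => rat n w = (Num.sqrt (gamma n * st4 n w / s4 n))^-1)).
    by apply: filterS nc => n [].
  rewrite -[X in _ --> X]invr1 -[X in X^-1]sqrtr1.
  apply: cvgV; first by rewrite sqrtr1 oner_neq0.
  apply: (cvg_comp _ _ left_pow4_cvg); exact: sqrt_continuous.
have mcoeft : \forall n \near \oo, measurable_fun setT (coeft n).
  apply: filterS Ut_measurable => n mU.
  have ms : measurable_fun setT (fun w => (1 - gamma n) * st4 n w).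
    by apply: measurable_funM => //; apply: measurable_sum => j; exact: measurable_funX.
  have msq : measurable_fun setT (@Num.sqrt R).
    by apply: continuous_measurable_fun; exact: sqrt_continuous.
  exact: measurableT_comp measurable_inv (measurableT_comp msq ms).
have mstat : \forall n \near \oo, measurable_fun setT (fun w => coeft n w *
    ((Lamhat n w 0 i)^-1 * (Lamhat n w 0 i - Lam n 0 i))).
  apply: filterS mcoeft => n mcn; apply: measurable_funM => //.
  by have := eigval_measurable (n := n) i 1; under eq_fun do rewrite mul1r.
have stE : \forall n \near \oo, forall w, coef n *
    ((Lamhat n w 0 i)^-1 * (Lamhat n w 0 i - Lam n 0 i)) * rat n w =
    coeft n w * ((Lamhat n w 0 i)^-1 * (Lamhat n w 0 i - Lam n 0 i)).
  apply: filterS nc => n [cn _] w.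
  by rewrite /rat mulrAC [coef n * _]mulrC divfK.
have mstat' : \forall n \near \oo, measurable_fun setT (fun w => coef n *
    ((Lamhat n w 0 i)^-1 * (Lamhat n w 0 i - Lam n 0 i)) * rat n w).
  by apply: filterS2 mstat stE => n mn' En; under eq_fun do rewrite En.
have m1 : \forall n \near \oo, measurable_fun setT (fun w => coef n *
    ((Lamhat n w 0 i)^-1 * (Lamhat n w 0 i - Lam n 0 i))).
  by apply: nearW => n; exact: eigval_measurable.
have c1 := cvg_std_normal_mul m1 mstat' (eigval_clt i) rat1.
apply: (cvg_std_normal_near_eq mstat' mstat c1).
exact: (@near_aas R d T P (fun n w => coef n *
    ((Lamhat n w 0 i)^-1 * (Lamhat n w 0 i - Lam n 0 i)) * rat n w =
    coeft n w * ((Lamhat n w 0 i)^-1 * (Lamhat n w 0 i - Lam n 0 i)))).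
Unshelve. all: by end_near. Qed.

End studentization.

(** * Central limit theorem for the eigenvectors *)

Lemma Gmx_norm_le n (U' : 'M[R]_(n, p.+1)) i k l :
  `|Gmx U' (vec_idx i k) (vec_idx i l)| <=
  (Gmx U' (vec_idx i k) (vec_idx i k) + Gmx U' (vec_idx i l) (vec_idx i l)) / 2.
Proof.
rewrite !GmxE normrM normr_nat -mulrDr -mulrA ler_wpM2l //.
apply: le_trans (ler_norm_sum _ _ _) _; rewrite -big_split /= mulr_suml.
apply: ler_sum => h _; rewrite ler_norml.
set a := U' h i; set b := U' h k; set b' := U' h l.
have s1 : 0 <= (a * (b - b')) ^+ 2 by exact: sqr_ge0.
have s2 : 0 <= (a * (b + b')) ^+ 2 by exact: sqr_ge0.
by apply/andP; split; lra.
Qed.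

Section eigenvectors.
Variables (i : 'I_p.+1) (c : 'cV[R]_p.+1) (dl : R).
Let v n k := ev k (gram (X n)).
Let vhat n (w : T n) k := ev k (gram (S n w *m X n)).
Local Arguments vhat : clear implicits.
Hypothesis c1 : dotv c c = 1.
Hypothesis VE : \forall n \near \oo, forall k, col k (V n) = v n k.

Let al n (w : T n) k := align_sign (v n k) (vhat n w k).
Local Arguments al : clear implicits.
Let beta n := eigvec_coef (Lam n) (v n) i c.

Lemma beta_near : \forall n \near \oo, forall k, k != i -> beta n k =
  ell n 0 k * ell n 0 i / (ell n 0 i ^+ 2 - ell n 0 k ^+ 2) * dotv c (v n k).
Proof.
near=> n => k ki.
have [_ ell0] : thin_svd (X n) (U n) (ell n) (V n) /\ forall i, 0 < ell n 0 i by near: n.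
have [_ LamE] : (forall j k : 'I_p.+1, (j < k)%N -> Lam n 0 k < Lam n 0 j) /\
  forall j, Lam n 0 j = ell n 0 j ^+ 2 by near: n; exact: population_spectrum.
rewrite /beta /eigvec_coef (negbTE ki) !LamE -exprMn sqrtr_sqr ger0_norm.
  by rewrite [ell n 0 i * _]mulrC.
by rewrite mulr_ge0 // ltW.
Unshelve. all: by end_near. Qed.

(** As V is orthogonal with columns v_k, the expansion of the coordinates V^T vhat_k
    becomes one of dot products; aligning vhat_k with v_k is the choice of sign made
    in [first_order]. *)
Lemma eigvec_linearization : exists e C : R, [/\ 0 < e, 0 <= C &
  \forall n \near \oo, forall w, E n w <= e ->
  [/\ forall j k : 'I_p.+1, (j < k)%N -> Lamhat n w 0 k < Lamhat n w 0 j,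
      forall k, `|Lamhat n w 0 k / ell n 0 k ^+ 2 - 1| <= C * E n w,
      forall k (x : 'cV[R]_p.+1), dotv x x = 1 ->
        `|dotv x (al n w k) - dotv x (v n k)| <= C * E n w &
      `|dotv c (al n w i - v n i) - \sum_k beta n k * W n w k i|
        <= C * E n w ^+ 2]].
Proof.
have [e0 [C [e00 C00 nexp]]] := sample_expansion.
have [e1 e10 nlam] := Lamhat_spec.
have [K [eta [K1 eta0 sep]]] := spaced_near.
pose th := K ^+ 2 / eta.
have th0 : 0 <= th by rewrite divr_ge0 ?sqr_ge0 // ltW.
pose N : R := p.+1%:R.
have N1 : 1 <= N by rewrite ler1n.
exists (Num.min (Num.min e0 e1) 1), (N * (C + 1 + th)); split.
- by rewrite !lt_min e00 e10 ltr01.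
- by rewrite mulr_ge0 // !addr_ge0.
apply: filter_app nexp; apply: filter_app nlam; apply: filter_app W_le_E; near=> n => HW Hlam Hexp w.
rewrite !le_min => /andP[/andP[E0 E1] E2].
have [[_ VV _ _ _] ell0] : thin_svd (X n) (U n) (ell n) (V n) /\ forall i, 0 < ell n 0 i by near: n.
have VV' := mulmx1C VV.
have sepn : spaced K eta (ell n) by near: n.
have bE : forall k, k != i -> beta n k =
  ell n 0 k * ell n 0 i / (ell n 0 i ^+ 2 - ell n 0 k ^+ 2) * dotv c (v n k).
  by near: n; exact: beta_near.
have VEn : forall k, col k (V n) = v n k by near: n.
have [LhS LhE] := Hlam w E1.
have [distinct fo] := Hexp w _ E0 LhS (fun x => char_poly_prod x LhE).
have En := E_ge0 w; have We j k : `|W n w j k| <= E n w := HW w j k.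
have EE : E n w ^+ 2 <= E n w by rewrite expr2 ler_piMl.
have coordV (x : 'cV[R]_p.+1) k : ((V n)^T *m x) k 0 = dotv (v n k) x.
  by rewrite -VEn dotvE [LHS]mxE; apply: eq_bigr => j _; rewrite !mxE.
have foj j : first_order (ell n) (W n w) (C * E n w ^+ 2) j (Lamhat n w 0 j)
    ((V n)^T *m vhat n w j).
  by have [ev_eq ev1 _] := evP j (gram_sym (S n w *m X n)); exact: fo.
have ratio k j : j != k -> `|ell n 0 j * ell n 0 k / (ell n 0 k ^+ 2 - ell n 0 j ^+ 2)| <= th.
  exact: spaced_ratio.
have dotV x y : dotv x y = \sum_j dotv (v n j) x * dotv (v n j) y.
  rewrite -[x in LHS]mul1mx -VV' -mulmxA dotvC dotv_mulmx dotvC dotvE.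
  by apply: eq_bigr => j _; rewrite !coordV.
have vv j k : dotv (v n j) (v n k) = (j == k)%:R.
  by rewrite -coordV -VEn colE mulmxA VV mul1mx mxE eqxx andbT.
have alE j k : dotv (v n j) (al n w k) =
    pos_sign (dotv (v n k) (vhat n w k)) * dotv (v n j) (vhat n w k).
  by rewrite /al align_signE dotvZr.
have alk k : `|dotv (v n k) (al n w k) - 1| <= C * E n w ^+ 2.
  by have [_ + _] := foj k; rewrite alE !coordV.
have alj k j : j != k -> `|dotv (v n j) (al n w k)
    - ell n 0 j * ell n 0 k / (ell n 0 k ^+ 2 - ell n 0 j ^+ 2) * W n w j k|
    <= C * E n w ^+ 2.
  by have [_ _ + jk] := foj k => /(_ j jk); rewrite alE !coordV.
have unit_coord x j : dotv x x = 1 -> `|dotv (v n j) x| <= 1.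
  move=> x1; rewrite -(@ler_pXn2r _ 2) ?nnegrE // real_normK ?num_real // expr1n.
  rewrite -x1 [leRHS]dotV (bigD1 j) //= -expr2 lerDl sumr_ge0 // => l _.
  by rewrite -expr2 sqr_ge0.
split=> //.
- move=> k; have [+ _ _] := foj k => Hk.
  have -> : Lamhat n w 0 k / ell n 0 k ^+ 2 - 1 =
    (Lamhat n w 0 k / ell n 0 k ^+ 2 - 1 - W n w k k) + W n w k k by ring.
  apply: le_trans (ler_normD _ _) _; apply: le_trans (lerD Hk (We k k)) _.
  have CE : C * E n w ^+ 2 <= C * E n w by rewrite ler_wpM2l.
  apply: le_trans (lerD CE (lexx _)) _.
  have -> : C * E n w + E n w = 1 * ((C + 1) * E n w) by ring.
  rewrite -[X in _ <= X]mulrA; apply: ler_pM => //; first by rewrite mulr_ge0 ?addr_ge0.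
  by rewrite ler_wpM2r // lerDl.
- move=> k x x1; rewrite -dotvBr dotV -mulrA [leRHS]mulr_natl -[X in _ <= _ *+ X]card_ord -sumr_const.
  apply: le_trans (ler_norm_sum _ _ _) _; apply: ler_sum => j _.
  rewrite normrM -[leRHS]mul1r ler_pM ?unit_coord // dotvBr vv.
  have CE : C * E n w ^+ 2 <= C * E n w by rewrite ler_wpM2l.
  have thE : 0 <= th * E n w by rewrite mulr_ge0.
  have [->|jk] := eqVneq j k; first by apply: le_trans (alk k) _; lra.
  rewrite subr0; set a := dotv _ _; pose b := ell n 0 j * ell n 0 k / (ell n 0 k ^+ 2 - ell n 0 j ^+ 2) * W n w j k.
  have aE : a = (a - b) + b by rewrite subrK.
  rewrite aE; apply: le_trans (ler_normD _ _) _.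
  apply: le_trans (lerD (alj k j jk) (_ : `|b| <= th * E n w)) _; last by lra.
  by rewrite /b normrM ler_pM // ratio.
rewrite dotvBr; set sb := \sum_k _.
have -> : dotv c (al n w i) - dotv c (v n i) - sb = \sum_j dotv (v n j) c *
    (dotv (v n j) (al n w i) - (j == i)%:R - if j == i then 0 else
      ell n 0 j * ell n 0 i / (ell n 0 i ^+ 2 - ell n 0 j ^+ 2) * W n w j i).
  rewrite !dotV /sb -!sumrB; apply: eq_bigr => j _; rewrite vv !mulrBr.
  have [->|ji] := eqVneq j i.
    by rewrite /beta /eigvec_coef eqxx mul0r mulr0.
  by rewrite bE // (dotvC c); ring.
rewrite -mulrA [leRHS]mulr_natl -[X in _ <= _ *+ X]card_ord -sumr_const.
apply: le_trans (ler_norm_sum _ _ _) _; apply: ler_sum => j _.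
rewrite normrM -[leRHS]mul1r ler_pM ?unit_coord //.
apply: (@le_trans _ _ (C * E n w ^+ 2)).
  by have [->|ji] := eqVneq j i; rewrite subr0 ?alk // alj.
by rewrite ler_wpM2r ?sqr_ge0 // -addrA lerDl addr_ge0.
Unshelve. all: by end_near. Qed.
Let s2 n := qform (Deltamx (Lam n) (v n) (Gmx (U n)) i) c.
Let s2h n (w : T n) := qform (Deltamx (Lamhat n w) (al n w) (Gmx (U n)) i) c.
Local Arguments s2h : clear implicits.

(** Eigenvalues and aligned eigenvectors move by O(E), hence so do the coefficients
    [eigvec_coef], and the variance is a quadratic form in them whose entries
    G_(ik)(il) are at most C0. *)
Lemma variance_perturb : exists e C : R, [/\ 0 < e, 0 <= C &
  \forall n \near \oo, forall w, E n w <= e ->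
    (forall k, 0 <= Lamhat n w 0 k) /\ `|s2h n w - s2 n| <= C * E n w].
Proof.
have [e0 [C [e00 C00 nlin]]] := eigvec_linearization.
have [K [eta [K1 eta0 sep]]] := spaced_near.
have K0 : 0 <= K by apply: le_trans K1.
pose th := K ^+ 2 / eta.
have th0 : 0 <= th by rewrite divr_ge0 ?sqr_ge0 // ltW.
(* Bounds a b, a^2 and b^2 relative to |a^2 - b^2|, for two singular values. *)
pose M := K * th.
have M0 : 0 <= M by rewrite mulr_ge0.
have thM : th <= M by rewrite ler_peMl.
pose C2 := 2 * (2 * M * (3 + 2 * M) * C) + th * C.
have C20 : 0 <= C2.
  have M3 : 0 <= 3 + 2 * M by rewrite addr_ge0 // mulr_ge0.
  apply: addr_ge0; last exact: mulr_ge0.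
  by do 3 (apply: mulr_ge0 => //); exact: mulr_ge0.
pose e := Num.min (Num.min e0 (C + 1)^-1) (Num.min (4 * M * C + 1)^-1 (C2 + 1)^-1).
have MC : 0 <= 4 * M * C by do 2 (apply: mulr_ge0 => //).
pose N : R := p.+1%:R.
exists e, (N * (N * ((C2 * (th + 1) + th * C2) * C0))); split.
- by rewrite !lt_min e00 !invr_gt0 !ltr_wpDl.
- have th1 : 0 <= th + 1 by rewrite addr_ge0.
  have C0' : 0 <= C0 by rewrite ltW // (lt_trans c00).
  by do 3 (apply: mulr_ge0 => //); apply: addr_ge0; apply: mulr_ge0.
apply: filter_app nlin; near=> n => Hlin w; rewrite !le_min => /andP[/andP[E0 E1] /andP[E2 E3]].
have [distinct lamE vecE' _] := Hlin w E0.
have [_ ell0] : thin_svd (X n) (U n) (ell n) (V n) /\ forall i, 0 < ell n 0 i by near: n.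
have sepn : spaced K eta (ell n) by near: n.
have [_ ellK _] := sepn.
have bE : forall k, k != i -> beta n k =
  ell n 0 k * ell n 0 i / (ell n 0 i ^+ 2 - ell n 0 k ^+ 2) * dotv c (v n k).
  by near: n; exact: beta_near.
have Gb : forall i j : 'I_p.+1, c0 <= Gmx (U n) (vec_idx i j) (vec_idx i j) <= C0.
  by near: n; exact: Gmx_diag_bounds.
have [_ LamE] : (forall j k : 'I_p.+1, (j < k)%N -> Lam n 0 k < Lam n 0 j) /\
  forall j, Lam n 0 j = ell n 0 j ^+ 2 by near: n; exact: population_spectrum.
have VVn : forall k, dotv (v n k) (v n k) = 1.
  by move=> k; have [_ + _] := evP k (gram_sym (X n)).
have En := E_ge0 w.
have small x : 0 <= x -> E n w <= (x + 1)^-1 -> x * E n w <= 1.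
  move=> x0 Ex; apply: (@le_trans _ _ (x * (x + 1)^-1)); first by rewrite ler_wpM2l.
  by rewrite ler_pdivrMr ?mul1r ?lerDl // ltr_wpDl.
have CE1 := small _ C00 E1.
have CE2 := small _ MC E2.
have CE3 := small _ C20 E3.
have GC k l : `|Gmx (U n) (vec_idx i k) (vec_idx i l)| <= C0.
  apply: le_trans (Gmx_norm_le _ _ _ _) _.
  by have := Gb i k; have := Gb i l => /andP[_ ?] /andP[_ ?]; lra.
pose r k := Lamhat n w 0 k / ell n 0 k ^+ 2 - 1.
have LhE k : Lamhat n w 0 k = ell n 0 k ^+ 2 * (1 + r k).
  by rewrite /r; field; rewrite gt_eqF.
have Lh0 k : 0 <= Lamhat n w 0 k.
  rewrite LhE mulr_ge0 ?sqr_ge0 //; have := lamE k; rewrite ler_norml => /andP[+ _].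
  by rewrite -/(r k); lra.
have kap1 k : `|dotv c (v n k)| <= 1.
  have cs : dotv c (v n k) ^+ 2 <= 1.
    have : 0 <= dotv (c - dotv c (v n k) *: v n k) (c - dotv c (v n k) *: v n k).
      exact: dotv_ge0.
    set t := dotv c (v n k); rewrite dotvBr dotvZr dotvC dotvBr c1 dotvZr -/t.
    by rewrite dotvC dotvBr dotvZr VVn dotvC -/t expr2; lra.
  by rewrite -(@ler_pXn2r _ 2) ?nnegrE // real_normK ?num_real // expr1n.
pose bh := eigvec_coef (Lamhat n w) (al n w) i c.
have ratio k : k != i -> `|ell n 0 i * ell n 0 k / (ell n 0 i ^+ 2 - ell n 0 k ^+ 2)| <= th.
  by move=> ki; rewrite [ell n 0 i * _]mulrC; exact: spaced_ratio.
have bth k : `|beta n k| <= th.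
  have [->|ki] := eqVneq k i; first by rewrite /beta /eigvec_coef eqxx normr0.
  by rewrite bE // normrM -[leRHS]mulr1 ler_pM // [ell n 0 k * _]mulrC ratio.
have bhb k : `|bh k - beta n k| <= C2 * E n w.
  have [->|ki] := eqVneq k i.
    by rewrite /bh /beta /eigvec_coef eqxx subrr normr0 mulr_ge0.
  rewrite bE // /bh /eigvec_coef (negbTE ki) [ell n 0 k * _]mulrC !LhE.
  have D0 : ell n 0 i ^+ 2 - ell n 0 k ^+ 2 != 0.
    have := sepn => -[_ _ gap].
    rewrite subr_sqr mulf_neq0 //; last by rewrite gt_eqF // addr_gt0.
    have : (k < i)%N || (i < k)%N by rewrite -neq_ltn.
    have e1 j : ell n 0 j < (1 + eta) * ell n 0 j by rewrite ltr_pMl // ltrDl.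
    by case/orP => /gap/(lt_le_trans (e1 _)) ee; [rewrite lt_eqF|rewrite gt_eqF] => //; rewrite ?subr_lt0 ?subr_gt0.
  have Dn : 0 < `|ell n 0 i ^+ 2 - ell n 0 k ^+ 2| by rewrite normr_gt0.
  have abD : ell n 0 i * ell n 0 k <= th * `|ell n 0 i ^+ 2 - ell n 0 k ^+ 2|.
    have := ratio k ki; rewrite normrM normrV ?unitfE // ler_pdivrMr //.
    by rewrite ger0_norm // mulr_ge0 // ltW.
  have sqM a b : 0 < a -> a <= K * b -> a * b = ell n 0 i * ell n 0 k ->
      a ^+ 2 <= M * `|ell n 0 i ^+ 2 - ell n 0 k ^+ 2|.
    move=> a0 ab abE; apply: (@le_trans _ _ (K * (a * b))).
      by rewrite expr2 mulrCA ler_wpM2l // ltW.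
    by rewrite abE -mulrA ler_wpM2l.
  have iM := sqM _ _ (ell0 i) (ellK i k) erefl.
  have kM := sqM _ _ (ell0 k) (ellK k i) (mulrC _ _).
  have CEM : 4 * M * (C * E n w) <= 1 by rewrite mulrA.
  have := eigvec_coef_perturb (ell0 i) (ell0 k) D0 iM kM
    (le_trans (ratio k ki) thM) (lamE i) (lamE k) CE1 CEM.
  rewrite -/(r i) -/(r k).
  set qh := Num.sqrt _ / _; set q0 := ell n 0 i * _ / _ => qD.
  have q0th : `|q0| <= th := ratio k ki.
  move: qh q0 qD q0th => qh q0 qD q0th.
  have kh : `|dotv c (al n w k)| <= 2.
    have -> : dotv c (al n w k) =
      (dotv c (al n w k) - dotv c (v n k)) + dotv c (v n k) by rewrite subrK.
    apply: le_trans (ler_normD _ _) _.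
    by apply: le_trans (lerD (vecE' k c c1) (kap1 k)) _; lra.
  have -> : qh * dotv c (al n w k) - q0 * dotv c (v n k) =
    (qh - q0) * dotv c (al n w k) + q0 * (dotv c (al n w k) - dotv c (v n k)) by ring.
  apply: le_trans (ler_normD _ _) _; rewrite !normrM.
  have -> : C2 * E n w = 2 * M * (3 + 2 * M) * (C * E n w) * 2 + th * (C * E n w).
    by rewrite /C2; ring.
  apply: lerD; first exact: ler_pM.
  by apply: ler_pM => //; exact: vecE'.
have bhth k : `|bh k| <= th + 1.
  have -> : bh k = beta n k + (bh k - beta n k) by rewrite addrC subrK.
  apply: le_trans (ler_normD _ _) _; apply: lerD => //.
  exact: le_trans (bhb k) CE3.
split=> //; rewrite /s2h /s2 !qform_Deltamx //; last first.
  by move=> k; rewrite LamE sqr_ge0.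
rewrite !qform_col_form -sumrB.
pose z := (C2 * (th + 1) + th * C2) * E n w.
have -> : N * (N * ((C2 * (th + 1) + th * C2) * C0)) * E n w = N * (N * (z * C0)).
  by rewrite /z; ring.
rewrite [leRHS]mulr_natl -[X in _ <= _ *+ X]card_ord -sumr_const.
apply: le_trans (ler_norm_sum _ _ _) _; apply: ler_sum => k _.
rewrite -sumrB [leRHS]mulr_natl -[X in _ <= _ *+ X]card_ord -sumr_const.
apply: le_trans (ler_norm_sum _ _ _) _; apply: ler_sum => l _.
rewrite -/bh -/(beta n) -mulrBl normrM ler_pM //.
have -> : bh k * bh l - beta n k * beta n l =
  (bh k - beta n k) * bh l + beta n k * (bh l - beta n l) by ring.
have -> : z =
  (C2 * E n w) * (th + 1) + th * (C2 * E n w) by rewrite /z; ring.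
by apply: le_trans (ler_normD _ _) _; rewrite !normrM; apply: lerD; apply: ler_pM.
Unshelve. all: by end_near. Qed.

Hypothesis dl0 : 0 < dl.
Hypothesis var_low : \forall n \near \oo, dl < s2 n.

Let stat n (w : T n) (y : 'I_p.+1 -> 'cV[R]_p.+1) :=
  rate n * inv_sqrt_ereal (Delta_form (Lamhat n w) y (Gmx (U n)) i c)
  * dotv c (y i - v n i).
Local Arguments stat : clear implicits.

(** The statistic normalized by the true variance. *)
Lemma eigvec_clt_oracle :
  cvg_std_normal P (fun n w => rate n / Num.sqrt (s2 n) * dotv c (al n w i - v n i)).
Proof.
have s2E : \forall n \near \oo, s2 n = qform (DGD (U n)) (col_form (beta n) i).
  near=> n; rewrite /s2 qform_Deltamx // => k.
  have [_ ->] : (forall j k : 'I_p.+1, (j < k)%N -> Lam n 0 k < Lam n 0 j) /\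
    forall j, Lam n 0 j = ell n 0 j ^+ 2 by near: n; exact: population_spectrum.
  exact: sqr_ge0.
have a0 : \forall n \near \oo, 0 < qform (DGD (U n)) (col_form (beta n) i).
  by apply: filterS2 s2E var_low => n <-; exact: lt_trans.
apply: (slutsky _ _ (form_clt a0)).
- apply: nearW => n; exact: (@statistic_measurable n (fun s => rate n /
    Num.sqrt (qform (DGD (U n)) (col_form (beta n) i)) *
    dotv (col_form (beta n) i) (half_vec ((U n)^T *m s^T *m s *m U n - 1%:M)))).
- apply: nearW => n; exact: (@statistic_measurable n (fun s => rate n /
    Num.sqrt (s2 n) * dotv c (align_sign (v n i) (ev i (gram (s *m X n))) - v n i))).
have [e [C [e0 C00 nlin]]] := eigvec_linearization.
apply: (aas_squeeze (C := C / Num.sqrt dl) _ rateE2_cvg0).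
apply: (aas_small_E e0); apply: filterS3 nlin s2E var_low => n Hlin {}s2E s2n w Ew.
have [_ _ _ lin] := Hlin w Ew.
rewrite -s2E col_formE ?Wsym // -mulrBr normrM distrC.
have rn : 0 <= rate n by exact: sqrtr_ge0.
rewrite ger0_norm ?divr_ge0 ?sqrtr_ge0 //.
rewrite [X in _ <= _ * X]ger0_norm; last by rewrite mulr_ge0 // sqr_ge0.
have -> : C / Num.sqrt dl * (rate n * E n w ^+ 2) =
   (rate n / Num.sqrt dl) * (C * E n w ^+ 2) by ring.
apply: ler_pM => //; first by rewrite divr_ge0 ?sqrtr_ge0.
have s20 : 0 < s2 n by exact: lt_trans s2n.
by rewrite ler_wpM2l // lef_pV2 ?posrE ?sqrtr_gt0 // ler_sqrt // ltW.
Unshelve. all: by end_near. Qed.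

Lemma variance_ratio_cvg : on_total (fun n w => s2h n w / s2 n) @ aas P --> (1 : R).
Proof.
have [e [C [e0 C00 nvar]]] := variance_perturb.
have D0 : on_total (fun n w => s2h n w / s2 n - 1) @ aas P --> (0 : R).
  apply: (aas_squeeze (C := C / dl) _ E_cvg0).
  apply: (aas_small_E e0); apply: filterS2 var_low nvar => n s2n Hvar w /Hvar[_ D].
  have s20 : 0 < s2 n by exact: lt_trans s2n.
  have -> : s2h n w / s2 n - 1 = (s2h n w - s2 n) / s2 n by field; rewrite gt_eqF.
  rewrite normrM normrV ?unitfE ?gt_eqF // (gtr0_norm s20).
  rewrite [X in _ <= _ * X]ger0_norm ?E_ge0 //.
  have -> : C / dl * E n w = (C * E n w) / dl by ring.
  apply: ler_pM => //; rewrite ?invr_ge0 ?(ltW s20) //.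
  by rewrite lef_pV2 ?posrE // ltW.
apply: (aas_eq_cvg (E := fun n w => (s2h n w / s2 n - 1) + 1)).
  by apply: nearW => -[n w]; rewrite /on_total /= subrK.
rewrite -[X in _ --> X]add0r; exact: (cvgD D0 (cvg_cst (1 : R))).
Qed.

Lemma eigvec_clt_aligned : cvg_std_normal P (fun n w => stat n w (al n w)).
Proof.
pose rat n (w : T n) := Num.sqrt (s2 n) *
  inv_sqrt_ereal (Delta_form (Lamhat n w) (al n w) (Gmx (U n)) i c).
have [e [C [e0 C00 nlin]]] := eigvec_linearization.
have [e' [C' [e0' C00' nvar]]] := variance_perturb.
pose e1 := Num.min (Num.min e e') (dl / (C' + 1)).
have C1 : 0 < C' + 1 by rewrite ltr_wpDl.
have e10 : 0 < e1 by rewrite !lt_min e0 e0' divr_gt0.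
have ratE : \forall x \near aas P, on_total (fun n w =>
    rat n w = (Num.sqrt (s2h n w / s2 n))^-1) x.
  apply: (aas_small_E e10).
  apply: filterS3 var_low nlin nvar => n s2n Hlin Hvar w; rewrite !le_min => /andP[/andP[Ee Ee'] E1].
  have s20 : 0 < s2 n by exact: lt_trans s2n.
  have [distinct _ _ _] := Hlin w Ee; have [_ D] := Hvar w Ee'.
  have En := E_ge0 w.
  have CE : C' * E n w <= dl.
    apply: (@le_trans _ _ ((C' + 1) * E n w)); first by rewrite ler_wpM2r // lerDl.
    by rewrite mulrC -ler_pdivlMr.
  have sh0 : 0 < s2h n w by move: D; rewrite ler_norml => /andP[D _]; lra.
  rewrite /rat Delta_form_fin // -/(s2h n w) inv_sqrt_erealE //.
  by rewrite sqrtrM ?(ltW sh0) // sqrtrV ?(ltW s20) // invfM invrK mulrC.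
have rat1 : on_total rat @ aas P --> (1 : R).
  apply: (aas_eq_cvg ratE).
  rewrite -[X in _ --> X]invr1 -[X in X^-1]sqrtr1.
  apply: cvgV; first by rewrite sqrtr1 oner_neq0.
  by apply: (cvg_comp _ _ variance_ratio_cvg); exact: sqrt_continuous.
have m1 : \forall n \near \oo, measurable_fun setT (fun w =>
    rate n / Num.sqrt (s2 n) * dotv c (al n w i - v n i)).
  apply: nearW => n; exact: (@statistic_measurable n (fun s => rate n /
    Num.sqrt (s2 n) * dotv c (align_sign (v n i) (ev i (gram (s *m X n))) - v n i))).
have m2 : \forall n \near \oo, measurable_fun setT (fun w =>
    rate n / Num.sqrt (s2 n) * dotv c (al n w i - v n i) * rat n w).
  apply: nearW => n; exact: (@statistic_measurable n (fun s => rate n /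
    Num.sqrt (s2 n) * dotv c (align_sign (v n i) (ev i (gram (s *m X n))) - v n i) *
    (Num.sqrt (s2 n) * inv_sqrt_ereal (Delta_form (eigvals (gram (s *m X n)))
      (fun k => align_sign (v n k) (ev k (gram (s *m X n)))) (Gmx (U n)) i c)))).
have m3 : \forall n \near \oo, measurable_fun setT (fun w => stat n w (al n w)).
  apply: nearW => n; exact: (@statistic_measurable n (fun s => rate n *
    inv_sqrt_ereal (Delta_form (eigvals (gram (s *m X n)))
      (fun k => align_sign (v n k) (ev k (gram (s *m X n)))) (Gmx (U n)) i c)
    * dotv c (align_sign (v n i) (ev i (gram (s *m X n))) - v n i))).
apply: (cvg_std_normal_near_eq m2 m3 (cvg_std_normal_mul m1 m2 eigvec_clt_oracle rat1)).
apply: (@near_aas R d T P (fun n w => rate n / Num.sqrt (s2 n) *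
  dotv c (al n w i - v n i) * rat n w = stat n w (al n w))).
apply: filterS var_low => n s2n w; have s20 : 0 < Num.sqrt (s2 n) by rewrite sqrtr_gt0 (lt_trans dl0).
by rewrite /rat /stat; field; rewrite gt_eqF.
Qed.

Lemma first_nonzero_ge0 (x : 'cV[R]_p.+1) : first_nonzero_pos x -> 0 <= x ord0 0.
Proof.
move=> [k [xk below]]; have [k0|k0] := posnP k; last by rewrite below.
have -> : ord0 = k by exact: val_inj.
exact: ltW.
Qed.

(** The first coordinate of the aligned sample eigenvector differs from that of v_k
    by O(E), which is negligible since E / v_k0 = rate E / (rate v_k0) tends to 0. It
    is therefore positive, and so the alignment changes no sign. *)
Lemma aligned_sample_eigvec k :
  (fun n => rate n * v n k ord0 0) @ \oo --> +oo ->
  \forall x \near aas P, on_total (fun n w => vhat n w k = al n w k) x.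
Proof.
move=> vk.
have [e [C [e0 C00 nlin]]] := eigvec_linearization.
have rv0 : (fun n => (rate n * v n k ord0 0)^-1) @ \oo --> (0 : R).
  apply/gtr0_cvgV0; last exact: vk.
  by have /cvgryPgt := vk; exact.
have C1 : 0 < (C + 1)^-1 by rewrite invr_gt0 ltr_wpDl.
have q0 := tight_mul_cvg0 (D := fun n _ => (rate n * v n k ord0 0)^-1)
  rateE_tight (@cvg_aas R d T P _ 0 rv0).
have /cvgryPgt/(_ 0) vk0 := vk.
have lin : \forall x \near aas P, on_total (fun n w =>
    0 < rate n * v n k ord0 0 /\ `|al n w k ord0 0 - v n k ord0 0| <= C * E n w) x.
  apply: (aas_small_E e0); apply: filter_app nlin.
  apply: filterS vk0 => n vn Hlin w /Hlin[_ _ + _] => /(_ k (delta_mx ord0 0)).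
  by rewrite !dotv_delta mxE !eqxx => /(_ erefl).
have nq' : \forall x \near aas P, on_total (E := Prop) (fun n w =>
    `|rate n * E n w * (rate n * v n k ord0 0)^-1| <= (C + 1)^-1) x.
  exact: ((cvgr0Pnorm_le _).1 q0 _ C1).
apply: (aas_apply2 _ lin nq') => n w [rv0' alE] Q; have En := E_ge0 w.
have [rn vn] : 0 < rate n /\ 0 < v n k ord0 0.
  have r0 : 0 <= rate n := sqrtr_ge0 _.
  have rn : 0 < rate n.
    by rewrite lt_def r0 andbT; apply: contraTneq rv0' => ->; rewrite mul0r ltxx.
  by split=> //; rewrite -(pmulr_rgt0 _ rn).
have Ev : (C + 1) * E n w <= v n k ord0 0.
  move: Q; rewrite invfM mulrACA mulfV ?gt_eqF // mul1r => /(le_trans (ler_norm _)).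
  rewrite ler_pdivrMr // => Q; apply: (@le_trans _ _ ((C + 1) * ((C + 1)^-1 * v n k ord0 0))).
    by rewrite ler_wpM2l // addr_ge0.
  by rewrite mulrA mulfV ?mul1r // gt_eqF // ltr_wpDl.
have al0 : 0 < al n w k ord0 0.
  move: alE; rewrite ler_norml => /andP[+ _].
  have [->|E0] := eqVneq (E n w) 0; first by rewrite mulr0; lra.
  have : 0 < E n w by rewrite lt_def E0 En.
  by move: Ev; rewrite mulrDl mul1r; lra.
have vh0 : 0 <= vhat n w k ord0 0.
  by have [_ _] := evP k (gram_sym (S n w *m X n)); exact: first_nonzero_ge0.
move: al0; rewrite /al align_signE /pos_sign; case: ifP => _; rewrite ?scale1r //.
by rewrite scaleN1r mxE oppr_gt0 ltNge vh0.
Qed.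

(** The eigenvectors with the first nonzero coordinate positive eventually coincide
    with the aligned ones; for p <= 1 this is only known for v_i, but then the
    coefficients enter the variance through a single square. *)
Lemma eigvec_clt_signed :
  (forall k : 'I_p.+1, (k == i) || (1 < p)%N ->
    (fun n => rate n * v n k ord0 0) @ \oo --> +oo) ->
  cvg_std_normal P (fun n w => stat n w (vhat n w)).
Proof.
move=> vk.
have [e [C [e0 C00 nlin]]] := eigvec_linearization.
have [e' [C' [e0' C00' nvar]]] := variance_perturb.
have e10 : 0 < Num.min e e' by rewrite lt_min e0 e0'.
have A1 : \forall x \near aas P, on_total (fun n w => forall k : 'I_p.+1,
    (k == i) || (1 < p)%N -> vhat n w k = al n w k) x.
  have nk (k : 'I_p.+1) : \forall x \near aas P, (k == i) || (1 < p)%N ->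
      on_total (fun n w => vhat n w k = al n w k) x.
    have [kp|kp] := boolP ((k == i) || (1 < p)%N); last by apply: nearW.
    have nk := aligned_sample_eigvec (vk k kp); by apply: (filterS _ nk) => x Hx _.
  by apply: (filterS _ (filter_forall _ nk)) => -[n w].
have A2 : \forall x \near aas P, on_total (fun n w =>
    (forall j k : 'I_p.+1, (j < k)%N -> Lamhat n w 0 k < Lamhat n w 0 j) /\
    (forall k, 0 <= Lamhat n w 0 k)) x.
  apply: (aas_small_E e10); apply: filter_app nvar.
  apply: filterS nlin => n Hlin Hvar w; rewrite le_min => /andP[Ee Ee'].
  by split; [have [] := Hlin w Ee|have [] := Hvar w Ee'].
apply: (cvg_std_normal_near_eq _ _ eigvec_clt_aligned).
- apply: nearW => n; exact: (@statistic_measurable n (fun s => rate n *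
    inv_sqrt_ereal (Delta_form (eigvals (gram (s *m X n)))
      (fun k => align_sign (v n k) (ev k (gram (s *m X n)))) (Gmx (U n)) i c)
    * dotv c (align_sign (v n i) (ev i (gram (s *m X n))) - v n i))).
- apply: nearW => n; exact: (@statistic_measurable n (fun s => rate n *
    inv_sqrt_ereal (Delta_form (eigvals (gram (s *m X n)))
      (fun k => ev k (gram (s *m X n))) (Gmx (U n)) i c)
    * dotv c (ev i (gram (s *m X n)) - v n i))).
apply: (aas_apply2 _ A1 A2) => n w eqv [distinct Lh0].
rewrite /stat (eqv i) ?eqxx // !Delta_form_fin // !qform_Deltamx // !qform_col_form.
congr (_ * inv_sqrt_ereal (_%:E) * _).
apply: eq_bigr => k _; apply: eq_bigr => l _; congr (_ * _).
rewrite /eigvec_coef; have [_|ki] := eqVneq k i; first by rewrite !mul0r.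
have [_|li] := eqVneq l i; first by rewrite !mulr0.
have [p1|p1] := ltnP 1 p; first by rewrite !eqv ?p1 ?orbT.
(* With at most two eigenvectors k and l coincide, and signs cancel. *)
have <- : k = l.
  have le1 (j : 'I_p.+1) : (j <= 1)%N by apply: leq_trans p1; rewrite -ltnS.
  apply/val_inj; move: (le1 k) (le1 l) (le1 i) ki li; rewrite -!val_eqE /=.
  by case: (nat_of_ord k) => [|[|?]] //; case: (nat_of_ord l) => [|[|?]] //;
    case: (nat_of_ord i) => [|[|?]].
rewrite /al align_signE dotvZr /pos_sign.
by case: ifP => _; ring.
Qed.

End eigenvectors.

End subsampled_svd.

(* The dimension p of the paper is p.+1 here, so that the first and last
   singular values are indexed by ord0 and ord_max. *)
Theorem mainTheorem13 (R : realType) (p : nat)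
  (d : nat -> measure_display) (T : forall n : nat, measurableType (d n))
  (P : forall n : nat, probability (T n) R)
  (m : nat -> nat)
  (B : forall n : nat, 'I_n -> {RV (P n) >-> bool})
  (X U : forall n : nat, 'M[R]_(n, p.+1))
  (ell : nat -> 'rV[R]_p.+1) (V : nat -> 'M[R]_p.+1)
  (ev : 'I_p.+1 -> 'M[R]_p.+1 -> 'cV[R]_p.+1)
  (c0 C0 : R)
  (gamma := fun n : nat => (m n)%:R / n%:R : R)
  (S := fun (n : nat) (w : T n) =>
    subsample_mx (m n) (fun i => B n i w) : 'M[R]_n)
  (Lam := fun n : nat => eigvals (gram (X n)))
  (Lamhat := fun (n : nat) (w : T n) => eigvals (gram (S n w *m X n)))
  (v := fun (n : nat) (k : 'I_p.+1) => ev k (gram (X n)))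
  (vhat := fun (n : nat) (w : T n) (k : 'I_p.+1) =>
    ev k (gram (S n w *m X n)))
  (rate := fun n : nat => Num.sqrt ((m n)%:R / (1 - gamma n)) : R) :
  (* m_n < n and m_n tends to infinity *)
  (\forall n \near \oo, (m n < n)%N) ->
  m @ \oo --> \oo ->
  (* B_{n,1}, ..., B_{n,n} are i.i.d. Bernoulli(m_n / n) *)
  (\forall n \near \oo, iid_bernoulli (B n) (gamma n)) ->
  (* singular value decomposition of X_n *)
  (\forall n \near \oo, thin_svd (X n) (U n) (ell n) (V n) /\
    forall i, 0 < ell n 0 i) ->
  (limn_esup (fun n => (ell n 0 ord0 / ell n 0 ord_max)%:E) < +oo)%E ->
  (1 < limn_einf (fun n => \big[mine/+oo]_(i < p)
    (ell n 0 (widen_ord (leqnSn p) i) / ell n 0 (lift ord0 i))%:E))%E ->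
  (* choice of the eigenvectors v_i(Xi) *)
  (forall (i : 'I_p.+1) (Xi : 'M[R]_p.+1),
    Xi^T = Xi -> is_eigvec Xi i (ev i Xi)) ->
  (* conditions on U_n *)
  0 < c0 -> c0 < C0 ->
  (\forall n \near \oo,
    loewner_le c0%:M (DGD (U n)) /\ loewner_le (DGD (U n)) C0%:M) ->
  (forall Phi : 'M[R]_p.+1,
    (forall i j : 'I_p.+1, (j < i)%N -> Phi i j = 0) -> Phi != 0 ->
    (fun n => (\big[Num.max/0]_(i < n) qform Phi (row i (U n))^T ^+ 2)
              / (\sum_(i < n) qform Phi (row i (U n))^T ^+ 2)) @ \oo --> (0 : R)) ->
  (* central limit theorem for the subsampled quadratic forms *)
  cvg_std_normal_vec P (fun n w =>
    rate n *: (inv_sqrt_mx (DGD (U n)) *m ((Dmx p.+1)^T *m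
      vec ((U n)^T *m (S n w)^T *m S n w *m U n - 1%:M)))) ->
  forall i : 'I_p.+1,
  [/\ (* eigenvalues, population normalization *)
      cvg_std_normal P (fun n w =>
        Num.sqrt ((m n)%:R
          / ((1 - gamma n) * (n%:R * \sum_(k < n) U n k i ^+ 4)))
        * ((Lamhat n w 0 i)^-1 * (Lamhat n w 0 i - Lam n 0 i))),
      (* eigenvalues, studentized *)
      (forall (Ut : forall n : nat, T n -> 'M[R]_(n, p.+1))
          (Lt : forall n : nat, T n -> 'rV[R]_p.+1)
          (Vt : forall n : nat, T n -> 'M[R]_p.+1),
        (\forall n \near \oo, forall w : T n,
          thin_svd (S n w *m X n) (Ut n w) (Lt n w) (Vt n w)) ->
        (\forall n \near \oo, forall (j : 'I_n) (k : 'I_p.+1),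
          measurable_fun setT (fun w : T n => Ut n w j k)) ->
        (0 < limn_einf (fun n => (gamma n)%:E))%E ->
        cvg_std_normal P (fun n w =>
          (Num.sqrt ((1 - gamma n) * \sum_(j < n) Ut n w j i ^+ 4))^-1
          * ((Lamhat n w 0 i)^-1 * (Lamhat n w 0 i - Lam n 0 i))))
    & (* eigenvectors *)
      (forall (c : 'cV[R]_p.+1)
          (stat := fun (n : nat) (w : T n) (y : 'I_p.+1 -> 'cV[R]_p.+1) =>
            rate n
            * inv_sqrt_ereal (Delta_form (Lamhat n w) y (Gmx (U n)) i c)
            * dotv c (y i - v n i)),
        dotv c c = 1 ->
        (* The cross terms of Delta depend on the joint signs of U_n and of the
           eigenvectors: the columns of V_n are the v_{n,k} themselves. *)
        (\forall n \near \oo, forall k, col k (V n) = v n k) ->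
        (0 < limn_einf (fun n =>
          Delta_form (Lam n) (v n) (Gmx (U n)) i c))%E ->
        (* signs of the sample eigenvectors matched to the population ones *)
        cvg_std_normal P (fun n w =>
          stat n w (fun k => align_sign (v n k) (vhat n w k))) /\
        (* signs fixed by the first nonzero coordinate: false without the
           condition below, e.g. for X_n^T X_n diagonal and i <> 1 *)
        ((forall k : 'I_p.+1, (k == i) || (1 < p)%N ->
            (fun n => rate n * v n k ord0 0) @ \oo --> +oo) ->
          cvg_std_normal P (fun n w => stat n w (vhat n w))))].
Proof.
move=> mn moo iid svd cond gaps evP c00 c0C0 loew leverage clt i; split.
- exact: (eigval_clt mn moo svd cond gaps evP c00 c0C0 loew clt).
- move=> Ut Lt Vt svd_sample Ut_meas gl.
  have [g0 g00 g0l] : exists2 g0 : R, 0 < g0 & (g0%:E < limn_einf (fun n => (gamma n)%:E))%E.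
    move: gl; case: limn_einf => [l|_|//]; last by exists 1; rewrite ?ltry.
    by rewrite lte_fin => l0; exists (l / 2); rewrite ?lte_fin; lra.
  have gamma_low : \forall n \near \oo, g0 < gamma n.
    by apply: filterS (limn_einf_gt_near g0l) => n; rewrite lte_fin.
  exact: (eigval_clt_studentized mn moo svd cond gaps evP c00 c0C0 loew clt iid
    leverage i g00 gamma_low svd_sample Ut_meas).
move=> c stat c1 VE gl.
have [dl dl0 dll] : exists2 dl : R, 0 < dl & (dl%:E < limn_einf (fun n =>
    Delta_form (Lam n) (v n) (Gmx (U n)) i c))%E.
  move: gl; case: limn_einf => [l|_|//]; last by exists 1; rewrite ?ltry.
  by rewrite lte_fin => l0; exists (l / 2); rewrite ?lte_fin; lra.
have var_low : \forall n \near \oo, dl < qform (Deltamx (Lam n) (v n) (Gmx (U n)) i) c.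
  have pop := population_spectrum svd cond gaps evP.
  apply: filterS2 (limn_einf_gt_near dll) pop => n + [distinct _].
  by rewrite Delta_form_fin // lte_fin.
split.
  exact: (eigvec_clt_aligned mn moo svd cond gaps evP c00 c0C0 loew clt c1 VE dl0 var_low).
move=> vk.
exact: (eigvec_clt_signed mn moo svd cond gaps evP c00 c0C0 loew clt c1 VE dl0 var_low vk).
Qed.
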